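(* Let $\Omega\subset\mathbb R^d$ be a bounded Lipschitz domain and $\omega\subset\Omega$ a Lipschitz domain with $\operatorname{dist}(\partial\omega,\partial\Omega)>c_0$ for a constant $c_0>0$. Let $\psi\in L^\infty(\mathbb R^d)$ satisfy the compact support condition (with radius $r_0$) and the $k$-th order moments condition for some integer $k\ge0$, and let $\varepsilon_0>0$ be fixed with $r_0\varepsilon_0\le c_0$. Let $s\in(0,\tfrac12]$ and let $F\in H^{-1}(\Omega)$ satisfy $\operatorname{supp}_{s-1}(F)\subseteq\omega$. Let $u\in V:=H^1_0(\Omega)$ and $\mathtt u^\varepsilon\in V$ be the solutions of $$\mathcal A(u,v)=\langle F,v\rangle_{V',V}\quad\forall v\in V,\qquad \mathcal A(\mathtt u^\varepsilon,v)=\langle F^\varepsilon,v\rangle_{V',V}\quad\forall v\in V .$$ Then, for all $0<\varepsilon\le\varepsilon_0$, $$\|u-\mathtt u^\varepsilon\|_{H^1(\Omega)}\le C\,\varepsilon^{s}\,\|F\|_{H^{s-1}(\omega)},$$ with a constant $C$ independent of $\varepsilon$ and $F$.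
   Context: Here $d\in\{2,3\}$. The bilinear form is $\mathcal A(v,w)=\int_\Omega \nabla v^{T}A(x)\nabla w+c(x)vw\,dx$ for $v,w\in V$, where $A(x)$ is a symmetric $d\times d$ matrix with uniformly bounded entries in $C^1(\overline\Omega)$ and $a_0|\xi|^2\le\xi^TA(x)\xi\le a_1|\xi|^2$ for all $\xi\in\mathbb R^d$, $x\in\overline\Omega$, with constants $a_0,a_1>0$, and $c\in C^{0,1}(\overline\Omega)$ is nonnegative. Compact support condition: $\operatorname{supp}(\psi)\subset B_{r_0}$, the ball of radius $r_0$ centered at $0$, with $r_0>0$. $k$-th order moments condition: $\int_{\mathbb R^d} y_i^\alpha\,\psi(x-y)\,dy = x_i^\alpha$ for all $i=1,\dots,d$, integers $0\le\alpha\le k$, $x\in\mathbb R^d$. For $\varepsilon>0$, $\delta^\varepsilon(x):=\varepsilon^{-d}\psi(x/\varepsilon)$ and, for $v\in L^1(\Omega)$, $v^\varepsilon(x):=\int_\Omega\delta^\varepsilon(x-y)v(y)\,dy$. For $t\ge0$, $H^{-t}(\Omega):=H^t(\Omega)'$ and $H^{-t}(\omega):=H^t(\omega)'$ with dual norms. $\operatorname{supp}_{s-1}(F)\subseteq\omega$ means that $F$ belongs to $H^{s-1}(\omega)$, acting through restriction to $\omega$: there is an element of $H^{s-1}(\omega)$, again denoted $F$, with $\langle F,w\rangle_{H^{-1}(\Omega),H^1(\Omega)}=\langle F,w|_\omega\rangle_{H^{s-1}(\omega),H^{1-s}(\omega)}$ for all $w\in H^1(\Omega)$. The regularization $F^\varepsilon$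 is defined by $\langle F^\varepsilon,w\rangle:=\langle F,w^\varepsilon\rangle$ for $w\in H^1(\Omega)$, the right-hand side being understood as $\langle F,w^\varepsilon|_\omega\rangle_{H^{s-1}(\omega),H^{1-s}(\omega)}$. The symbol $\mathtt u^\varepsilon$ denotes the solution of the regularized problem, not the regularization of $u$. *)

(* Defs.v *)
From HB Require Import structures.
From mathcomp Require Import all_boot all_order all_algebra.
From mathcomp Require Import all_classical all_reals all_analysis.
Set Implicit Arguments.
Unset Strict Implicit.
Unset Printing Implicit Defensive.
Import Order.TTheory GRing.Theory Num.Theory numFieldNormedType.Exports.
Local Open Scope classical_set_scope.
Local Open Scope ring_scope.

(* R^n is 'rV[R]_n; the sigma-algebra generated by the coordinates is the Borel
   one, and the n-dimensional Lebesgue measure is obtained by iterating the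
   product with the one-dimensional measure (see lebesgue_rV_box). *)

Definition rV_display : measure_display.
Proof. exact: default_measure_display. Qed.

Section measurable_rV.
Context {R : realType} (n : nat).

Let coords : 'I_n -> 'rV[R]_n -> R := fun i x => x ord0 i.

Let rV_set0 : g_sigma_preimage coords set0.
Proof. exact: sigma_algebra0. Qed.

Let rV_setC A : g_sigma_preimage coords A -> g_sigma_preimage coords (~` A).
Proof. exact: sigma_algebraC. Qed.

Let rV_bigcup (F : (set 'rV[R]_n)^nat) :
  (forall i, g_sigma_preimage coords (F i)) ->
  g_sigma_preimage coords (\bigcup_i (F i)).
Proof. exact: sigma_algebra_bigcup. Qed.

HB.instance Definition _ := @isMeasurable.Build rV_display 'rV[R]_n
  (g_sigma_preimage coords) rV_set0 rV_setC rV_bigcup.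

End measurable_rV.

Section rV_cons.
Context {R : realType} (n : nat).

Lemma measurable_rV_coord (i : 'I_n) :
  measurable_fun [set: 'rV[R]_n] (fun x => x ord0 i).
Proof.
move=> _ Y mY; rewrite setTI; apply: sub_sigma_algebra => /=.
rewrite -bigcup_seq/=; exists i => /=; first by rewrite mem_index_enum.
by exists Y => //; rewrite setTI.
Qed.

Lemma measurable_to_rV d (T : measurableType d) (f : T -> 'rV[R]_n) :
  (forall i, measurable_fun [set: T] (fun t => f t ord0 i)) ->
  measurable_fun [set: T] f.
Proof.
move=> mf _ A mA; rewrite setTI.
suff : g_sigma_preimage (fun (i : 'I_n) (x : 'rV[R]_n) => x ord0 i)
    `<=` [set B | measurable (f @^-1` B)] by apply.
apply: smallest_sub; first split => /=.
- by rewrite preimage_set0.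
- by move=> B mB; rewrite setTD preimage_setC; exact: measurableC.
- by move=> F mF; rewrite preimage_bigcup; exact: bigcup_measurable.
- move=> B /=; rewrite -bigcup_seq => -[i _ [C mC <-]] /=.
  by rewrite setTI -[X in measurable X]setTI; exact: mf.
Qed.

Definition rV_cons (p : R * 'rV[R]_n) : 'rV[R]_n.+1 :=
  row_mx (p.1%:M : 'rV_1) p.2.

End rV_cons.

Lemma measurable_rV_cons (R : realType) n :
  measurable_fun [set: R * 'rV[R]_n] (@rV_cons R n).
Proof.
apply: measurable_to_rV => i.
case: (@split_ordP 1 n i) => j ->.
  apply: (eq_measurable_fun fst) => [p _|]; last exact: measurable_fst.
  by rewrite /rV_cons (row_mxEl (p.1%:M : 'rV_1)) !ord1 mxE mulr1n.
apply: (eq_measurable_fun ((fun x : 'rV[R]_n => x ord0 j) \o snd)) => [p _|].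
  by rewrite /rV_cons (row_mxEr (p.1%:M : 'rV_1)).
apply: measurableT_comp; [exact: measurable_rV_coord|exact: measurable_snd].
Qed.

Lemma sigma_finite_product_measure d1 d2 (T1 : measurableType d1)
    (T2 : measurableType d2) (R : realType)
    (m1 : {sigma_finite_measure set T1 -> \bar R})
    (m2 : {sigma_finite_measure set T2 -> \bar R}) :
  sigma_finite setT (m1 \x m2)%E.
Proof.
have /sigma_finiteP[F [TF ndF Foo]] := sigma_finiteT m1.
have /sigma_finiteP[G [TG ndG Goo]] := sigma_finiteT m2.
exists (fun n => F n `*` G n).
  rewrite -setXTT TF TG predeqE => -[x y]; split.
    move=> [/= [n _ Fnx] [k _ Gky]]; exists (maxn n k) => //; split.
    - by move: x Fnx; exact/subsetPset/ndF/leq_maxl.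
    - by move: y Gky; exact/subsetPset/ndG/leq_maxr.
  by move=> [n _ []/= ? ?]; split; exists n.
move=> k; have [? ?] := Foo k; have [? ?] := Goo k.
split; first exact: measurableX.
by rewrite product_measure1E// lte_mul_pinfty// ge0_fin_numE.
Qed.

Section rV_cons_measure.
Context {R : realType} (n : nat).
Variable mu : {sigma_finite_measure set 'rV[R]_n -> \bar R}.

Definition rV_cons_measure : set 'rV[R]_n.+1 -> \bar R :=
  pushforward (@lebesgue_measure R \x mu)%E (@rV_cons R n).

Let rV_cons_measure0 : rV_cons_measure set0 = 0%E.
Proof. by rewrite /rV_cons_measure /pushforward preimage_set0 measure0. Qed.

Let rV_cons_measure_ge0 A : (0 <= rV_cons_measure A)%E.
Proof. by rewrite /rV_cons_measure /pushforward; apply: measure_ge0. Qed.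

Let rV_cons_measure_sigma_additive : semi_sigma_additive rV_cons_measure.
Proof.
have mc (A : set 'rV[R]_n.+1) : measurable A -> measurable (@rV_cons R n @^-1` A).
  by move=> mA; rewrite -[X in measurable X]setTI; exact: measurable_rV_cons.
move=> F mF tF mUF; rewrite /rV_cons_measure /pushforward preimage_bigcup.
apply: measure_semi_sigma_additive.
- by move=> k; exact: mc.
- apply/trivIsetP => /= i j _ _ ij; rewrite -preimage_setI.
  by move/trivIsetP : tF => /(_ _ _ _ _ ij) ->//; rewrite preimage_set0.
- by rewrite -preimage_bigcup; exact: mc.
Qed.

HB.instance Definition _ := isMeasure.Build _ _ _ rV_cons_measure
  rV_cons_measure0 rV_cons_measure_ge0 rV_cons_measure_sigma_additive.

Let rV_cons_measure_sigma_finite : sigma_finite setT rV_cons_measure.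
Proof.
have [F TF mF] := sigma_finite_product_measure (@lebesgue_measure R) mu.
pose uncons (x : 'rV[R]_n.+1) : R * 'rV[R]_n :=
  (x ord0 ord0, \row_j x ord0 (lift ord0 j)).
have consK : cancel (@rV_cons R n) uncons.
  move=> [a v]; rewrite /uncons /rV_cons /=; congr pair.
    rewrite (_ : ord0 = lshift n ord0 :> 'I_(1 + n)); last exact/val_inj.
    by rewrite (row_mxEl (a%:M : 'rV_1)) mxE mulr1n.
  apply/rowP => j; rewrite mxE.
  rewrite (_ : lift ord0 j = rshift 1 j :> 'I_(1 + n)); last exact/val_inj.
  by rewrite (row_mxEr (a%:M : 'rV_1)).
have muncons : measurable_fun setT uncons.
  apply/measurable_fun_pairP; split; first exact: measurable_rV_coord.
  apply: measurable_to_rV => j.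
  apply: (eq_measurable_fun (fun x : 'rV[R]_n.+1 => x ord0 (lift ord0 j))).
    by move=> x _; rewrite /= mxE.
  exact: measurable_rV_coord.
exists (fun k => uncons @^-1` F k).
  by rewrite -preimage_bigcup -TF preimage_setT.
move=> k; have [mFk Fkoo] := mF k; split.
  by rewrite -[X in measurable X]setTI; exact: muncons.
rewrite /rV_cons_measure /pushforward -comp_preimage.
by rewrite (_ : uncons \o _ = id)//; apply/funext => p /=; rewrite consK.
Qed.

HB.instance Definition _ := Measure_isSigmaFinite.Build _ _ _ rV_cons_measure
  rV_cons_measure_sigma_finite.

End rV_cons_measure.

Fixpoint lebesgue_rV (R : realType) (n : nat) :
    {sigma_finite_measure set 'rV[R]_n -> \bar R} :=
  match n with
  | 0 => \d_(0 : 'rV[R]_0)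
  | k.+1 => rV_cons_measure (lebesgue_rV R k)
  end.

Lemma lebesgue_rV_box (R : realType) (n : nat)
    (A : 'I_n -> set (measurableTypeR R)) : (forall i, measurable (A i)) ->
  lebesgue_rV R n [set x | forall i, A i (x ord0 i)] =
  (\prod_(i < n) lebesgue_measure (A i))%E.
Proof.
elim: n A => [|n IHn] A mA.
  rewrite big_ord0 (_ : mkset _ = setT) /=; first by rewrite diracT.
  by apply/seteqP; split => // x _ [].
have mB : measurable [set x : 'rV[R]_n | forall j, A (lift ord0 j) (x ord0 j)].
  rewrite (_ : mkset _ = \bigcap_(j in [set: 'I_n])
      ((fun x : 'rV[R]_n => x ord0 j) @^-1` A (lift ord0 j))).
    apply: fin_bigcap_measurable => [|j _]; first exact: finite_finset.
    rewrite -[X in measurable X]setTI.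
    by apply: measurable_rV_coord => //; exact: mA.
  by apply/seteqP; split => x /= h j; [move=> _; exact: h | exact: h].
rewrite big_ord_recl -IHn => [|i]; last by exact: mA.
rewrite -product_measure1E; [|exact: mA|exact: mB].
rewrite [LHS]/= /rV_cons_measure /pushforward; congr (_ _).
have c0 a (v : 'rV[R]_n) : rV_cons (a, v) ord0 ord0 = a.
  rewrite /rV_cons (_ : ord0 = lshift n ord0 :> 'I_(1 + n)); last exact/val_inj.
  by rewrite (row_mxEl (a%:M : 'rV_1)) mxE mulr1n.
have cS a (v : 'rV[R]_n) j : rV_cons (a, v) ord0 (lift ord0 j) = v ord0 j.
  rewrite /rV_cons (_ : lift ord0 j = rshift 1 j :> 'I_(1 + n)).
    by rewrite (row_mxEr (a%:M : 'rV_1)).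
  exact/val_inj.
apply/seteqP; split => -[a v] /=.
  move=> h; split; first by have := h ord0; rewrite c0.
  by move=> j; have := h (lift ord0 j); rewrite cS.
move=> [h0 hS] i; case: (unliftP ord0 i) => [j ->|->]; first by rewrite cS.
by rewrite c0.
Qed.

Section euclidean.
Context {R : realType} (n : nat).
Implicit Types (x y : 'rV[R]_n) (A B : set 'rV[R]_n).

(* The library norm on 'rV[R]_n is the sup norm. *)
Definition enorm x : R := Num.sqrt (\sum_(i < n) x ord0 i ^+ 2).

Definition boundary A : set 'rV[R]_n := closure A `\` interior A.

Definition set_dist A B : \bar R :=
  ereal_inf [set e | exists x y, [/\ A x, B y & e = (enorm (x - y))%:E]].

(* Support of an L^oo function, i.e. up to a null set. *)
Definition ess_supp (f : 'rV[R]_n -> R) : set 'rV[R]_n :=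
  [set x | ~ exists U, [/\ open U, U x &
     {ae lebesgue_rV R n, forall y, U y -> f y = 0}]].

End euclidean.

Definition domain (R : realType) (n : nat) (O : set 'rV[R]_n) : Prop :=
  [/\ open O, connected O & O !=set0].

(* Dimensions are written m.+1 so that the last coordinate and the remaining
   m coordinates of a point make sense. *)
Section domains.
Context {R : realType} {m : nat}.
Local Notation E := 'rV[R]_m.+1.

(* Near every boundary point, in suitable Cartesian coordinates x *m Q, the set
   is the region strictly above the graph of a Lipschitz function. *)
Definition lipschitz_boundary (O : set E) : Prop :=
  forall x0, boundary O x0 ->
  exists (Q : 'M[R]_m.+1) (g : 'rV[R]_m -> R),
    [/\ Q *m Q^T = 1%:M, lipschitz g &
        \forall x \near x0,
          O x <-> g (col' ord_max (x *m Q)) < (x *m Q) ord0 ord_max].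

Definition lipschitz_domain (O : set E) : Prop :=
  domain O /\ lipschitz_boundary O.

End domains.

Section sobolev.
Context {R : realType} {d : nat}.
Local Notation E := 'rV[R]_d.
Local Notation mu := (lebesgue_rV R d).
Implicit Types (O : set E) (u v w f : E -> R).

Definition evec (i : 'I_d) : E := delta_mx ord0 i.

Definition partial (i : 'I_d) f : E -> R := fun x => 'D_(evec i) f x.

Definition smooth f : Prop :=
  forall l : seq 'I_d, let h := foldr partial f l in
    continuous h /\ forall i x, derivable h x (evec i).

Definition test_fun O f : Prop :=
  smooth f /\ exists K, [/\ compact K, K `<=` O & forall x, ~ K x -> f x = 0].

(* Elements of L^2(O), H^1(O), ... are represented by functions on the whole
   space whose values outside O are irrelevant; in particular restriction to a
   subdomain does not change the representative. *)
Definition L2 O f : Prop :=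
  measurable_fun O f /\ (\int[mu]_(x in O) (f x ^+ 2)%:E < +oo)%E.

Definition is_weak_grad O u (g : E -> E) : Prop :=
  (forall i, L2 O (fun x => g x ord0 i)) /\
  forall i f, test_fun O f ->
    \int[mu]_(x in O) (u x * partial i f x) =
    - \int[mu]_(x in O) (g x ord0 i * f x).

Definition H1 O : set (E -> R) :=
  [set u | L2 O u /\ exists g, is_weak_grad O u g].

Definition grad O u : E -> E := xget (cst 0) [set g | is_weak_grad O u g].

Definition H1norm O u : R :=
  Num.sqrt (\int[mu]_(x in O) (u x ^+ 2) +
            \int[mu]_(x in O) (enorm (grad O u x) ^+ 2)).

Definition H10 O : set (E -> R) :=
  [set u | H1 O u /\ forall e : R, 0 < e ->
     exists2 f, test_fun O f & H1norm O (u - f) < e].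

(* Sobolev-Slobodeckij space H^t(O), for 0 < t < 1 *)
Definition gagliardo O (t : R) v : \bar R :=
  (\int[mu]_(x in O) \int[mu]_(y in O)
     ((v x - v y) ^+ 2 / enorm (x - y) `^ (d%:R + 2 * t))%:E)%E.

Definition Hfrac O (t : R) : set (E -> R) :=
  [set v | L2 O v /\ (gagliardo O t v < +oo)%E].

Definition Hfracnorm O (t : R) v : R :=
  Num.sqrt (\int[mu]_(x in O) (v x ^+ 2) + fine (gagliardo O t v)).

(* Topological dual of the space X with seminorm N. Boundedness makes such an F
   insensitive to changes on null sets; its values outside X are irrelevant. *)
Definition in_dual (X : set (E -> R)) (N : (E -> R) -> R) (F : (E -> R) -> R)
    : Prop :=
  (forall (a : R) u v, X u -> X v -> F (a *: u + v) = a * F u + F v) /\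
  exists M : R, forall u, X u -> `|F u| <= M * N u.

Definition dual_norm (X : set (E -> R)) (N : (E -> R) -> R)
    (F : (E -> R) -> R) : R :=
  sup [set r | exists u, [/\ X u, N u <= 1 & r = `|F u|]].

(* H^{-1}(O) = H^1(O)' and H^{-t}(O) = H^t(O)' for 0 < t < 1 *)
Definition Hm1 O : set ((E -> R) -> R) := in_dual (H1 O) (H1norm O).
Definition Hmfrac O (t : R) : set ((E -> R) -> R) :=
  in_dual (Hfrac O t) (Hfracnorm O t).
Definition Hmfracnorm O (t : R) : ((E -> R) -> R) -> R :=
  dual_norm (Hfrac O t) (Hfracnorm O t).

(* supp_{s-1}(F) is contained in om, and Fom is the element of H^{s-1}(om)
   representing F. *)
Definition supp_sm1 O om (s : R) (F Fom : (E -> R) -> R) : Prop :=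
  Hmfrac om (1 - s) Fom /\ forall w, H1 O w -> F w = Fom w.

Definition C1_closure O f : Prop :=
  {within closure O, continuous f} /\
  forall i, (forall x, O x -> derivable f x (evec i)) /\
    exists2 g : E -> R, {within closure O, continuous g} &
      forall x, O x -> g x = partial i f x.

Definition admissible_coefficients O (A : E -> 'M[R]_d) (c : E -> R) : Prop :=
  [/\ forall i j, C1_closure O (fun x => A x i j),
      exists M : R, forall x i j, closure O x -> `|A x i j| <= M,
      forall x, closure O x -> (A x)^T = A x,
      exists a0 a1 : R, [/\ 0 < a0, 0 < a1 &
        forall x (xi : E), closure O x ->
          a0 * enorm xi ^+ 2 <= (xi *m A x *m xi^T) ord0 ord0
                             <= a1 * enorm xi ^+ 2] &
      [lipschitz c x | x in closure O] /\
      forall x, closure O x -> 0 <= c x].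

Definition energy_form O (A : E -> 'M[R]_d) (c : E -> R) v w : R :=
  \int[mu]_(x in O) ((grad O v x *m A x *m (grad O w x)^T) ord0 ord0
                     + c x * v x * w x).

Definition solution O A c (F : (E -> R) -> R) u : Prop :=
  H10 O u /\ forall v, H10 O v -> energy_form O A c u v = F v.

Definition Linfty f : Prop :=
  measurable_fun setT f /\ ('N[mu]_+oo[EFin \o f] < +oo)%E.

Definition supp_in_ball (psi : E -> R) (r : R) : Prop :=
  ess_supp psi `<=` [set x | enorm x <= r].

Definition moments (psi : E -> R) (k : nat) : Prop :=
  forall (i : 'I_d) (a : nat) (x : E), (a <= k)%N ->
    \int[mu]_y (y ord0 i ^+ a * psi (x - y)) = x ord0 i ^+ a.

Definition delta_eps (psi : E -> R) (e : R) : E -> R :=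
  fun x => e ^- d * psi (e^-1 *: x).

Definition regularize O (psi : E -> R) (e : R) v : E -> R :=
  fun x => \int[mu]_(y in O) (delta_eps psi e (x - y) * v y).

(* F^eps, in terms of the representative of F in H^{s-1}(om) *)
Definition regularize_dual O (psi : E -> R) (e : R) (Fom : (E -> R) -> R)
  : (E -> R) -> R := fun w => Fom (regularize O psi e w).

End sobolev.

(* Main.v *)
Require Import Defs.
From HB Require Import structures.
From mathcomp Require Import all_boot all_order all_algebra.
From mathcomp Require Import all_classical all_reals all_analysis.
From mathcomp Require Import measurable_realfun ess_sup_inf ring lra.
Import Order.TTheory GRing.Theory Num.Theory numFieldNormedType.Exports.
Local Open Scope classical_set_scope.
Local Open Scope ring_scope.

(** The estimate is an energy argument dual to an approximation property of the
    mollifier. Let e = u - u^eps, an element of H^1_0(Omega). Testing both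
    problems with e and using coercivity ([energy_coercive]),
      a0 ||grad e||^2 <= A(u, e) - A(u^eps, e) = <F, e> - <F, e^eps>
                       = <F, e - e^eps>
                      <= ||F||_(H^(s-1)(omega)) ||e - e^eps||_(H^(1-s)(omega)).
    It remains to show ||e - e^eps||_(H^(1-s)(omega)) <= C eps^s ||grad e||,
    which is [regularization_estimate]; one factor ||grad e|| cancels, and the
    Poincare inequality ([poincare]) turns ||grad e|| into the H^1 norm.

    The approximation property is proved on the whole space for the extension
    of e by zero, through the squared L^2 modulus of continuity
    ||f(. + h) - f||^2, called [shift_sq]. For H^1_0 functions it is at most
    C |h|^2 ||grad e||^2 ([H10_shift]): for test functions by the fundamental
    theorem of calculus along coordinate lines, in general by density. The
    Poincare inequality is the case of a translation longer than the width of
    Omega. The mollifier has mass 1 and is supported in a ball of radius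
    r0 eps, so e - e^eps is an average of e - e(. - z) over |z| <= r0 eps and
    its L^2 norm is at most C eps ||grad e|| ([convolve_dist]); averaging does
    not increase the modulus by more than a constant ([convolve_shift]). Hence
    g = e - e^eps has modulus at most C ||grad e||^2 min(|h|^2, eps^2). Now the
    Gagliardo seminorm of order 1 - s is at most the integral of the modulus
    against |h|^(-d-2(1-s)), and a summation over dyadic shells gives
    C eps^(2s) ||grad e||^2 ([gagliardo_bound]).

    Gradients are chosen weak gradients, defined up to null sets. Their
    uniqueness ([weak_grad_unique]), which makes the gradient linear and equal
    to the classical one on test functions, is the fundamental lemma of the
    calculus of variations; it follows from the existence of smooth bumps that
    converge to indicator functions of boxes, and from the uniqueness of
    measures that agree on boxes. *)

Set Implicit Arguments.
Unset Strict Implicit.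
Unset Printing Implicit Defensive.

(** * Boxes, open sets and Lebesgue measure on R^n *)

Section euclidean_measure.
Context {R : realType} (n : nat).
Local Notation E := 'rV[R]_n.
Local Notation mu := (lebesgue_rV R n).

Definition box (A : 'I_n -> set R) : set E := [set x | forall i, A i (x ord0 i)].

Lemma measurable_box (A : 'I_n -> set R) :
  (forall i, measurable (A i)) -> measurable (box A).
Proof.
move=> mA; rewrite (_ : box A = \bigcap_(j in [set: 'I_n])
    ((fun x : E => x ord0 j) @^-1` A j)).
  apply: fin_bigcap_measurable => [|j _]; first exact: finite_finset.
  by rewrite -[X in measurable X]setTI; exact: measurable_rV_coord.
by apply/seteqP; split => x /= h j; [move=> _; exact: h | exact: h].
Qed.

Lemma lebesgue_box (A : 'I_n -> set (measurableTypeR R)) :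
  (forall i, measurable (A i)) ->
  mu (box A) = (\prod_(i < n) lebesgue_measure (A i))%E.
Proof. exact: lebesgue_rV_box. Qed.

Definition cube (r : R) : set E := box (fun=> `[- r, r]%classic).

Definition rat_box (p : 'rV[rat]_n * nat) : set E :=
  box (fun i => `]ratr (p.1 ord0 i) - p.2.+1%:R^-1,
                  ratr (p.1 ord0 i) + p.2.+1%:R^-1[%classic).

Definition rat_cbox (p : 'rV[rat]_n * nat) : set E :=
  box (fun i => `[ratr (p.1 ord0 i) - p.2.+1%:R^-1,
                  ratr (p.1 ord0 i) + p.2.+1%:R^-1]%classic).

Lemma rat_box_sub p : rat_box p `<=` rat_cbox p.
Proof. by move=> x h i; have := h i; rewrite /= !in_itv/= => /andP[/ltW-> /ltW->]. Qed.

(** Both boxes are needed: the open one to cover, the closed one to provide a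
    compact set in U carrying the supports of test functions. *)
Lemma rat_box_basis (U : set E) x : open U -> U x ->
  exists2 p, rat_box p x & rat_cbox p `<=` U.
Proof.
move=> oU Ux; have /nbhs_ballP[e /= e0 eU] : nbhs x U by exact: open_nbhs_nbhs.
have [k k0 ke] : exists2 k : nat, True & k.+1%:R^-1 < e / 2.
  have [k _ hk] := near_infty_natSinv_lt (PosNum (divr_gt0 e0 (ltr0n R 2))).
  by exists k => //; exact: (hk k (leqnn k)).
have q i : {q : rat | `|x ord0 i - ratr q| < k.+1%:R^-1}.
  have lt : x ord0 i - k.+1%:R^-1 < x ord0 i + k.+1%:R^-1.
    by rewrite ltrD2l gtrN// invr_gt0.
  apply: cid; have [q qx] := rat_in_itvoo lt; exists q.
  by move: qx; rewrite in_itv/= ltr_distlC.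
exists (\row_i sval (q i), k).
  move=> i /=; rewrite mxE in_itv/=; have := svalP (q i).
  by rewrite ltr_distl.
move=> y hy; apply: eU; split => // a i; rewrite (ord1 a).
have := hy i; rewrite /= mxE in_itv/= => h.
have {}h : `|y ord0 i - ratr (sval (q i))| <= k.+1%:R^-1 by rewrite ler_distl.
have := svalP (q i); rewrite /ball/= => h'.
rewrite (_ : x ord0 i - y ord0 i = (x ord0 i - ratr (sval (q i))) -
   (y ord0 i - ratr (sval (q i)))); last by ring.
apply: le_lt_trans (ler_normB _ _) _; rewrite [ltRHS](splitr e).
by apply: ltr_leD; [exact: lt_trans ke|apply: le_trans (ltW ke)].
Qed.

Lemma open_bigcup_rat_box (U : set E) : open U ->
  U = \bigcup_p (if `[<rat_cbox p `<=` U>] then rat_box p else set0).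
Proof.
move=> oU; apply/seteqP; split => [x Ux|x [p _]].
  have [p px pU] := rat_box_basis oU Ux; exists p => //.
  by case: asboolP.
by case: asboolP => // pU /rat_box_sub/pU.
Qed.

Lemma measurable_rat_box p : measurable (rat_box p).
Proof. by apply: measurable_box => i; exact: measurable_itv. Qed.

(** The sigma-algebra on row vectors is generated by the coordinates, not by
    the open sets; an open set belongs to it because it is a countable union
    of rational boxes. *)
Lemma open_measurable_rV (U : set E) : open U -> measurable U.
Proof.
move=> /open_bigcup_rat_box ->; apply: countable_bigcupT_measurable => // p.
by case: asboolP => // _; exact: measurable_rat_box.
Qed.

Lemma continuous_measurable_rV (U : set E) (f : E -> R) :
  open U -> {in U, continuous f} -> measurable_fun U f.
Proof.
move=> oU cf; apply: (measurability _ (RGenOpens.measurableE R)).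
move=> _ [_ [a [b ->]] <-]; apply: open_measurable_rV.
  rewrite openE => x [Ux /= fx]; apply: filterI; first exact: open_nbhs_nbhs.
  have := cf x (mem_set Ux); apply.
  by apply: open_nbhs_nbhs; split => //; exact: interval_open.
Qed.

Lemma continuous_measurable_rVT (f : E -> R) : continuous f -> measurable_fun setT f.
Proof. by move=> cf; apply: continuous_measurable_rV => [|x _]; [exact: openT|exact: cf]. Qed.

(** An almost everywhere property may be checked locally, although a point
    only comes with some neighbourhood: countably many rational boxes suffice,
    and a countable union of null sets is null. *)
Lemma negligible_open_locally (U : set E) (P : E -> Prop) : open U ->
  (forall x, U x -> exists V, [/\ open V, V x & {ae mu, forall y, V y -> P y}]) ->
  {ae mu, forall y, U y -> P y}.
Proof.
move=> oU h.
pose B p : set E := if `[<rat_box p `<=` U /\ {ae mu, forall y, rat_box p y -> P y}>]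
   then rat_box p else set0.
have /(_ _)/= H p : mu.-negligible [set y | ~ (B p y -> P y)].
  rewrite /B; case: asboolP => [[_]//|_].
  by apply: negligibleS (negligible_set0 mu) => y /= [].
suff : mu.-negligible (\bigcup_p [set y | ~ (B p y -> P y)]).
  apply: negligibleS => y /= /not_implyP[Uy nP].
  have [V [oV Vy aV]] := h _ Uy.
  have [p py pV] := rat_box_basis (openI oU oV) (conj Uy Vy).
  exists p => //= /(_ _) k; apply: nP; apply: k; rewrite /B.
  case: asboolP => // -[]; split; first by move=> z /rat_box_sub/pV[].
  by apply: filterS aV => z + pz; apply; move/rat_box_sub/pV : pz => [].
have /countable_bijP[D] : countable [set: 'rV[rat]_n * nat] by [].
move=> /ppcard_eqP[f].
rewrite (reindex_bigcup f^-1%FUN setT)//=; last first.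
  exact: (@subl_surj _ _ D).
apply: negligible_bigcup => k; exact: H.
Qed.

Definition obox (a b : E) : set E := box (fun i => `]a ord0 i, b ord0 i[%classic).

Let oboxes : set (set E) := [set B | exists a b, B = obox a b].

Lemma measurable_obox a b : measurable (obox a b).
Proof. by apply: measurable_box => i; exact: measurable_itv. Qed.

Lemma oboxI a b a' b' : obox a b `&` obox a' b' =
  obox (\row_i Num.max (a ord0 i) (a' ord0 i)) (\row_i Num.min (b ord0 i) (b' ord0 i)).
Proof.
apply/seteqP; split => x /=.
  move=> [h h'] i; have := h i; have := h' i; rewrite /= !in_itv/= !mxE gt_max lt_min.
  by move=> /andP[? ?] /andP[? ?]; apply/andP; split; apply/andP.
by move=> h; split => i; have := h i; rewrite /= !in_itv/= !mxE gt_max lt_min;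
  move=> /andP[/andP[? ?] /andP[? ?]]; apply/andP.
Qed.

Lemma rat_box_obox p : rat_box p = obox (\row_i (ratr (p.1 ord0 i) - p.2.+1%:R^-1))
  (\row_i (ratr (p.1 ord0 i) + p.2.+1%:R^-1)).
Proof. by apply/seteqP; split => x h i; have := h i; rewrite /= !mxE. Qed.

Let open_oboxes (U : set E) : open U -> <<s oboxes >> U.
Proof.
pose T := g_sigma_algebraType oboxes.
move=> oU; rewrite (open_bigcup_rat_box oU).
have := @countable_bigcupT_measurable _ T ('rV[rat]_n * nat)%type
  (fun p => if `[<rat_cbox p `<=` U>] then rat_box p else set0).
apply => // p; case: asboolP => // _.
by apply: sub_sigma_algebra; rewrite rat_box_obox; exists (\row_i (ratr (p.1 ord0 i) - p.2.+1%:R^-1)), (\row_i (ratr (p.1 ord0 i) + p.2.+1%:R^-1)).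
Qed.

Lemma measurable_oboxes : @measurable _ E = <<s oboxes >>.
Proof.
pose T := g_sigma_algebraType oboxes.
apply/seteqP; split; last first.
  apply: smallest_sub; first exact: sigma_algebra_measurable.
  by move=> _ [a [b ->]]; exact: measurable_obox.
apply: smallest_sub; first exact: smallest_sigma_algebra.
move=> B /=; rewrite -bigcup_seq => -[i _ [C mC <-]].
have : measurable_fun [set: T] (fun x : T => (x : E) ord0 i).
  apply: (measurability _ (RGenOpens.measurableE R)) => _ [_ [a [b ->]] <-].
  rewrite setTI; apply: open_oboxes; rewrite openE => x /= abx.
  apply: (@coord_continuous R 1 n ord0 i x).
  by apply: open_nbhs_nbhs; split => //; exact: interval_open.
exact.
Qed.

(** Uniqueness of measures on a generating pi-system. Open boxes are the
    convenient choice: they are stable under intersection and under dilations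
    and translations, and they are limits of smooth bumps. *)
Lemma rV_measure_unique (m1 m2 : {measure set E -> \bar R}) :
  (forall a b, m1 (obox a b) = m2 (obox a b)) ->
  (forall a b, (m1 (obox a b) < +oo)%E) ->
  forall A, measurable A -> m1 A = m2 A.
Proof.
move=> h hk A mA.
apply: (measure_unique oboxes (fun k => obox (const_mx (- k%:R)) (const_mx k%:R))) => //.
- exact: measurable_oboxes.
- by move=> _ _ [a [b ->]] [a' [b' ->]]; rewrite oboxI; do 2 eexists.
- by move=> k; do 2 eexists.
- apply/seteqP; split => // x _; exists (\max_(i < n) Num.bound (x ord0 i))%N => // i.
  rewrite /= in_itv/= !mxE -ltr_norml; apply: lt_le_trans (archi_boundP (normr_ge0 _)) _.
  by rewrite ler_nat (leq_trans _ (leq_bigmax i))// /Num.bound normr_id.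
- by move=> _ [a [b ->]]; exact: h.
Qed.

Lemma lebesgue_obox_lty a b : (mu (obox a b) < +oo)%E.
Proof.
rewrite lebesgue_box => [|i]; last exact: measurable_itv.
rewrite (eq_bigr (fun i => (Num.max 0 (b ord0 i - a ord0 i))%:E)) => [|i _].
  by rewrite prodEFin ltry.
rewrite lebesgue_measure_itv/= lte_fin; case: ltP => [ab|ab].
  by rewrite -EFinB (max_idPr _)// subr_ge0 ltW.
by rewrite (max_idPl _)// subr_le0.
Qed.

Lemma lebesgue_cube r : 0 <= r -> mu (cube r) = ((r *+ 2) ^+ n)%:E.
Proof.
move=> r0; rewrite lebesgue_box => [|i]; last exact: measurable_itv.
under eq_bigr => i _.
  rewrite lebesgue_measure_itv/= lte_fin.
  rewrite (_ : (if _ then _ else _) = (r *+ 2)%:E); first over.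
  case: ltP => [_|rr]; first by rewrite -EFinD opprK.
  by rewrite (_ : r = 0) ?mul0rn//; lra.
by rewrite prodEFin prodr_const card_ord.
Qed.

Lemma measurable_cube r : measurable (cube r).
Proof. by apply: measurable_box => i; exact: measurable_itv. Qed.

End euclidean_measure.

(** * Affine changes of variables *)

Section affine1.
Context {R : realType}.
Variables (a b : R) (a0 : a != 0).
Let T (y : R) := a * y + b.

Let mT : measurable_fun [set: measurableTypeR R] (T : _ -> measurableTypeR R).
Proof. by apply: measurable_funD => //; exact: measurable_funM. Qed.

(** The one-dimensional factor of the change of variables on boxes; the sign
    of a decides which ends of the half-open intervals are exchanged. *)
Lemma lebesgue_affine (A : set (measurableTypeR R)) : measurable A ->
  lebesgue_measure (T @^-1` A) = (`|a|^-1%:E * lebesgue_measure A)%E.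
Proof.
move=> mA; pose k : {nonneg R} := NngNum (normr_ge0 a).
pose m : {measure set (measurableTypeR R) -> \bar R} :=
  mscale k (measure_function_pushforward__canonical__measure_function_Measure
      (@lebesgue_measure R) mT).
(* Lebesgue measure is the image measure scaled by |a|, as both agree on
   half-open intervals. *)
suff -> : lebesgue_measure A = m A.
  rewrite [m A](_ : _ = (`|a|%:E * lebesgue_measure (T @^-1` A))%E)// muleA -EFinM mulVf ?normr_eq0// mul1e.
  by [].
apply: lebesgue_measure_unique => // _ [[p q] _ <-].
rewrite [RHS](_ : _ = (`|a|%:E * lebesgue_measure (T @^-1` `]p, q]%classic))%E)//=.
have [a1|a1|/esym/eqP] := ltgtP 0 a; last by rewrite (negbTE a0).
  rewrite (_ : _ @^-1` _ = `](p - b) / a, (q - b) / a]%classic); last first.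
    by apply/seteqP; split => x /=; rewrite !in_itv/= /T ltr_pdivrMr// ler_pdivlMr//
      ltrBlDr lerBrDr (mulrC a).
  rewrite !lebesgue_measure_itv/= !lte_fin ltr_pM2r ?invr_gt0// ltrD2r.
  case: ifP; last by rewrite mule0.
  by rewrite -!EFinB -EFinM gtr0_norm// => _; congr EFin; field.
rewrite (_ : _ @^-1` _ = `[(q - b) / a, (p - b) / a[%classic); last first.
  by apply/seteqP; split => x /=; rewrite !in_itv/= /T ltr_ndivlMr// ler_ndivrMr//
    lerBrDr ltrBlDr (mulrC a) andbC.
rewrite !lebesgue_measure_itv/= !lte_fin ltr_nM2r ?invr_lt0// ltrD2r.
case: ifP; last by rewrite mule0.
by rewrite -!EFinB -EFinM ltr0_norm// => _; congr EFin; field.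
Qed.

End affine1.

Section affine.
Context {R : realType} (n : nat).
Local Notation E := 'rV[R]_n.
Local Notation mu := (lebesgue_rV R n).

Lemma measurable_affine (a : R) (b : E) : measurable_fun setT (fun y : E => a *: y + b).
Proof.
apply: measurable_to_rV => i.
rewrite (_ : (fun _ => _) = fun t : E => a * t ord0 i + b ord0 i); last first.
  by apply/funext => t; rewrite !mxE.
by apply: measurable_funD => //; apply: measurable_funM => //; exact: measurable_rV_coord.
Qed.

Variables (a : R) (a0 : a != 0) (b : E).
Let T (y : E) := a *: y + b.
Let mT : measurable_fun setT T := measurable_affine a b.

Let m : {measure set E -> \bar R} :=
  mscale (NngNum (exprn_ge0 n (normr_ge0 a))) (measure_function_pushforward__canonical__measure_function_Measure mu mT).

Let mE A : measurable A -> mu A = m A.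
Proof.
apply: rV_measure_unique => [p q|p q]; last exact: lebesgue_obox_lty.
pose B i := `]p ord0 i, q ord0 i[%classic; rewrite -[obox p q]/(box B).
have mB i : measurable (B i) by exact: measurable_itv.
rewrite [RHS](_ : _ = ((`|a| ^+ n)%:E * mu (T @^-1` box B))%E)//.
rewrite (_ : T @^-1` box B = box (fun i => (fun t => a * t + b ord0 i) @^-1` B i)); last first.
  by apply/seteqP; split => x h i /=; have := h i; rewrite /= !mxE.
rewrite lebesgue_box; last first.
  move=> i; rewrite -[X in measurable X]setTI.
  by apply: measurable_funD => //; exact: measurable_funM.
rewrite [X in (_ * X)%E](eq_bigr (fun i =>
  (`|a|^-1%:E * lebesgue_measure (B i))%E)); last first.
  by move=> i _; exact: (@lebesgue_affine R a (b ord0 i) a0 (B i) (mB i)).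
rewrite big_split/= muleA.
suff -> : ((`|a| ^+ n)%:E * \prod_(i < n) `|a|^-1%:E = 1 :> \bar R)%E.
  by rewrite mul1e; exact: lebesgue_box.
by rewrite prodEFin -EFinM prodr_const card_ord -exprMn divff ?expr1n// normr_eq0.
Qed.

(** Lebesgue measure and its image under y |-> a y + b, scaled by |a|^n, agree
    on open boxes by the one-dimensional case, hence everywhere. *)
Lemma ge0_integral_affine (f : E -> \bar R) : measurable_fun setT f ->
  (forall x, (0 <= f x)%E) ->
  (\int[mu]_y f (a *: y + b)%R = (`|a| ^- n)%:E * \int[mu]_y f y)%E.
Proof.
move=> mf f0.
rewrite [X in (_ * X)%E](eq_measure_integral m); last by move=> A mA _; exact: mE.
rewrite ge0_integral_mscale//= muleA -EFinM mulVf ?expf_neq0 ?normr_eq0// mul1e.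
by rewrite ge0_integral_pushforward.
Qed.

Lemma negligible_affine (N : set E) : mu.-negligible N ->
  mu.-negligible (T @^-1` N).
Proof.
move=> [B [mB B0 NB]]; exists (T @^-1` B); split.
- by rewrite -[X in measurable X]setTI; exact: mT.
- have : mu B = ((`|a| ^+ n)%:E * mu (T @^-1` B))%E := mE mB; rewrite B0 => /esym/eqP.
  by rewrite mule_eq0 eqe expf_eq0 normr_eq0 (negbTE a0) andbF/= => /eqP.
- by move=> x /NB.
Qed.

End affine.

Section translation.
Context {R : realType} (n : nat).
Local Notation E := 'rV[R]_n.
Local Notation mu := (lebesgue_rV R n).

Lemma ge0_integral_shift (h : E) (f : E -> \bar R) : measurable_fun setT f ->
  (forall x, (0 <= f x)%E) ->
  (\int[mu]_y f (y + h)%R = \int[mu]_y f y)%E.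
Proof.
move=> mf f0; have := ge0_integral_affine (oner_neq0 R) h mf f0.
rewrite normr1 expr1n invr1 mul1e => <-.
by apply: eq_integral => x _; rewrite scale1r.
Qed.

Lemma integral_shift (h : E) (f : E -> \bar R) : measurable_fun setT f ->
  (\int[mu]_y f (y + h)%R = \int[mu]_y f y)%E.
Proof.
move=> mf; rewrite integralE [RHS]integralE; congr (_ - _)%E.
  rewrite -(ge0_integral_shift h (measurable_funepos mf)) => [|x]; last first.
    by rewrite funepos_ge0.
  by apply: eq_integral => x _; rewrite funepos.unlock.
rewrite -(ge0_integral_shift h (measurable_funeneg mf)) => [|x]; last first.
  by rewrite funeneg_ge0.
by apply: eq_integral => x _; rewrite funeneg.unlock.
Qed.

Lemma integral_scale (a : R) (f : E -> \bar R) : a != 0 -> mu.-integrable setT f ->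
  (\int[mu]_y f (a *: y)%R = (`|a| ^- n)%:E * \int[mu]_y f y)%E.
Proof.
move=> a0 intf; have mf := measurable_int _ intf.
have H g := @ge0_integral_affine R n a a0 0 g.
rewrite integralE [in RHS]integralE muleBr//; last first.
  by apply: fin_num_adde_defr; exact: integrable_pos_fin_num.
rewrite -(H _ (measurable_funepos mf))// -(H _ (measurable_funeneg mf))//.
by congr (_ - _)%E; apply: eq_integral => x _; rewrite addr0 ?funepos.unlock ?funeneg.unlock.
Qed.

End translation.

(** * Flat functions and smooth bumps *)

Section flat.
Context {R : realType}.
Implicit Types (P : {poly R}) (x : R).

Lemma poly_expR_bound P : exists2 C : R, 0 <= C & forall y, 0 <= y -> `|P.[y]| <= C * expR y.
Proof.
have Xn n y : 0 <= y -> y ^+ n <= n`!%:R * expR y.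
  case: n => [|n] y0; first by rewrite expr0 fact0 mul1r -expR0 ler_expR.
  rewrite -ler_pdivrMl ?ltr0n ?fact_gt0// mulrC.
  by apply: le_trans (expR_ge1Dxn n y0); rewrite lerDr.
exists (\sum_(i < size P) `|P`_i| * i`!%:R).
  by apply: sumr_ge0 => i _; rewrite mulr_ge0.
move=> y y0; rewrite horner_coef mulr_suml; apply: le_trans (ler_norm_sum _ _ _) _.
apply: ler_sum => i _; rewrite normrM normrX (ger0_norm y0) -mulrA.
by rewrite ler_wpM2l// Xn.
Qed.

(** For P = 1 this is the classical smooth function exp(-1/x) that vanishes to
    infinite order at 0. The polynomial factor makes the family closed under
    differentiation. *)
Definition flat P x : R := if 0 < x then P.[x^-1] * expR (- x^-1) else 0.

(** The exponential beats every power of 1/x. A quadratic bound is what makes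
    the difference quotients at 0 converge to 0. *)
Lemma flat_quadratic P : exists2 C : R, 0 <= C & forall x, `|flat P x| <= C * x ^+ 2.
Proof.
have [C C0 hC] := poly_expR_bound (P * 'X^2); exists C => // x.
rewrite /flat; case: ifPn => [x0|_]; last by rewrite normr0 mulr_ge0 ?sqr_ge0.
have xV : 0 <= x^-1 by rewrite invr_ge0 ltW.
have := hC _ xV; rewrite hornerM hornerXn normrM (ger0_norm (exprn_ge0 2 xV)) => h.
rewrite expRN normrM normfV (gtr0_norm (expR_gt0 _)) ler_pdivrMr ?expR_gt0// mulrAC -ler_pdivrMr ?exprn_gt0//.
by rewrite -exprVn.
Qed.

(** The chain rule at x > 0, with y = 1/x: the derivative of P(y) exp(-y) in x
    is - y^2 (P'(y) - P(y)) exp(-y). *)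
Definition flat_dpoly P : {poly R} := 'X^2 * (P - P^`()).

(** The only delicate point is 0, where the quadratic bound gives derivative
    0. *)
Lemma is_derive_flat P x : is_derive x 1 (flat P) (flat (flat_dpoly P) x).
Proof.
have [x0|x0|<-] := ltgtP 0 x.
- have -> : flat (flat_dpoly P) x = (- x ^- 2) *: P^`().[x^-1] * expR (- x^-1) +
      P.[x^-1] * (x ^- 2 * expR (- x^-1)).
    by rewrite /flat x0 /flat_dpoly !hornerE -exprVn /GRing.scale/=; ring.
  apply: (@near_eq_is_derive _ _ _ (fun y : R => P.[y^-1] * expR (- y^-1))).
    near=> y; rewrite /flat ifT//; near: y; apply: (open_nbhs_nbhs (A := [set y : R | 0 < y])); split => //; exact: open_gt.
  have x1 : x != 0 by rewrite gt_eqF.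
  have dV := is_deriveV x1 (is_derive_id x 1).
  have d1 : is_derive x 1 (fun y => P.[y^-1]) (P^`().[x^-1] * (- x ^- 2 *: 1)).
    exact: (is_derive1_comp (is_derive_poly P x^-1) dV).
  have d2 : is_derive x 1 (fun y => expR (- y^-1)) (expR (- x^-1) * (- (- x ^- 2 *: 1))).
    exact: (is_derive1_comp (is_derive_expR _) (is_deriveN dV)).
  apply: (is_derive_eq (is_deriveM d1 d2)).
  rewrite /GRing.scale/=; ring.
- have -> : flat (flat_dpoly P) x = 0 by rewrite /flat ltNge ltW.
  apply: (@near_eq_is_derive _ _ _ (cst 0)).
    near=> y; rewrite /flat ifN// -leNgt ltW//; near: y; apply: (open_nbhs_nbhs (A := [set y : R | y < 0])); split => //; exact: open_lt.
- rewrite {2}/flat ltxx.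
  have [C C0 hC] := flat_quadratic P.
  suff : (fun h : R => h^-1 *: ((flat P \o shift 0) (h *: 1) - flat P 0)) @ 0^' --> (0:R).
    by move=> h; split; [apply/cvg_ex; exists 0|exact: cvg_lim].
  apply/cvgr0Pnorm_lt => e e0; near=> h.
  rewrite /= addr0 {2}/flat ltxx subr0 normrM normfV /GRing.scale/= mulr1.
  have h0 : h != 0 by near: h; exact: nbhs_dnbhs_neq.
  rewrite -ltr_pdivlMl ?invr_gt0 ?normr_gt0// invrK.
  apply: le_lt_trans (hC _) _; rewrite -normr_id -[_ ^+ 2]real_normK ?num_real//.
  rewrite expr2 mulrA normr_id mulrC ltr_pM2l ?normr_gt0//.
  apply: (@le_lt_trans _ _ ((C + 1) * `|h|)); first by rewrite ler_wpM2r// lerDl.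
  rewrite mulrC -ltr_pdivlMr; last by lra.
  near: h; apply: dnbhs0_lt; rewrite divr_gt0//; lra.
Unshelve. all: by end_near. Qed.

(** Dilating exp(-1/t) turns it into the indicator function of t > 0. *)
Lemma flat1_cvg t : flat 1 (k.+1%:R * t) @[k --> \oo] --> ((0 < t)%R%:R : R).
Proof.
rewrite /flat; have [t0|t0] := ltP 0 t; last first.
  under eq_fun => k do rewrite pmulr_rgt0// ltNge t0/=.
  exact: cvg_cst.
under eq_fun => k do rewrite pmulr_rgt0// t0/= hornerC mul1r invfM.
rewrite (_ : true%:R = expR 0 :> R); last by rewrite expR0.
have h : (fun k : nat => - (k.+1%:R^-1 * t^-1)) @ \oo --> (0 : R).
  rewrite -oppr0; apply: cvgN; rewrite -[X in _ --> X](mul0r t^-1).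
  by apply: cvgM; [exact: cvg_harmonic|exact: cvg_cst].
have := @cvg_comp _ _ _ _ expR _ _ _ h (@continuous_expR R 0). exact.
Qed.

Lemma flat1_ge0 t : 0 <= flat 1 t.
Proof. by rewrite /flat; case: ifP => // _; rewrite hornerC mul1r expR_ge0. Qed.

Lemma flat1_le1 t : flat 1 t <= 1.
Proof.
rewrite /flat; case: ifP => // t0; rewrite hornerC mul1r -expR0 ler_expR.
by rewrite oppr_le0 invr_ge0 ltW.
Qed.

Lemma flat_le0 P t : t <= 0 -> flat P t = 0.
Proof. by move=> t0; rewrite /flat ltNge t0. Qed.

End flat.

Lemma is_derive_line (R : realType) (V : normedModType R) (f : V -> R) (x v : V) (l : R) :
  is_derive x v f l <-> is_derive (0 : R) 1 (fun t : R => f (t *: v + x)) l.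
Proof.
have E : (fun h : R => h^-1 *: ((f \o shift x) (h *: v) - f x)) =
   (fun h : R => h^-1 *: (((fun t : R => f (t *: v + x)) \o shift 0) (h *: 1) - f (0 *: v + x))).
  by apply/funext => h /=; rewrite addr0 scale0r add0r [h *: 1]mulr1.
by split => -[d1 d2]; split; move: d1 d2; rewrite /derivable /derive E.
Qed.

Section smooth_class.
Context {R : realType} {d : nat}.
Local Notation E := 'rV[R]_d.

(** The ring generated by flat functions of one affine coordinate. It contains
    the bumps below and is closed under partial derivatives, so smoothness of
    all orders follows by induction without a formula for higher derivatives. *)
Inductive flat_class : (E -> R) -> Prop :=
| FlatCst (c : R) : flat_class (cst c)
| FlatCoord P i (a b : R) : flat_class (fun x => flat P (a * x ord0 i + b))
| FlatAdd f g of flat_class f & flat_class g : flat_class (f + g)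
| FlatMul f g of flat_class f & flat_class g : flat_class (f * g).

Lemma flat_class_derive f j : flat_class f ->
  exists2 f', flat_class f' & forall x, is_derive x (evec j) f (f' x).
Proof.
elim => [c|P i a b|{}f g Sf [f' Sf' df'] Sg [g' Sg' dg']|
  {}f g Sf [f' Sf' df'] Sg [g' Sg' dg']].
- by exists (cst 0) => [|x]; [exact: FlatCst|exact: is_derive_cst].
- exists (cst (a * (i == j)%:R) * (fun x : E => flat (flat_dpoly P) (a * x ord0 i + b))).
    by apply: FlatMul; [exact: FlatCst|exact: FlatCoord].
  move=> x; apply/is_derive_line.
  have -> : (fun t : R => flat P (a * (t *: evec j + x) ord0 i + b)) =
    flat P \o (fun t : R => (a * (i == j)%:R) * t + (a * x ord0 i + b)).
    apply/funext => t /=; congr flat; rewrite !mxE eqxx/= eq_sym.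
    by case: eqP => _ /=; ring.
  have dl : is_derive (0 : R) 1 (fun t : R => (a * (i == j)%:R) * t + (a * x ord0 i + b))
      (a * (i == j)%:R).
    have -> : (fun t : R => (a * (i == j)%:R) * t + (a * x ord0 i + b)) =
       ((a * (i == j)%:R) \*: id) + cst (a * x ord0 i + b) by [].
    apply: (is_derive_eq (is_deriveD (is_deriveZ _ (is_derive_id _ _)) (is_derive_cst _ _ _))).
    by rewrite addr0 [_ *: _]mulr1.
  have := is_derive_flat P ((a * (i == j)%:R) * 0 + (a * x ord0 i + b)).
  move=> /(@is_derive1_comp _ _ (fun t : R => (a * (i == j)%:R) * t + (a * x ord0 i + b)) 0).
  move=> /(_ _ dl) H; apply: (is_derive_eq H).
  by rewrite mulr0 add0r mulrC.
- by exists (f' + g') => [|x]; [exact: FlatAdd|exact: is_deriveD].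
- exists (f * g' + g * f') => [|x]; first by apply: FlatAdd; exact: FlatMul.
  exact: is_deriveM.
Qed.

Lemma flat_class_continuous f : flat_class f -> continuous f.
Proof.
elim => [c|P i a b|{}f g Sf cf Sg cg|{}f g Sf cf Sg cg] x.
- exact: cst_continuous.
- apply: (@continuous_comp _ _ _ (fun x : E => a * x ord0 i + b) (flat P)).
    apply: continuousD; last exact: cst_continuous.
    apply: continuousM; first exact: cst_continuous.
    exact: coord_continuous.
  apply/differentiable_continuous/derivable1_diffP.
  by have [] := is_derive_flat P (a * x ord0 i + b).
- exact: (continuousD (cf x) (cg x)).
- exact: (continuousM (cf x) (cg x)).
Qed.

Lemma flat_class_smooth f : flat_class f -> smooth f.
Proof.
move=> Sf l; have {Sf} : flat_class (foldr partial f l).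
  elim: l => //= i l Sl; have [f' Sf' df'] := flat_class_derive i Sl.
  have -> // : partial i (foldr partial f l) = f'.
  by apply/funext => x; rewrite /partial; have [] := df' x.
move=> Sl; split; first exact: flat_class_continuous.
by move=> i x; have [f' _ df'] := flat_class_derive i Sl; have [] := df' x.
Qed.

Lemma flat_class_prod (I : Type) (s : seq I) (g : I -> E -> R) :
  (forall i, flat_class (g i)) -> flat_class (fun x => \prod_(i <- s) g i x).
Proof.
move=> Sg; elim: s => [|i s IHs].
  by under eq_fun => x do rewrite big_nil; exact: FlatCst.
by under eq_fun => x do rewrite big_cons; exact: FlatMul.
Qed.

(** As k grows these smooth functions, supported in the box, increase to its
    indicator function. *)
Definition box_bump (a b : E) (k : nat) (x : E) : R :=
  \prod_(i < d) (flat 1 (k.+1%:R * (x ord0 i - a ord0 i)) *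
                 flat 1 (k.+1%:R * (b ord0 i - x ord0 i))).

Lemma box_bump_smooth a b k : smooth (box_bump a b k).
Proof.
apply: flat_class_smooth; apply: flat_class_prod => i; apply: FlatMul.
  under eq_fun => x do rewrite mulrBr -mulrN.
  exact: FlatCoord.
under eq_fun => x do rewrite mulrBr addrC -mulNr.
exact: FlatCoord.
Qed.

Lemma box_bump_out a b k x : ~ obox a b x -> box_bump a b k x = 0.
Proof.
move=> /existsNP[i /=]; rewrite in_itv/= => /negP; rewrite negb_and -!leNgt => h.
rewrite /box_bump (bigD1 i)//=.
case/orP: h => h; last rewrite (mulrC (flat _ _)).
  by rewrite flat_le0 ?mul0r// pmulr_rle0// subr_le0.
by rewrite flat_le0 ?mul0r// pmulr_rle0// subr_le0.
Qed.

Lemma box_bump_ge0 a b k x : 0 <= box_bump a b k x.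
Proof. by apply: prodr_ge0 => i _; rewrite mulr_ge0// flat1_ge0. Qed.

Lemma box_bump_le1 a b k x : box_bump a b k x <= 1.
Proof.
apply: prodr_ile1 => i _.
by rewrite mulr_ge0 ?flat1_ge0//= mulr_ile1 ?flat1_ge0 ?flat1_le1.
Qed.

Lemma box_bump_cvg a b x : box_bump a b k x @[k --> \oo] --> (\1_(obox a b) x : R).
Proof.
have -> : \1_(obox a b) x = \prod_(i < d)
    ((0 < x ord0 i - a ord0 i)%R%:R * (0 < b ord0 i - x ord0 i)%R%:R) :> R.
  rewrite indicE; have [h|] := pselect (obox a b x).
    rewrite mem_set// big1// => i _; have := h i; rewrite /= in_itv/=.
    by move=> /andP[xa xb]; rewrite !subr_gt0 xa xb mulr1.
  move=> nh; rewrite memNset//; move: nh => /existsNP[i /=]; rewrite in_itv/= => /negP.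
  by rewrite (bigD1 i)//= !subr_gt0 -natrM mulnb => /negbTE ->; rewrite mul0r.
rewrite /box_bump; apply: cvg_big => [|i _].
  by move=> p; exact: mul_continuous.
by apply: cvgM; exact: flat1_cvg.
Qed.

End smooth_class.

(** * Square-integrable functions and the fundamental lemma of the calculus of variations *)

Section density_measure.
Context d (T : measurableType d) (R : realType) (mu : {measure set T -> \bar R}).
Variables (f : T -> \bar R) (mf : measurable_fun setT f) (f0 : forall x, (0 <= f x)%E).

Let density_fun (A : set T) : \bar R := (\int[mu]_(x in A) f x)%E.

Let density0 : density_fun set0 = 0%E.
Proof. exact: integral_set0. Qed.

Let density_ge0 A : (0 <= density_fun A)%E.
Proof. exact: integral_ge0. Qed.

Let density_sigma_additive : semi_sigma_additive density_fun.
Proof.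
move=> /= F mF tF mUF; rewrite /density_fun; apply: cvg_toP.
  apply: ereal_nondecreasing_is_cvgn => m n mn.
  by apply: lee_sum_nneg_natr => // k _ _; exact: integral_ge0.
by rewrite ge0_integral_bigcup//; exact: measurable_funTS.
Qed.

(** The indefinite integral of f as a measure, so that uniqueness of measures
    applies to integrals over sets. *)
Definition density_measure : {measure set T -> \bar R} :=
  HB.pack_for {measure set T -> \bar R} density_fun (isMeasure.Build _ _ _ density_fun
    density0 density_ge0 density_sigma_additive).

Lemma density_measureE A : density_measure A = (\int[mu]_(x in A) f x)%E.
Proof. by []. Qed.

End density_measure.

Section L2_theory.
Context {R : realType} {d : nat}.
Local Notation E := 'rV[R]_d.
Local Notation mu := (lebesgue_rV R d).
Implicit Types (O : set E) (f g : E -> R).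

Lemma L2_sqr_integrable O f : measurable O -> L2 O f ->
  mu.-integrable O (fun x => (f x ^+ 2)%:E).
Proof.
move=> mO [mf f2]; apply/integrableP; split.
  by apply/measurable_EFinP; exact: measurable_funX.
by under eq_integral => x _ do rewrite /= ger0_norm ?sqr_ge0//.
Qed.

Lemma integrable_sqr_L2 O f : measurable O -> measurable_fun O f ->
  mu.-integrable O (fun x => (f x ^+ 2)%:E) -> L2 O f.
Proof.
move=> mO mf /integrableP[_]; split => //.
by under eq_integral => x _ do rewrite -[(f x ^+ 2)%:E]gee0_abs ?lee_fin ?sqr_ge0//.
Qed.

Lemma L2_dominated O f g1 g2 : measurable O -> L2 O g1 -> L2 O g2 -> measurable_fun O f ->
  (forall x, O x -> `|f x| <= `|g1 x| + `|g2 x|) -> L2 O f.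
Proof.
move=> mO L1 L2' mf h; apply: integrable_sqr_L2 => //.
have i1 := L2_sqr_integrable mO L1; have i2 := L2_sqr_integrable mO L2'.
apply: (le_integrable mO _ _ (integrableZl mO 2 (integrableD mO i1 i2))).
  by apply/measurable_EFinP; exact: measurable_funX.
move=> x Ox; rewrite /= lee_fin normrX [leRHS]ger0_norm; last first.
  by rewrite mulr_ge0// addr_ge0 ?sqr_ge0.
have := h _ Ox; rewrite -[g1 x ^+ 2]real_normK ?num_real// -[g2 x ^+ 2]real_normK ?num_real//.
have := normr_ge0 (f x); have := normr_ge0 (g1 x); have := normr_ge0 (g2 x).
move: `|f x| `|g1 x| `|g2 x| => a b c c0 b0 a0 abc.
apply: (@le_trans _ _ ((b + c) ^+ 2)); first by rewrite lerXn2r ?nnegrE ?addr_ge0.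
by rewrite -subr_ge0 (_ : _ - _ = (b - c) ^+ 2) ?sqr_ge0//; ring.
Qed.

Lemma L2B O f g : measurable O -> L2 O f -> L2 O g -> L2 O (f - g).
Proof.
move=> mO Lf Lg; apply: (L2_dominated mO Lf Lg) => [|x _]; last exact: ler_normB.
by apply: measurable_funB; [exact: Lf.1|exact: Lg.1].
Qed.

Lemma L2M_integrable O f g : measurable O -> L2 O f -> L2 O g ->
  mu.-integrable O (fun x => (f x * g x)%:E).
Proof.
move=> mO Lf Lg.
apply: (le_integrable mO _ _ (integrableD mO (L2_sqr_integrable mO Lf) (L2_sqr_integrable mO Lg))).
  by apply/measurable_EFinP; apply: measurable_funM; [exact: Lf.1|exact: Lg.1].
move=> x Ox; rewrite /= lee_fin [leRHS]ger0_norm; last by rewrite addr_ge0 ?sqr_ge0.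
rewrite normrM -[f x ^+ 2]real_normK ?num_real// -[g x ^+ 2]real_normK ?num_real//.
have := sqr_ge0 (`|f x| - `|g x|); have := normr_ge0 (f x); have := normr_ge0 (g x).
by nra.
Qed.

Lemma L2_integrable O A f : measurable O -> measurable A -> A `<=` O ->
  (mu A < +oo)%E -> L2 O f -> mu.-integrable A (EFin \o f).
Proof.
move=> mO mA AO A1 Lf.
have i1 : mu.-integrable A (fun x => (f x ^+ 2)%:E).
  exact: (integrableS mO mA AO (L2_sqr_integrable mO Lf)).
have i2 : mu.-integrable A (EFin \o cst (1 : R)).
  apply/integrableP; split; first exact/measurable_EFinP/measurable_cst.
  under eq_integral => x _ do rewrite /= normr1.
  by rewrite integral_cst// mul1e.
apply: (le_integrable mA _ _ (integrableD mA i1 i2)).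
  by apply/measurable_EFinP; apply: measurable_funS AO Lf.1.
move=> x Ax /=; rewrite lee_fin [leRHS]ger0_norm ?addr_ge0 ?sqr_ge0//.
rewrite -[f x ^+ 2]real_normK ?num_real//.
by have := sqr_ge0 (`|f x| - 1); have := normr_ge0 (f x); nra.
Qed.

Lemma box_bump_test O a b k (K : set E) : compact K -> K `<=` O -> obox a b `<=` K ->
  test_fun O (box_bump a b k).
Proof.
move=> cK KO bK; split; first exact: box_bump_smooth.
by exists K; split => // x Kx; apply: box_bump_out; by move=> /bK.
Qed.

Lemma compact_rat_cbox p : compact (rat_cbox p : set E).
Proof. by apply: rV_compact => i; exact: segment_compact. Qed.

Lemma rat_box_open p : open (rat_box p : set E).
Proof.
rewrite openE => x px.
exists (fun _ i => `]ratr (p.1 ord0 i) - p.2.+1%:R^-1,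
                     ratr (p.1 ord0 i) + p.2.+1%:R^-1[%classic); last by move=> y h i; exact: h.
move=> k i; rewrite (ord1 k).
by apply: open_nbhs_nbhs; split; [exact: interval_open|exact: px].
Qed.

(** Locally, bumps converge boundedly to indicators of boxes, so g integrates
    to 0 over every small box. Hence the measures with densities g^+ and g^-
    agree on boxes, therefore on all measurable sets, and g = 0 almost
    everywhere. *)
Lemma fundamental_lemma_calc_var O g : open O -> L2 O g ->
  (forall f, test_fun O f -> \int[mu]_(x in O) (g x * f x) = 0) ->
  {ae mu, forall x, O x -> g x = 0}.
Proof.
move=> oO Lg h; apply: negligible_open_locally => // x0 Ox0.
have mO := open_measurable_rV oO.
have [p px pO] := rat_box_basis oO Ox0.
exists (rat_box p); split => //; first exact: rat_box_open.
set B := rat_box p; have mB : measurable B := measurable_rat_box p.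
have BO : B `<=` O by exact: subset_trans (@rat_box_sub _ _ p) pO.
have B1 : (mu B < +oo)%E by rewrite /B rat_box_obox; exact: lebesgue_obox_lty.
pose G := g \_ B.
have iG : mu.-integrable setT (EFin \o G).
  rewrite /G -restrict_EFin; apply: (integrable_mkcond _ mB).1.
  exact: (L2_integrable mO mB BO B1 Lg).
have mG : measurable_fun setT (EFin \o G) := measurable_int _ iG.
have mG' : measurable_fun setT G by exact/measurable_EFinP.
have G0 a b : (\int[mu]_(x in obox a b) (G x)%:E = 0)%E.
  pose W := obox a b `&` B.
  have [a' [b' WE]] : exists a' b', W = obox a' b'.
    by rewrite /W /B rat_box_obox oboxI; do 2 eexists.
  have mW : measurable W by rewrite WE; exact: measurable_obox.
  pose F k x := (G x * box_bump a' b' k x)%:E.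
  have Fi k : mu.-integrable setT (F k).
    apply: (le_integrable measurableT _ _ iG) => [|x _].
      apply/measurable_EFinP; apply: measurable_funM => //.
      by apply: continuous_measurable_rVT; have [] := box_bump_smooth a' b' k [::].
    rewrite /F EFinM abseM /= lee_fin -[leRHS]mulr1 ler_wpM2l//.
    by rewrite ger0_norm ?box_bump_ge0 ?box_bump_le1.
  have F0 k : (\int[mu]_x F k x = 0)%E.
    rewrite -[LHS]fineK; last exact: integrable_fin_num.
    congr EFin; rewrite -[RHS](h (box_bump a' b' k)); last first.
      apply: (box_bump_test _ (@compact_rat_cbox p)) => //.
      by rewrite -WE => x -[_] /rat_box_sub.
    rewrite [RHS]Rintegral_mkcond; apply: eq_Rintegral => x _.
    rewrite /G !patchE.
    have [xB|xB] := boolP (x \in B).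
      by rewrite mem_set//; apply: BO; exact: set_mem.
    rewrite mul0r; case: ifP => // _; rewrite box_bump_out ?mulr0// -WE => -[_].
    by move/mem_set; rewrite (negbTE xB).
  have Fcvg x : F k x @[k --> \oo] --> (G x * \1_W x)%:E.
    apply/cvg_EFin; first by near=> k.
    apply: cvgM; first exact: cvg_cst.
    by rewrite WE; exact: box_bump_cvg.
  have mGW : measurable_fun setT (fun x => (G x * \1_W x)%:E).
    by apply/measurable_EFinP; apply: measurable_funM => //; exact: measurable_indic.
  have FG : {ae mu, forall x k, setT x -> (`|F k x| <= `|(G x)%:E|)%E}.
    apply: aeW => x k _; rewrite /F EFinM abseM -[leRHS]mule1 lee_pmul//= lee_fin.
    by rewrite ger0_norm ?box_bump_ge0 ?box_bump_le1.
  have [_ _] := @dominated_convergence _ _ R mu setT measurableT F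
     (fun x => (G x * \1_W x)%:E) (fun x => `|(G x)%:E|%E)
     (fun k => measurable_int _ (Fi k)) mGW (aeW _ (fun x _ => Fcvg x))
     (integrable_abse iG) FG.
  under eq_fun => k do rewrite F0.
  move=> /(cvg_unique (@ereal_hausdorff R)) => /(_ _ (cvg_cst _)) H.
  rewrite integral_mkcond -[RHS]H; apply: eq_integral => x _.
  rewrite patchE /G patchE indicE /W in_setI.
  by do 2 case: ifP => //= _; rewrite ?mulr1 ?mulr0 ?mul0r.
have iGS A : measurable A -> mu.-integrable A (EFin \o G).
  by move=> mA; exact: integrableS iG.
have gep x : (0 <= (EFin \o G)^\+ x)%E by exact: funepos_ge0.
have gen x : (0 <= (EFin \o G)^\- x)%E by exact: funeneg_ge0.
(* The vanishing of integrals passes from boxes to measurable sets by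
   uniqueness of measures, which needs nonnegative densities: g is split into
   its positive and negative parts. *)
have eqm A : measurable A ->
    (\int[mu]_(x in A) (EFin \o G)^\+ x = \int[mu]_(x in A) (EFin \o G)^\- x)%E.
  move=> mA.
  rewrite -(density_measureE mu (measurable_funepos mG) gep).
  rewrite -(density_measureE mu (measurable_funeneg mG) gen).
  apply: rV_measure_unique => // [a b|a b]; rewrite !density_measureE.
    have nfin : (\int[mu]_(x in obox a b) (EFin \o G)^\- x \is a fin_num)%E.
      by apply: integrable_neg_fin_num; last apply: iGS; exact: measurable_obox.
    by have := integralE mu (obox a b) (EFin \o G); rewrite [LHS]G0 => H;
      rewrite -[LHS](subeK _ nfin) -H add0e.
  rewrite -ge0_fin_numE ?integral_ge0//.
  by apply: integrable_pos_fin_num; last apply: iGS; exact: measurable_obox.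
have : ae_eq mu setT (EFin \o G) (cst 0%E).
  apply: integral_ae_eq => // A _ mA; rewrite integral0 integralE eqm// subee//.
  by apply: integrable_neg_fin_num => //; exact: iGS.
apply: filterS => x /(_ I) /=; rewrite /G patchE => + xB.
by rewrite mem_set// => -[].
Unshelve. all: by end_near. Qed.

End L2_theory.

(** * A weighted Cauchy-Schwarz inequality *)

Section cauchy_schwarz.
Context d (T : measurableType d) (R : realType) (mu : {measure set T -> \bar R}).

Section real_integrands.
Variables (D : set T) (f g : T -> R).
Hypotheses (mD : measurable D) (mf : measurable_fun D f) (mg : measurable_fun D g).
Hypothesis f0 : forall x, D x -> 0 <= f x.

Lemma ge0_le_integral_fin : (forall x, D x -> f x <= g x) ->
  (\int[mu]_(x in D) (f x)%:E <= \int[mu]_(x in D) (g x)%:E)%E.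
Proof.
by move=> fg; apply: ge0_le_integral => //; [exact/measurable_EFinP..].
Qed.

Lemma ge0_integralD_fin : (forall x, D x -> 0 <= g x) ->
  (\int[mu]_(x in D) (f x + g x)%:E =
   \int[mu]_(x in D) (f x)%:E + \int[mu]_(x in D) (g x)%:E)%E.
Proof.
move=> g0; rewrite -ge0_integralD//; first exact/measurable_EFinP.
exact/measurable_EFinP.
Qed.

Lemma ge0_integralZl_fin (a : R) : 0 <= a ->
  (\int[mu]_(x in D) (a * f x)%:E = a%:E * \int[mu]_(x in D) (f x)%:E)%E.
Proof.
by move=> a0; rewrite -ge0_integralZl//; exact/measurable_EFinP.
Qed.

End real_integrands.

(** The square of an average against the signed weight k. From AM-GM, |k f| <=
    |k| (l/2 + f^2/(2l)) for each l > 0; integrating and optimizing l gives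
    the bound. This route also proves integrability of k f. *)
Lemma cauchy_schwarz (D : set T) (k f : T -> R) (K : R) : measurable D ->
  measurable_fun D k -> measurable_fun D f -> 0 < K ->
  (\int[mu]_(x in D) `|k x|%:E <= K%:E)%E ->
  (((\int[mu]_(x in D) (k x * f x)) ^+ 2)%:E <=
   K%:E * \int[mu]_(x in D) (`|k x| * f x ^+ 2)%:E)%E.
Proof.
move=> mD mk mf K0 kK; set X := (\int[mu]_(x in D) (`|k x| * f x ^+ 2)%:E)%E.
have X0 : (0 <= X)%E by apply: integral_ge0 => x _; rewrite lee_fin mulr_ge0 ?sqr_ge0.
have [Xoo|] := eqVneq X +oo%E.
  by rewrite Xoo gt0_muley ?lte_fin// leey.
rewrite -ltey -ge0_fin_numE// => /fineK XE.
have mak : measurable_fun D (fun x => `|k x|) by exact: measurableT_comp.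
have mkf2 : measurable_fun D (fun x => `|k x| * f x ^+ 2).
  by apply: measurable_funM => //; exact: measurable_funX.
set r := `|\int[mu]_(x in D) (k x * f x)|.
have h (l : R) : 0 < l -> r <= l / 2 * K + (2 * l)^-1 * fine X.
  move=> l0.
  have bnd : (\int[mu]_(x in D) `|k x * f x|%:E <= (l / 2 * K + (2 * l)^-1 * fine X)%:E)%E.
    have l20 : 0 <= (2 * l)^-1 by rewrite invr_ge0 mulr_ge0// ltW.
    apply: (@le_trans _ _ (\int[mu]_(x in D) (l / 2 * `|k x| +
       (2 * l)^-1 * (`|k x| * f x ^+ 2))%:E)%E).
      apply: ge0_le_integral_fin => //.
      - by apply: measurableT_comp => //; exact: measurable_funM.
      - by apply: measurable_funD; exact: measurable_funM.
      move=> x _; rewrite normrM.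
      rewrite [X in _ <= X](_ : _ = `|k x| * (l / 2 + (2 * l)^-1 * f x ^+ 2)); last by ring.
      rewrite ler_wpM2l// -[f x ^+ 2]real_normK ?num_real//.
      rewrite -subr_ge0 (_ : _ - _ = (2 * l)^-1 * (l - `|f x|) ^+ 2).
        by rewrite mulr_ge0 ?sqr_ge0.
      by field; rewrite gt_eqF.
    have p0 x : D x -> 0 <= `|k x| * f x ^+ 2 by rewrite mulr_ge0 ?sqr_ge0.
    have p1 x : D x -> 0 <= l / 2 * `|k x| by rewrite mulr_ge0// divr_ge0// ltW.
    have p2 x : D x -> 0 <= (2 * l)^-1 * (`|k x| * f x ^+ 2).
      by move=> Dx; rewrite mulr_ge0// p0.
    have m1 : measurable_fun D (fun x => l / 2 * `|k x|) by apply: measurable_funM.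
    have m2 : measurable_fun D (fun x => (2 * l)^-1 * (`|k x| * f x ^+ 2)).
      by apply: measurable_funM.
    have l2 : 0 <= l / 2 by rewrite divr_ge0// ltW.
    rewrite (ge0_integralD_fin mD m1 m2 p1 p2) (ge0_integralZl_fin mD mkf2 p0 l20) (ge0_integralZl_fin mD mak _ l2)//.
    rewrite EFinD !EFinM XE leeD2r// -EFinM lee_pmul2l//.
    by rewrite lte_fin divr_gt0.
  have ikf : mu.-integrable D (fun x => (k x * f x)%:E).
    apply/integrableP; split; first by apply/measurable_EFinP; exact: measurable_funM.
    by apply: le_lt_trans bnd _; exact: ltry.
  have := le_normr_Rintegral mD ikf; rewrite -/r => /le_trans; apply.
  by rewrite -lee_fin fineK//; apply: integrable_fin_num => //; exact: integrable_norm ikf.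
rewrite -real_normK ?num_real// -/r -XE -EFinM lee_fin.
have x0 : 0 <= fine X by exact: fine_ge0.
have [r0|] := leP r 0.
  have -> : r = 0 by apply/eqP; rewrite eq_le r0 normr_ge0.
  by rewrite expr0n/= mulr_ge0// ltW.
(* With X the integral on the right, the bound l K/2 + X/(2l) at l = r/K is
   r/2 + K X/(2r), whence r^2 <= K X. *)
move=> r0; have := h (r / K) (divr_gt0 r0 K0).
rewrite (_ : _ / 2 * K = r / 2); last by field; rewrite gt_eqF.
rewrite (_ : (_)^-1 * _ = (K * fine X) / (2 * r)); last by field; rewrite !gt_eqF.
move: (K * fine X) => Y; rewrite -lerBlDl (_ : r - _ = r / 2); last by field.
by rewrite ler_pdivlMr ?mulr_gt0// => h'; apply: le_trans h'; rewrite le_eqVlt; apply/orP; left; apply/eqP; field.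
Qed.

End cauchy_schwarz.

(** * The squared L^2 modulus of continuity *)

Section shifts.
Context {R : realType} {d : nat}.
Local Notation E := 'rV[R]_d.
Local Notation mu := (lebesgue_rV R d).

(** All Sobolev information enters the proof through this quantity, the square
    of the L^2 distance between f and its translate: it controls averages of f
    and, integrated against a power of |h|, it is the Gagliardo seminorm. *)
Definition shift_sq (f : E -> R) (h : E) : \bar R :=
  (\int[mu]_x ((f (x + h)%R - f x) ^+ 2)%:E)%E.

Lemma measurable_shift (f : E -> R) h : measurable_fun setT f ->
  measurable_fun setT (fun x : E => f (x + h)).
Proof.
move=> mf; apply: (measurableT_comp mf).
have := measurable_affine (1 : R) h; congr (measurable_fun _ _).
by apply/funext => x; rewrite scale1r.
Qed.

Lemma measurable_sqr (f : E -> R) D : measurable_fun D f -> measurable_fun D (fun x => (f x ^+ 2)%:E).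
Proof. by move=> mf; apply/measurable_EFinP; exact: measurable_funX. Qed.

Lemma measurable_shift_sqr (f : E -> R) h : measurable_fun setT f ->
  measurable_fun setT (fun x : E => ((f (x + h)%R - f x) ^+ 2)%:E).
Proof.
move=> mf; apply: measurable_sqr; apply: measurable_funB => //.
exact: measurable_shift.
Qed.

Lemma integral_sqrD (f g : E -> R) D : measurable D -> measurable_fun D f -> measurable_fun D g ->
  (\int[mu]_(x in D) ((f x + g x) ^+ 2)%:E <=
   2%:E * (\int[mu]_(x in D) (f x ^+ 2)%:E + \int[mu]_(x in D) (g x ^+ 2)%:E))%E.
Proof.
move=> mD mf mg.
have mf2 : measurable_fun D (fun x => f x ^+ 2) by exact: measurable_funX.
have mg2 : measurable_fun D (fun x => g x ^+ 2) by exact: measurable_funX.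
rewrite -ge0_integralD_fin//; try by move=> x _; rewrite sqr_ge0.
rewrite -ge0_integralZl_fin//; last 2 first.
- exact: measurable_funD.
- by move=> x _; rewrite addr_ge0 ?sqr_ge0.
apply: ge0_le_integral_fin => //.
- by apply: measurable_funX; exact: measurable_funD.
- by apply: measurable_funM => //; exact: measurable_funD.
- by move=> x _; rewrite sqr_ge0.
move=> x _; rewrite -subr_ge0.
by rewrite (_ : _ - _ = (f x - g x) ^+ 2) ?sqr_ge0//; ring.
Qed.

Lemma integral_sqrB (f g : E -> R) D : measurable D -> measurable_fun D f -> measurable_fun D g ->
  (\int[mu]_(x in D) ((f x - g x) ^+ 2)%:E <=
   2%:E * (\int[mu]_(x in D) (f x ^+ 2)%:E + \int[mu]_(x in D) (g x ^+ 2)%:E))%E.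
Proof.
move=> mD mf mg; have mg' : measurable_fun D (fun x => - g x) by exact: measurableT_comp.
have := integral_sqrD mD mf mg'; congr (_ <= _ * (_ + _))%E.
by apply: eq_integral => x _; rewrite sqrrN.
Qed.

Lemma integral_sqr_shift (f : E -> R) h : measurable_fun setT f ->
  (\int[mu]_x (f (x + h)%R ^+ 2)%:E = \int[mu]_x (f x ^+ 2)%:E)%E.
Proof.
move=> mf; apply: (@ge0_integral_shift R d h (fun x => (f x ^+ 2)%:E)).
  exact: measurable_sqr.
by move=> x; rewrite lee_fin sqr_ge0.
Qed.

(** The modulus is subadditive up to a factor, since translations are
    isometries of L^2; this reduces a general translation to translations
    along the axes. *)
Lemma shift_sqD f h h' : measurable_fun setT f ->
  (shift_sq f (h + h') <= 2%:E * (shift_sq f h + shift_sq f h'))%E.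
Proof.
move=> mf; have mh := measurable_shift h mf.
rewrite /shift_sq -[X in (_ + X)%E](integral_sqr_shift h); last first.
  by apply: measurable_funB => //; exact: measurable_shift.
rewrite addeC; apply: le_trans (integral_sqrD _ _ _) => //.
- rewrite le_eqVlt; apply/orP; left; apply/eqP; apply: eq_integral => x _.
  by congr (_%:E); rewrite addrA; ring.
- apply: measurable_funB => //.
  apply: (@measurable_shift (fun x : E => f (x + h'))); exact: measurable_shift.
- exact: measurable_funB.
Qed.

Lemma shift_sq_le4 f h : measurable_fun setT f ->
  (shift_sq f h <= 4%:E * \int[mu]_x (f x ^+ 2)%:E)%E.
Proof.
move=> mf; apply: le_trans (integral_sqrB _ _ _) _ => //; first exact: measurable_shift.
rewrite integral_sqr_shift//; move: (integral _ _ _) => X.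
case: X => [x| |]; last 2 first.
- by rewrite addye// !gt0_muley ?lte_fin.
- by rewrite addNye// !gt0_muleNy ?lte_fin.
by rewrite -EFinD -!EFinM lee_fin; lra.
Qed.

Lemma shift_sq0 f : shift_sq f 0 = 0%E.
Proof.
by rewrite /shift_sq integral0_eq// => x _; rewrite addr0 subrr expr0n.
Qed.

Lemma shift_sqN f h : measurable_fun setT f -> shift_sq f (- h) = shift_sq f h.
Proof.
move=> mf; rewrite /shift_sq -[LHS](integral_sqr_shift h); last first.
  by apply: measurable_funB => //; exact: measurable_shift.
by apply: eq_integral => x _; rewrite addrK -[in RHS]sqrrN opprB.
Qed.

End shifts.

(** * Differentiation and integration along lines *)

Lemma is_derive_line_at (R : realType) (V : normedModType R) (f : V -> R) (x v : V) (s l : R) :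
  is_derive (s *: v + x) v f l -> is_derive s 1 (fun t : R => f (t *: v + x)) l.
Proof.
have E : (fun h : R => h^-1 *: ((f \o shift (s *: v + x)) (h *: v) - f (s *: v + x))) =
   (fun h : R => h^-1 *: (((fun t : R => f (t *: v + x)) \o shift s) (h *: 1) - f (s *: v + x))).
  by apply/funext => h /=; rewrite [h *: 1]mulr1 addrA -scalerDl.
by move=> -[d1 d2]; split; move: d1 d2; rewrite /derivable /derive E.
Qed.

Section line.
Context {R : realType} {d : nat}.
Local Notation E := 'rV[R]_d.
Local Notation mu := (lebesgue_rV R d).
Local Notation leb := (@lebesgue_measure R).

Lemma line_continuous (f : E -> R) (x v : E) :
  continuous f -> continuous (fun s : R => f (s *: v + x)).
Proof.
move=> cf s; apply: (@continuous_comp _ _ _ (fun s : R => s *: v + x) f); last exact: cf.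
by apply: cvgD; [apply: cvgZr_tmp; exact: cvg_id|exact: cvg_cst].
Qed.

Lemma integral_indic_fin d' (T : measurableType d') (m : {measure set T -> \bar R})
    (D : set T) (g : T -> R) :
  (\int[m]_(s in D) (g s)%:E = \int[m]_s (\1_D s * g s)%:E)%E.
Proof.
rewrite integral_mkcond; apply: eq_integral => s _; rewrite patchE indicE.
by case: ifP => _; rewrite ?mul1r ?mul0r.
Qed.

Lemma measurable_line (f : E -> R) (v : E) : measurable_fun setT f ->
  measurable_fun setT (fun p : R * E => f (p.1 *: v + p.2)).
Proof.
move=> mf; apply: (measurableT_comp mf); apply: measurable_to_rV => i.
apply: (eq_measurable_fun (fun p : R * E => p.1 * v ord0 i + p.2 ord0 i)).
  by move=> p _; rewrite !mxE.
apply: measurable_funD; first by apply: measurable_funM.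
exact: (measurableT_comp (measurable_rV_coord i)).
Qed.

Lemma lebesgue_itvcc0 (t : R) : 0 < t -> (leb `[0%R, t]%classic = t%:E)%E.
Proof. by move=> t0; rewrite lebesgue_measure_itv/= lte_fin t0 sube0. Qed.

Lemma measurable_line1 (f : E -> R) (v x : E) : measurable_fun setT f ->
  measurable_fun setT (fun s : R => f (s *: v + x)).
Proof.
move=> mf; exact: (measurableT_comp (measurable_line v mf) (pair2_measurable x)).
Qed.

Lemma measurable_line2 (f : E -> R) (v : E) (s : R) : measurable_fun setT f ->
  measurable_fun setT (fun x : E => f (s *: v + x)).
Proof.
move=> mf; exact: (measurableT_comp (measurable_line v mf) (pair1_measurable s)).
Qed.

Variables (v : E) (F F' : E -> R).
Hypotheses (cF : continuous F) (cF' : continuous F').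
Hypothesis dF : forall x, is_derive x v F (F' x).

Lemma line_FTC (x : E) (t : R) : 0 < t ->
  (\int[leb]_(s in `[0%R, t]) (F' (s *: v + x)%R)%:E = (F (t *: v + x)%R - F x)%:E)%E.
Proof.
move=> t0.
have cG := @line_continuous F x v cF; have cG' := @line_continuous F' x v cF'.
have dG (s : R) : is_derive s 1 (fun t : R => F (t *: v + x)) (F' (s *: v + x)).
  by apply: is_derive_line_at.
rewrite (@continuous_FTC2 R (fun s => F' (s *: v + x)) (fun s => F (s *: v + x)))//.
- by rewrite scale0r add0r EFinB.
- exact: continuous_subspaceT.
- split.
  + by move=> s _; have [] := dG s.
  + by apply: cvg_at_right_filter; exact: cG.
  + by apply: cvg_at_left_filter; exact: cG.
- by move=> s _; rewrite derive1E; have [] := dG s.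
Qed.

(** F(x + t v) - F(x) is the integral of F' over a segment; Cauchy-Schwarz in
    s costs a factor t, and integrating in x first (Tonelli), by translation
    invariance, gives another t. *)
Lemma shift_sq_line_pos t : 0 < t ->
  (shift_sq F (t *: v) <= (t ^+ 2)%:E * \int[mu]_x (F' x ^+ 2)%:E)%E.
Proof.
move=> t0; have mF' := continuous_measurable_rVT cF'.
have mI : measurable (`[0%R, t]%classic : set (measurableTypeR R)) by exact: measurable_itv.
pose H (p : R * E) : R := \1_(`[0%R, t]%classic) p.1 * F' (p.1 *: v + p.2) ^+ 2.
have mH : measurable_fun setT (EFin \o H).
  apply/measurable_EFinP; apply: measurable_funM.
    exact: (measurableT_comp (measurable_indic mI)).
  by apply: measurable_funX; exact: measurable_line.
have H0 p : (0 <= (EFin \o H) p)%E by rewrite lee_fin mulr_ge0 ?sqr_ge0.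
apply: (@le_trans _ _ (\int[mu]_x (t%:E * \int[leb]_s (H (s, x))%:E))%E).
  apply: ge0_le_integral => //.
  - by move=> x _; rewrite lee_fin sqr_ge0.
  - by apply: measurable_shift_sqr; exact: continuous_measurable_rVT.
  - apply: emeasurable_funM => //.
  - exact: (@measurable_fun_fubini_tonelli_G _ _ _ _ _ leb (EFin \o H) mH H0).
  move=> x _; have ml : measurable_fun `[0%R, t] (fun s => F' (s *: v + x)).
    by apply: measurable_funTS; exact: (measurable_line1 v x mF').
  have := @cauchy_schwarz _ _ R leb `[0%R, t]%classic (cst 1) (fun s => F' (s *: v + x)) t mI
    (measurable_cst _) ml t0.
  have -> : (\int[leb]_(x in `[0%R, t]) `|cst 1 x|%:E = t%:E)%E.
    under eq_integral do rewrite /= normr1.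
    by rewrite integral_cst// mul1e; exact: lebesgue_itvcc0.
  move=> /(_ (lexx _)).
  rewrite (_ : (\int[leb]_(x0 in `[0%R, t]) _)%R = F (x + t *: v) - F x); last first.
    rewrite /Rintegral; under eq_integral => s _ do rewrite mul1r.
    by rewrite line_FTC//= (addrC x).
  congr (_ <= _ * _)%E; rewrite integral_indic_fin; apply: eq_integral => s _.
  by rewrite /H/= normr1 mul1r.
rewrite ge0_integralZl//; last 3 first.
- exact: (@measurable_fun_fubini_tonelli_G _ _ _ _ _ leb (EFin \o H) mH H0).
- by move=> x _; apply: integral_ge0 => s _; exact: H0.
- by rewrite lee_fin ltW.
have -> : (\int[mu]_x \int[leb]_s (H (s, x))%:E = \int[leb]_s \int[mu]_x (H (s, x))%:E)%E.
  exact: (esym (@fubini_tonelli _ _ _ _ R leb mu (EFin \o H) mH H0)).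
have HE s : (\int[mu]_x (H (s, x))%:E = (\1_(`[0%R, t]%classic) s)%:E * \int[mu]_x (F' x ^+ 2)%:E)%E.
  rewrite /H/= ge0_integralZl_fin//; last 2 first.
  - apply: measurable_funX; exact: (measurable_line2 v s mF').
  - by move=> x _; rewrite sqr_ge0.
  congr (_ * _)%E; rewrite -[RHS](integral_sqr_shift (s *: v) mF').
  by apply: eq_integral => x _; rewrite addrC.
under eq_integral do rewrite HE.
have N0 : (0 <= \int[mu]_x (F' x ^+ 2)%:E)%E.
  by apply: integral_ge0 => x _; rewrite lee_fin sqr_ge0.
rewrite ge0_integralZr//; last exact/measurable_EFinP/measurable_indic.
rewrite integral_indic// setIT [X in (_ * (X * _))%E](lebesgue_itvcc0 t0).
by rewrite muleA -EFinM expr2.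
Qed.

Lemma shift_sq_line t :
  (shift_sq F (t *: v) <= (t ^+ 2)%:E * \int[mu]_x (F' x ^+ 2)%:E)%E.
Proof.
have [t0|t0|->] := ltgtP t 0; last 2 first.
- exact: shift_sq_line_pos.
- by rewrite scale0r shift_sq0 expr0n/= mul0e.
rewrite -(opprK t) scaleNr shift_sqN; last exact: continuous_measurable_rVT.
by rewrite sqrrN; apply: shift_sq_line_pos; rewrite oppr_gt0.
Qed.

(** Integrate F(x + v) - F(x) in x: the result is 0 by translation invariance,
    and by the fundamental theorem of calculus and Fubini it is the integral
    of F' over R^n. This is integration by parts without boundary. *)
Lemma integral_derive0 : mu.-integrable setT (EFin \o F) ->
  mu.-integrable setT (EFin \o F') -> (\int[mu]_x (F' x)%:E = 0)%E.
Proof.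
move=> iF iF'; have mF' := continuous_measurable_rVT cF'.
have mI : measurable (`[0%R, 1%R]%classic : set (measurableTypeR R)) by exact: measurable_itv.
pose H (p : R * E) : R := \1_(`[0%R, 1%R]%classic) p.1 * F' (p.1 *: v + p.2).
have mH : measurable_fun setT (EFin \o H).
  apply/measurable_EFinP; apply: measurable_funM; last exact: measurable_line.
  exact: (measurableT_comp (measurable_indic mI)).
have shiftF' s : (\int[mu]_x (F' (s *: v + x)%R)%:E = \int[mu]_x (F' x)%:E)%E.
  rewrite -[RHS](integral_shift (s *: v) (measurable_int _ iF')).
  by apply: eq_integral => x _; rewrite addrC.
have iH : (leb \x mu)%E.-integrable setT (EFin \o H).
  apply: (@integrable12ltyP _ _ _ _ R leb mu _ mH).2.
  have HE s : (\int[mu]_x `|(EFin \o H) (s, x)| =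
      (\1_(`[0%R, 1%R]%classic) s)%:E * \int[mu]_x `|F' x|%:E)%E.
    rewrite /H/=; under eq_integral do rewrite normrM ger0_norm//.
    rewrite ge0_integralZl_fin//; last first.
      apply: measurableT_comp => //; exact: (measurable_line2 v s mF').
    congr (_ * _)%E.
    rewrite -[RHS](@ge0_integral_shift _ _ (s *: v) (fun x => `|F' x|%:E))//.
      by apply: eq_integral => x _; rewrite addrC.
    by apply/measurable_EFinP; exact: measurableT_comp.
  under eq_integral do rewrite HE.
  rewrite ge0_integralZr//; [|exact/measurable_EFinP/measurable_indic|exact: integral_ge0].
  rewrite integral_indic// setIT [X in (X * _)%E](lebesgue_itvcc0 ltr01) mul1e.
  by have /integrableP[] := iF'.
have := Fubini iH.
have -> : (\int[leb]_x \int[mu]_y (EFin \o H) (x, y) = \int[mu]_x (F' x)%:E)%E.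
  have HE s : (\int[mu]_x (EFin \o H) (s, x) =
      (\1_(`[0%R, 1%R]%classic) s)%:E * \int[mu]_x (F' x)%:E)%E.
    rewrite /H/=; under eq_integral do rewrite EFinM.
    rewrite integralZl//; first by rewrite shiftF'.
    apply/integrableP; split.
      apply/measurable_EFinP; exact: (measurable_line2 v s mF').
    have /integrableP[_] := iF'; congr (_ < _)%E.
    rewrite -[LHS](@ge0_integral_shift _ _ (s *: v) (fun x => `|F' x|%:E))//.
      by apply: eq_integral => x _; rewrite addrC.
    by apply/measurable_EFinP; exact: measurableT_comp.
  under eq_integral do rewrite HE.
  have /fineK <- : (\int[mu]_x (F' x)%:E \is a fin_num)%E by exact: integrable_fin_num.
  rewrite integralZr//; last first.
    apply/integrableP; split; first exact/measurable_EFinP/measurable_indic.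
    under eq_integral do rewrite gee0_abs ?lee_fin//.
    by rewrite integral_indic// setIT [X in (X < _)%E](lebesgue_itvcc0 ltr01) ltry.
  by rewrite integral_indic// setIT [X in (X * _)%E](lebesgue_itvcc0 ltr01) mul1e.
move=> ->.
transitivity (\int[mu]_y ((F (y + v)%R)%:E - (F y)%:E))%E.
  apply: eq_integral => x _; rewrite /H/= -integral_indic_fin.
  by rewrite line_FTC// scale1r (addrC v) EFinB.
have iF1 : mu.-integrable setT (fun x : E => (F (x + v)%R)%:E).
  apply/integrableP; split.
    by apply/measurable_EFinP; apply: measurable_shift; exact: continuous_measurable_rVT.
  have /integrableP[mF0] := iF; congr (_ < _)%E.
  rewrite -[LHS](@ge0_integral_shift _ _ v (fun x => `|(F x)%:E|%E))//.
  exact: measurableT_comp.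
rewrite integralB_EFin//.
rewrite (integral_shift v (measurable_int _ iF)) subee//.
exact: integrable_fin_num.
Qed.

End line.

(** * Test functions *)

Section test_functions.
Context {R : realType} {d : nat}.
Local Notation E := 'rV[R]_d.
Local Notation mu := (lebesgue_rV R d).
Implicit Types (O : set E) (f g : E -> R).

Lemma coord_le_norm (x : E) i : `|x ord0 i| <= `|x|.
Proof.
have /mapP[j Hj e] : `|x ord0 i| \in [seq `|x y.1 y.2| | y : 'I_1 * 'I_d].
  by apply/mapP; exists (ord0, i) => //=; rewrite mem_enum.
by rewrite e [leRHS]/Num.Def.normr /= mx_normrE; apply/bigmax_geP; right => /=; exists j.
Qed.

Lemma bounded_cube (A : set E) : bounded_set A -> exists2 r : R, 0 < r & A `<=` cube r.
Proof.
move=> [M [_ hM]]; exists (`|M| + 1) => [|x Ax i].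
  by rewrite ltr_wpDl.
rewrite /= in_itv/= -ler_norml; apply: le_trans (coord_le_norm x i) _.
by apply: hM => //; rewrite (le_lt_trans (ler_norm M))// ltrDl.
Qed.

Lemma test_fun_partial O f i : test_fun O f -> test_fun O (partial i f).
Proof.
move=> [sf [K [cK KO f0]]]; split.
  by move=> l; have := sf (rcons l i); rewrite foldr_rcons.
exists K; split => // x Kx; rewrite /partial.
have oK : open (~` K) by apply: closed_openC; apply: compact_closed => //; exact: norm_hausdorff.
rewrite (@near_eq_derive _ _ _ f (cst 0)) ?derive_cst//.
have : \near x, (~` K) x by apply: open_nbhs_nbhs; split.
by apply: filterS => y /f0.
Qed.

Lemma test_fun_continuous O f : test_fun O f -> continuous f.
Proof. by move=> [sf _]; have [] := sf [::]. Qed.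

Lemma test_fun_measurable O f : test_fun O f -> measurable_fun setT f.
Proof. by move=> /test_fun_continuous/continuous_measurable_rVT. Qed.

Lemma test_fun_is_derive O f i x : test_fun O f -> is_derive x (evec i) f (partial i f x).
Proof. by move=> [sf _]; have [_ h] := sf [::]; split => //; exact: h. Qed.

Lemma test_fun_out O f x : test_fun O f -> ~ O x -> f x = 0.
Proof. by move=> [_ [K [_ KO f0]]] Ox; apply: f0 => /KO. Qed.

Lemma test_fun_bounded O f : test_fun O f -> exists M r : R, [/\ 0 <= M, 0 <= r,
  forall x, `|f x| <= M & forall x, ~ cube r x -> f x = 0].
Proof.
move=> tf; have [sf [K [cK KO f0]]] := tf.
have [r r0 Kr] := bounded_cube (compact_bounded cK).
have cfK : {within K, continuous f}.
  by apply: continuous_subspaceT; exact: test_fun_continuous tf.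
have [M [_ hM]] := compact_bounded (continuous_compact cfK cK).
exists (`|M| + 1), r; split; [by rewrite addr_ge0|exact: ltW| |].
  move=> x; have [Kx|Kx] := pselect (K x); last by rewrite f0// normr0 addr_ge0.
  by apply: (hM (`|M| + 1)); [rewrite (le_lt_trans (ler_norm M))// ltrDl|exists x].
by move=> x xr; apply: f0 => /Kr.
Qed.

Lemma test_fun_L2 O D f : measurable D -> test_fun O f -> L2 D f.
Proof.
move=> mD tf; have mf := test_fun_measurable tf.
split; first exact: measurable_funTS.
have [M [r [M0 r0 fM fr]]] := test_fun_bounded tf.
have mc : measurable (cube r : set E) by exact: measurable_cube.
apply: (@le_lt_trans _ _ (\int[mu]_x ((M ^+ 2) * \1_(cube r) x)%:E)%E).
  apply: (@le_trans _ _ (\int[mu]_x (f x ^+ 2)%:E)%E).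
    apply: ge0_subset_integral => //; first exact: measurable_sqr.
    by move=> x _; rewrite lee_fin sqr_ge0.
  apply: ge0_le_integral_fin => //.
  - exact: measurable_funX.
  - by apply: measurable_funM => //; exact: measurable_indic.
  - by move=> x _; rewrite sqr_ge0.
  move=> x _; rewrite indicE; have [xr|xr] := pselect (cube r x).
    rewrite mem_set// mulr1 -real_normK ?num_real//.
    by rewrite lerXn2r ?nnegrE.
  by rewrite fr// expr0n/= mulr_ge0 ?sqr_ge0.
have mi : measurable_fun setT (\1_(cube r) : E -> R) by exact: measurable_indic.
rewrite ge0_integralZl_fin ?sqr_ge0//.
rewrite integral_indic// setIT [X in (_ * X)%E](lebesgue_cube d r0).
by rewrite -EFinM ltry.
Qed.

Lemma test_funB O f g : test_fun O f -> test_fun O g -> test_fun O (f - g).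
Proof.
move=> [sf [K [cK KO f0]]] [sg [L [cL LO g0]]]; split; last first.
  exists (K `|` L); split; first exact: compactU.
    by move=> x [/KO|/LO].
  by move=> x /not_orP[Kx Lx]; rewrite !fctE f0// g0// subrr.
have fE l : foldr partial (f - g) l = foldr partial f l - foldr partial g l.
  elim: l => //= i l ->; apply/funext => x; rewrite /partial deriveB//.
    by have [_] := sf l; apply.
  by have [_] := sg l; apply.
move=> l /=; rewrite fE; have [cf df] := sf l; have [cg dg] := sg l; split.
  by move=> x; exact: (continuousB (cf x) (cg x)).
by move=> i x; exact: derivableB.
Qed.

Lemma test_funM_integrable O f g : test_fun O f -> test_fun O g ->
  mu.-integrable setT (fun x => (f x * g x)%:E).
Proof.
by move=> tf tg; apply: L2M_integrable => //; [exact: test_fun_L2 tf|exact: test_fun_L2 tg].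
Qed.

(** The product f g has integrable derivative f' g + f g', whose integral is
    0. *)
Lemma test_fun_ibp O f g i : test_fun O f -> test_fun O g ->
  \int[mu]_x (f x * partial i g x) = - \int[mu]_x (partial i f x * g x).
Proof.
move=> tf tg; have tf' := test_fun_partial i tf; have tg' := test_fun_partial i tg.
have cf := test_fun_continuous tf; have cg := test_fun_continuous tg.
have cf' := test_fun_continuous tf'; have cg' := test_fun_continuous tg'.
apply/eqP; rewrite -addr_eq0 -RintegralD//; [|exact: (test_funM_integrable tf tg')|exact: (test_funM_integrable tf' tg)].
apply/eqP; rewrite /Rintegral.
suff -> : (\int[mu]_x (f x * partial i g x + partial i f x * g x)%:E = 0)%E by [].
apply: (@integral_derive0 R d (evec i) (f * g)
  (fun x => f x * partial i g x + partial i f x * g x)).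
- by move=> x; exact: (continuousM (cf x) (cg x)).
- by move=> x; exact: (continuousD (continuousM (cf x) (cg' x)) (continuousM (cf' x) (cg x))).
- move=> x.
  apply: (is_derive_eq (is_deriveM (test_fun_is_derive i x tf) (test_fun_is_derive i x tg))).
  by rewrite /GRing.scale/=; ring.
- exact: (test_funM_integrable tf tg).
- exact: (integrableD _ (test_funM_integrable tf tg') (test_funM_integrable tf' tg)).
Qed.

Definition classical_grad (f : E -> R) : E -> E := fun x => \row_i partial i f x.

Lemma Rintegral_out O f : (forall x, ~ O x -> f x = 0) ->
  \int[mu]_(x in O) f x = \int[mu]_x f x.
Proof.
move=> f0; rewrite Rintegral_mkcond; apply: eq_Rintegral => x _.
by rewrite patchE; case: ifPn => // /negP xO; rewrite f0// => /mem_set.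
Qed.

Lemma test_fun_weak_grad O f : measurable O -> test_fun O f -> is_weak_grad O f (classical_grad f).
Proof.
move=> mO tf; split => [i|i g tg].
  rewrite (_ : (fun _ => _) = partial i f); last by apply/funext => x; rewrite mxE.
  apply: test_fun_L2 => //; exact: (test_fun_partial i tf).
rewrite (@Rintegral_out O (fun x => f x * partial i g x)) => [|x Ox]; last first.
  by rewrite (test_fun_out tf)// mul0r.
rewrite (@Rintegral_out O (fun x => classical_grad f x ord0 i * g x)) => [|x Ox]; last first.
  by rewrite (test_fun_out tg)// mulr0.
rewrite (test_fun_ibp i tf tg); congr (- _); apply: eq_Rintegral => x _.
by rewrite mxE.
Qed.

Lemma test_fun_H1 O f : measurable O -> test_fun O f -> H1 O f.
Proof.
move=> mO tf; split; first exact: test_fun_L2 tf.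
by exists (classical_grad f); exact: test_fun_weak_grad.
Qed.

Lemma enorm_sqr (x : E) : enorm x ^+ 2 = \sum_(i < d) x ord0 i ^+ 2.
Proof. by rewrite /enorm sqr_sqrtr// sumr_ge0// => i _; rewrite sqr_ge0. Qed.

Lemma enorm_ge0 (x : E) : 0 <= enorm x.
Proof. exact: sqrtr_ge0. Qed.

Lemma coord_le_enorm (x : E) i : `|x ord0 i| <= enorm x.
Proof.
rewrite -[leRHS]ger0_norm ?enorm_ge0// -ler_sqr ?nnegrE// !real_normK ?num_real//.
rewrite enorm_sqr (bigD1 i)//= lerDl sumr_ge0// => j _; exact: sqr_ge0.
Qed.

(** A translation by h is a succession of d translations along the axes, each
    controlled by one partial derivative. The factor 2^d comes from applying
    the subadditivity of the modulus d times. *)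
Lemma test_fun_shift O f h : test_fun O f ->
  (shift_sq f h <= (2 ^+ d * enorm h ^+ 2)%:E *
    \int[mu]_x (\sum_(i < d) partial i f x ^+ 2)%:E)%E.
Proof.
move=> tf; set G := (\int[mu]_x _)%E.
have mf := test_fun_measurable tf.
have mp i : measurable_fun setT (partial i f) := test_fun_measurable (test_fun_partial i tf).
have G0 : (0 <= G)%E.
  by apply: integral_ge0 => x _; rewrite lee_fin sumr_ge0// => i _; rewrite sqr_ge0.
have Gi i : (\int[mu]_x (partial i f x ^+ 2)%:E <= G)%E.
  apply: ge0_le_integral_fin => //.
  - exact: measurable_funX.
  - by apply: measurable_sum => j; exact: measurable_funX.
  - by move=> x _; rewrite sqr_ge0.
  by move=> x _; rewrite (bigD1 i)//= lerDl sumr_ge0// => j _; exact: sqr_ge0.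
have hi i : (shift_sq f (h ord0 i *: evec i) <= (h ord0 i ^+ 2)%:E * G)%E.
  apply: (@le_trans _ _ ((h ord0 i ^+ 2)%:E * \int[mu]_x (partial i f x ^+ 2)%:E)%E).
    apply: shift_sq_line; first exact: test_fun_continuous tf.
      exact: (test_fun_continuous (test_fun_partial i tf)).
    by move=> x; exact: test_fun_is_derive tf.
  by rewrite lee_wpmul2l ?lee_fin ?sqr_ge0.
have key (s : seq 'I_d) : (shift_sq f (\sum_(i <- s) h ord0 i *: evec i) <=
    (2 ^+ size s * \sum_(i <- s) h ord0 i ^+ 2)%:E * G)%E.
  elim: s => [|i s IHs]; first by rewrite !big_nil shift_sq0 mulr0 mul0e.
  rewrite !big_cons; apply: le_trans (shift_sqD _ _ mf) _.
  have s0 : 0 <= \sum_(j <- s) h ord0 j ^+ 2 by rewrite sumr_ge0// => j _; rewrite sqr_ge0.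
  apply: (@le_trans _ _ (2%:E * ((h ord0 i ^+ 2)%:E * G +
     (2 ^+ size s * \sum_(i <- s) h ord0 i ^+ 2)%:E * G))%E).
    by rewrite lee_wpmul2l// leeD.
  rewrite -ge0_muleDl ?lee_fin ?sqr_ge0 ?mulr_ge0 ?exprn_ge0//.
  rewrite muleA -EFinM lee_wpmul2r// lee_fin (exprS 2 (size s)) -[leRHS]mulrA ler_pM2l// mulrDr lerD2r.
  by rewrite ler_peMl ?sqr_ge0// exprn_ege1// ler1n.
have := key (index_enum 'I_d); rewrite enorm_sqr.
have -> : \sum_i h ord0 i *: evec i = h.
  by rewrite [RHS]row_sum_delta; apply: eq_bigr => i _; rewrite /evec.
rewrite (_ : size _ = d)//; have := size_enum_ord d; rewrite enumT.
by move/esym; rewrite -[in size (index_enum _)]/(index_enum _).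
Qed.

End test_functions.

(** * Weak gradients and the spaces H^1 and H^1_0 *)

Section weak_gradients.
Context {R : realType} {d : nat}.
Local Notation E := 'rV[R]_d.
Local Notation mu := (lebesgue_rV R d).
Variables (O : set E) (oO : open O).
Let mO : measurable O := open_measurable_rV oO.
Implicit Types (u v f : E -> R) (g : E -> E).

Definition L2sq u : R := \int[mu]_(x in O) (u x ^+ 2).
Definition gradsq u : R := \int[mu]_(x in O) (enorm (grad O u x) ^+ 2).

Lemma L2sq_EFin u : L2 O u -> (L2sq u)%:E = (\int[mu]_(x in O) (u x ^+ 2)%:E)%E.
Proof.
move=> Lu; rewrite /L2sq /Rintegral fineK//.
apply: integrable_fin_num => //; exact: L2_sqr_integrable.
Qed.

Lemma L2sq_ge0 u : 0 <= L2sq u.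
Proof. by apply: Rintegral_ge0 => x _; rewrite sqr_ge0. Qed.

Lemma gradsq_ge0 u : 0 <= gradsq u.
Proof. by apply: Rintegral_ge0 => x _; rewrite sqr_ge0. Qed.

Lemma H1norm_sqr u : H1norm O u ^+ 2 = L2sq u + gradsq u.
Proof. by rewrite /H1norm sqr_sqrtr// addr_ge0 ?L2sq_ge0 ?gradsq_ge0. Qed.

Lemma H1norm_ge0 u : 0 <= H1norm O u.
Proof. exact: sqrtr_ge0. Qed.

Lemma grad_weak u : H1 O u -> is_weak_grad O u (grad O u).
Proof. by move=> [_ [g gu]]; rewrite /grad; apply: (@xgetPex _ _ [set g | is_weak_grad O u g]); exists g. Qed.

Lemma weak_gradB u v g g' : L2 O u -> L2 O v -> is_weak_grad O u g ->
  is_weak_grad O v g' -> is_weak_grad O (u - v) (g - g').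
Proof.
move=> Lu Lv [Lg hg] [Lg' hg']; split => [i|i f tf].
  rewrite (_ : (fun _ => _) = (fun x => g x ord0 i) - (fun x => g' x ord0 i)).
    exact: L2B.
  by apply/funext => x; rewrite !fctE !mxE.
have Lf := test_fun_L2 mO tf; have Lf' := test_fun_L2 mO (test_fun_partial i tf).
have -> : \int[mu]_(x in O) ((u - v) x * partial i f x) =
    \int[mu]_(x in O) (u x * partial i f x) - \int[mu]_(x in O) (v x * partial i f x).
  rewrite -RintegralB//; [|exact: L2M_integrable..].
  by apply: eq_Rintegral => x _; rewrite !fctE mulrBl.
have -> : \int[mu]_(x in O) ((g - g') x ord0 i * f x) =
    \int[mu]_(x in O) (g x ord0 i * f x) - \int[mu]_(x in O) (g' x ord0 i * f x).
  rewrite -RintegralB//; [|exact: (L2M_integrable mO (Lg i))|exact: (L2M_integrable mO (Lg' i))].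
  by apply: eq_Rintegral => x _; rewrite !fctE !mxE mulrBl.
by rewrite hg// hg'// opprB opprK addrC.
Qed.

(** The gradient of an H^1 function is an arbitrarily chosen weak gradient, so
    that every computation with it, linearity included, rests on this
    uniqueness. *)
Lemma weak_grad_unique u g g' : is_weak_grad O u g -> is_weak_grad O u g' ->
  {ae mu, forall x, O x -> g x = g' x}.
Proof.
move=> [Lg hg] [Lg' hg'].
have H i : {ae mu, forall x, O x -> g x ord0 i - g' x ord0 i = 0}.
  apply: fundamental_lemma_calc_var => //; first exact: L2B.
  move=> f tf; have Lf := test_fun_L2 mO tf.
  have -> : \int[mu]_(x in O) ((g x ord0 i - g' x ord0 i) * f x) =
      \int[mu]_(x in O) (g x ord0 i * f x) - \int[mu]_(x in O) (g' x ord0 i * f x).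
    rewrite -RintegralB//; [|exact: (L2M_integrable mO (Lg i))|exact: (L2M_integrable mO (Lg' i))].
    by apply: eq_Rintegral => x _; rewrite mulrBl.
  by apply/eqP; rewrite subr_eq0 -eqr_opp -hg// -hg'.
have : {ae mu, forall x (i : 'I_d), O x -> g x ord0 i - g' x ord0 i = 0}.
  exact: filter_forall.
by apply: filterS => x h Ox; apply/rowP => i; apply/eqP; rewrite -subr_eq0 h.
Qed.

Lemma grad_unique u g : H1 O u -> is_weak_grad O u g ->
  {ae mu, forall x, O x -> grad O u x = g x}.
Proof. by move=> /grad_weak; exact: weak_grad_unique. Qed.

Lemma H1B u v : H1 O u -> H1 O v -> H1 O (u - v).
Proof.
move=> Hu Hv; split; first by apply: L2B => //; [exact: Hu.1|exact: Hv.1].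
exists (grad O u - grad O v); apply: weak_gradB; [exact: Hu.1|exact: Hv.1|exact: grad_weak..].
Qed.

Lemma gradB u v : H1 O u -> H1 O v ->
  {ae mu, forall x, O x -> grad O (u - v) x = grad O u x - grad O v x}.
Proof.
move=> Hu Hv; apply: (grad_unique (H1B Hu Hv)).
apply: weak_gradB; [exact: Hu.1|exact: Hv.1|exact: grad_weak..].
Qed.

Definition L2v g := forall i, L2 O (fun x => g x ord0 i).

Lemma L2v_measurable g : L2v g -> measurable_fun O (fun x => enorm (g x) ^+ 2).
Proof.
move=> Lg; under eq_fun => x do rewrite enorm_sqr.
by apply: measurable_sum => i; apply: measurable_funX; exact: (Lg i).1.
Qed.

Lemma L2v_integrable g : L2v g -> mu.-integrable O (fun x => (enorm (g x) ^+ 2)%:E).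
Proof.
move=> Lg; rewrite (_ : (fun _ => _) =
    (fun x => \sum_(i <- index_enum 'I_d) (g x ord0 i ^+ 2)%:E)%E); last first.
  by apply/funext => x; rewrite enorm_sqr sumEFin.
by apply: integrable_sum => // i _; apply: L2_sqr_integrable => //; exact: Lg.
Qed.

Lemma enormB_sqr (a b : E) : enorm (a - b) ^+ 2 <= 2 * (enorm a ^+ 2 + enorm b ^+ 2).
Proof.
rewrite !enorm_sqr -big_split/= mulr_sumr; apply: ler_sum => i _.
rewrite !mxE -subr_ge0 (_ : _ - _ = (a ord0 i + b ord0 i) ^+ 2) ?sqr_ge0//; ring.
Qed.

Lemma ae_eq_Rintegral (a b : E -> R) : measurable_fun O a -> measurable_fun O b ->
  {ae mu, forall x, O x -> a x = b x} ->
  \int[mu]_(x in O) a x = \int[mu]_(x in O) b x.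
Proof.
move=> ma mb ab; congr fine; apply: ae_eq_integral => //; [exact/measurable_EFinP..|].
by apply: filterS ab => x h Ox; rewrite h.
Qed.

Lemma gradsqB u v : H1 O u -> H1 O v ->
  gradsq (u - v) <= 2 * (gradsq u + gradsq v).
Proof.
move=> Hu Hv; have [Lgu _] := grad_weak Hu; have [Lgv _] := grad_weak Hv.
have [Lguv _] := grad_weak (H1B Hu Hv).
have LB : L2v (fun x => grad O u x - grad O v x).
  move=> i; rewrite (_ : (fun _ => _) =
    (fun x => grad O u x ord0 i) - (fun x => grad O v x ord0 i)); first exact: L2B.
  by apply/funext => x; rewrite !fctE !mxE.
have iu := L2v_integrable Lgu; have iv := L2v_integrable Lgv.
have iuv := integrableD mO iu iv.
have -> : gradsq (u - v) = \int[mu]_(x in O) (enorm (grad O u x - grad O v x) ^+ 2).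
  apply: ae_eq_Rintegral; [exact: L2v_measurable..|].
  by apply: filterS (gradB Hu Hv) => x h Ox; rewrite h.
have -> : 2 * (gradsq u + gradsq v) = \int[mu]_(x in O)
    (2 * (enorm (grad O u x) ^+ 2 + enorm (grad O v x) ^+ 2)).
  rewrite (@RintegralZl _ _ _ mu O
    (fun x => enorm (grad O u x) ^+ 2 + enorm (grad O v x) ^+ 2) 2 mO iuv).
  by rewrite (@RintegralD _ _ _ mu O (fun x => enorm (grad O u x) ^+ 2)
    (fun x => enorm (grad O v x) ^+ 2) mO iu iv).
apply: le_Rintegral => //; first exact: L2v_integrable.
  exact: (integrableZl mO 2 iuv).
by move=> x _; exact: enormB_sqr.
Qed.

Lemma L2sqB u v : L2 O u -> L2 O v -> L2sq (u - v) <= 2 * (L2sq u + L2sq v).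
Proof.
move=> Lu Lv; rewrite -lee_fin L2sq_EFin; last exact: L2B.
apply: le_trans (integral_sqrB mO Lu.1 Lv.1) _.
by rewrite -!L2sq_EFin.
Qed.

Lemma H1normB u v : H1 O u -> H1 O v ->
  H1norm O (u - v) ^+ 2 <= 2 * (H1norm O u ^+ 2 + H1norm O v ^+ 2).
Proof.
move=> Hu Hv.
rewrite [leLHS]H1norm_sqr [X in _ <= _ * (X + _)]H1norm_sqr [X in _ <= _ * (_ + X)]H1norm_sqr.
have := gradsqB Hu Hv. have := L2sqB Hu.1 Hv.1.
move: (gradsq (u - v)) (gradsq u) (gradsq v) (L2sq (u - v)) (L2sq u) (L2sq v).
by move=> a b c a' b' c'; lra.
Qed.

Lemma H10B u v : H10 O u -> H10 O v -> H10 O (u - v).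
Proof.
move=> [Hu hu] [Hv hv]; split; first exact: H1B.
move=> e e0; have e2 : 0 < e / 2 by rewrite divr_gt0.
have [f tf hf] := hu _ e2; have [g tg hg] := hv _ e2.
exists (f - g); first exact: test_funB.
have -> : u - v - (f - g) = (u - f) - (v - g).
  by apply/funext => x; rewrite !fctE; ring.
rewrite -ltr_sqr ?nnegrE ?H1norm_ge0// ?ltW//.
apply: le_lt_trans (H1normB _ _) _.
- exact: H1B Hu (test_fun_H1 mO tf).
- exact: H1B Hv (test_fun_H1 mO tg).
move: hf hg; have := H1norm_ge0 (u - f); have := H1norm_ge0 (v - g).
move: (H1norm O (u - f)) (H1norm O (v - g)) => a b b0 a0 ha hb.
have : a ^+ 2 < (e / 2) ^+ 2 by rewrite ltr_sqr ?nnegrE// ltW.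
have : b ^+ 2 < (e / 2) ^+ 2 by rewrite ltr_sqr ?nnegrE// ltW.
by lra.
Qed.

(** A test function has its classical gradient as weak gradient, and the
    chosen weak gradient agrees with it almost everywhere. Both vanish off O,
    which turns the integral over O into one over the whole space. *)
Lemma gradsq_test_fun f : test_fun O f ->
  ((gradsq f)%:E = \int[mu]_x (\sum_(i < d) partial i f x ^+ 2)%:E)%E.
Proof.
move=> tf; have wf := test_fun_weak_grad mO tf.
have Hf := test_fun_H1 mO tf.
rewrite /gradsq (@ae_eq_Rintegral _ (fun x => enorm (classical_grad f x) ^+ 2)).
- rewrite Rintegral_out; last first.
    move=> x Ox; rewrite enorm_sqr big1// => i _; rewrite mxE.
    by rewrite (test_fun_out (test_fun_partial i tf))// expr0n.
  have -> : (fun x => enorm (classical_grad f x) ^+ 2) = (fun x => \sum_(i < d) partial i f x ^+ 2).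
    by apply/funext => x; rewrite enorm_sqr; apply: eq_bigr => i _; rewrite mxE.
  rewrite /Rintegral fineK//; apply: integrable_fin_num => //.
  rewrite (_ : (fun _ => _) =
    (fun x => \sum_(i <- index_enum 'I_d) (partial i f x ^+ 2)%:E)%E); last first.
    by apply/funext => x; rewrite sumEFin.
  apply: integrable_sum => // i _; apply: L2_sqr_integrable => //.
  exact: test_fun_L2 (test_fun_partial i tf).
- by apply: L2v_measurable; have [] := grad_weak Hf.
- by apply: L2v_measurable; case: wf.
- by apply: filterS (grad_unique Hf wf) => x h Ox; rewrite h.
Qed.

End weak_gradients.

(** * Translation and Poincare estimates in H^1_0 *)

Section H10_estimates.
Context {R : realType} {d : nat}.
Local Notation E := 'rV[R]_d.
Local Notation mu := (lebesgue_rV R d).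
Variables (O : set E) (oO : open O).
Let mO : measurable O := open_measurable_rV oO.
Implicit Types (u v f : E -> R) (g : E -> E).

Lemma measurable_extension u : L2 O u -> measurable_fun setT (u \_ O).
Proof. by move=> Lu; apply/(measurable_restrictT _ mO); exact: Lu.1. Qed.

Lemma integral_extension u :
  (\int[mu]_x ((u \_ O) x ^+ 2)%:E = \int[mu]_(x in O) (u x ^+ 2)%:E)%E.
Proof.
rewrite [RHS]integral_mkcond; apply: eq_integral => x _.
by rewrite !patchE; case: ifP => //; rewrite expr0n.
Qed.

(** The factor 2 comes from ||a - b||^2 <= 2 (||a||^2 + ||b||^2), with f = u -
    (u - f). *)
Lemma H10_approx u (e : R) : H10 O u -> 0 < e ->
  exists f, [/\ test_fun O f, (\int[mu]_(x in O) ((u x - f x) ^+ 2)%:E <= e%:E)%E &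
    ((gradsq O f)%:E <= (2 * (gradsq O u + e))%:E)%E].
Proof.
move=> [Hu hu] e0; have [f tf hf] := hu (Num.sqrt e) (etrans (sqrtr_gt0 _) e0).
have Hf := test_fun_H1 mO tf; have Huf := H1B oO Hu Hf.
have hf2 : H1norm O (u - f) ^+ 2 < e.
  by rewrite -[ltRHS](sqr_sqrtr (ltW e0)) ltr_sqr ?nnegrE ?sqrtr_ge0 ?H1norm_ge0.
have {}hf2 : L2sq O (u - f) + gradsq O (u - f) <= e.
  by move: hf2; rewrite [in ltLHS]H1norm_sqr => /ltW.
have l0 := L2sq_ge0 O (u - f); have g0 := gradsq_ge0 O (u - f).
exists f; split => //.
  rewrite -[leLHS](L2sq_EFin oO (L2B mO Hu.1 Hf.1)) lee_fin.
  by apply: le_trans hf2; rewrite lerDl.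
rewrite lee_fin.
have -> : gradsq O f = gradsq O (u - (u - f)).
  by congr gradsq; apply/funext => x; rewrite !fctE; ring.
apply: le_trans (gradsqB oO Hu Huf) _.
rewrite ler_pM2l// lerD2l; apply: le_trans hf2; by rewrite lerDr.
Qed.

(** The zero extension of a function of H^1_0 has no jump at the boundary of
    O: it is an L^2 limit of test functions, for which the estimate holds. *)
Lemma H10_shift u h : H10 O u ->
  (shift_sq (u \_ O) h <= (2 ^+ d * 4 * enorm h ^+ 2 * gradsq O u)%:E)%E.
Proof.
move=> Hu; have Lu := Hu.1.1; have mu' := measurable_extension Lu.
set G := gradsq O u; have G0 : 0 <= G := gradsq_ge0 O u.
set C := (2 ^+ d * enorm h ^+ 2 : R).
have C0 : 0 <= C by rewrite mulr_ge0 ?sqr_ge0// exprn_ge0.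
have -> : 2 ^+ d * 4 * enorm h ^+ 2 * G = 4 * C * G by rewrite /C; ring.
(* With w the difference between the extension of u and f, the total error is
   2 (4 e + 2 C e), which this e makes equal to a. *)
apply/lee_addgt0Pr => a a0; pose e := a / (8 + 4 * C).
have D0 : 0 < 8 + 4 * C by rewrite ltr_wpDr// mulr_ge0.
have e0 : 0 < e by rewrite divr_gt0.
have [f [tf uf gf]] := H10_approx Hu e0.
have mf := test_fun_measurable tf.
pose w : E -> R := (u \_ O : E -> R) - f.
have mb : measurable_fun setT w by exact: measurable_funB.
have uE : (u \_ O) = (fun x => w x + f x).
  by apply/funext => x; rewrite /w !fctE subrK.
have h1 : (shift_sq w h <= (4 * e)%:E)%E.
  apply: le_trans (shift_sq_le4 h mb) _; rewrite EFinM lee_wpmul2l//.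
  apply: le_trans uf; rewrite -integral_extension.
  rewrite le_eqVlt; apply/orP; left; apply/eqP; apply: eq_integral => x _.
  rewrite /w !fctE !patchE; case: ifPn => // /negP xO.
  by rewrite (test_fun_out tf) ?subrr// => /mem_set.
have h2 : (shift_sq f h <= (C * (2 * (G + e)))%:E)%E.
  apply: le_trans (test_fun_shift h tf) _.
  by rewrite -(gradsq_test_fun oO tf) [leRHS]EFinM lee_wpmul2l.
apply: (@le_trans _ _ (2%:E * (shift_sq w h + shift_sq f h))%E).
  have := integral_sqrD measurableT (measurable_funB (measurable_shift h mb) mb)
    (measurable_funB (measurable_shift h mf) mf).
  congr (_ <= _)%E; apply: eq_integral => x _; rewrite uE/=; congr (_%:E); ring.
apply: (@le_trans _ _ (2%:E * ((4 * e)%:E + (C * (2 * (G + e)))%:E))%E).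
  by rewrite lee_wpmul2l// leeD.
rewrite -EFinD -EFinM -EFinD lee_fin.
have -> : a = e * (8 + 4 * C) by rewrite /e divfK// gt_eqF.
by rewrite le_eqVlt; apply/orP; left; apply/eqP; ring.
Qed.

(** Translate along an axis by more than the width of O: the supports of the
    extension of u and of its translate are disjoint, so the L^2 norm of u is
    at most that of their difference, which H10_shift bounds. *)
Lemma poincare (r : R) (i0 : 'I_d) : 0 < r -> O `<=` cube r ->
  forall u, H10 O u -> L2sq O u <= 2 ^+ d * 8 * (2 * r + 1) ^+ 2 * gradsq O u.
Proof.
move=> r0 Or u Hu; have Lu := Hu.1.1; have mu' := measurable_extension Lu.
have G0 := gradsq_ge0 O u.
pose h : E := (2 * r + 1) *: evec i0.
have hE : enorm h ^+ 2 = (2 * r + 1) ^+ 2.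
  rewrite enorm_sqr (bigD1 i0)//= big1 ?addr0 => [|j ji]; rewrite !mxE eqxx/=.
    by rewrite eqxx mulr1.
  by rewrite (negbTE ji) mulr0 expr0n.
have := H10_shift h Hu; rewrite hE => H.
have : ((L2sq O u)%:E <= shift_sq (u \_ O) h)%E.
  rewrite L2sq_EFin// -integral_extension -(integral_sqr_shift h mu').
  apply: ge0_le_integral_fin => //.
  - by apply: measurable_funX; exact: measurable_shift.
  - by apply: measurable_funX; apply: measurable_funB => //; exact: measurable_shift.
  - by move=> x _; rewrite sqr_ge0.
  move=> x _; rewrite !patchE; case: ifPn => [xhO|_]; last by rewrite expr0n sqr_ge0.
  case: ifPn => [xO|]; last by rewrite subr0.
  have /Or/(_ i0) := set_mem xhO; have /Or/(_ i0) := set_mem xO.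
  rewrite /= !in_itv/= !mxE !eqxx/= mulr1 => /andP[a1 a2] /andP[b1 b2].
  by exfalso; lra.
move=> /le_trans/(_ H); rewrite lee_fin => /le_trans; apply.
rewrite ler_wpM2r// ler_wpM2r ?sqr_ge0// ler_wpM2l ?exprn_ge0//; lra.
Qed.

End H10_estimates.

(** * Averaging by an integrable kernel *)

Section convolution.
Context {R : realType} {d : nat}.
Local Notation E := 'rV[R]_d.
Local Notation mu := (lebesgue_rV R d).
Variables (k : E -> R) (K M rho : R).
Hypotheses (mk : measurable_fun setT k) (K0 : 0 < K).
Hypotheses (kM : {ae mu, forall z, `|k z| <= M}).
Hypothesis kK : (\int[mu]_z `|k z|%:E <= K%:E)%E.
Hypothesis krho : {ae mu, forall z, k z != 0 -> enorm z <= rho}.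
Hypothesis k1 : forall x, \int[mu]_y k (x - y) = 1.

Definition convolve (v : E -> R) (x : E) : R := \int[mu]_y (k (x - y) * v y).

Lemma measurable_diff_kernel : measurable_fun setT (fun p : E * E => k (p.1 - p.2)).
Proof.
apply: (measurableT_comp mk); apply: measurable_to_rV => i.
apply: (eq_measurable_fun (fun p : E * E => p.1 ord0 i - p.2 ord0 i)).
  by move=> p _; rewrite !mxE.
by apply: measurable_funB; exact: (measurableT_comp (measurable_rV_coord i)).
Qed.

Lemma measurable_add_pair (v : E -> R) : measurable_fun setT v ->
  measurable_fun setT (fun p : E * E => v (p.1 + p.2)).
Proof.
move=> mv; apply: (measurableT_comp mv); apply: measurable_to_rV => i.
apply: (eq_measurable_fun (fun p : E * E => p.1 ord0 i + p.2 ord0 i)).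
  by move=> p _; rewrite !mxE.
by apply: measurable_funD; exact: (measurableT_comp (measurable_rV_coord i)).
Qed.

Lemma measurable_kernel_x x : measurable_fun setT (fun y : E => k (x - y)).
Proof. exact: (measurableT_comp measurable_diff_kernel (pair1_measurable x)). Qed.

Lemma measurable_kernel_y y : measurable_fun setT (fun x : E => k (x - y)).
Proof. exact: (measurableT_comp measurable_diff_kernel (pair2_measurable y)). Qed.

Lemma kernel_xM x : {ae mu, forall y, `|k (x - y)| <= M}.
Proof.
have N1 : (-1 : R) != 0 by rewrite oppr_eq0 oner_eq0.
have := negligible_affine N1 x kM; apply: negligibleS => y /= h h'; apply: h.
by have -> : x - y = -1 *: y + x by rewrite scaleN1r addrC.
Qed.

Lemma kernel_xK x : (\int[mu]_y `|k (x - y)|%:E <= K%:E)%E.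
Proof.
have N1 : (-1 : R) != 0 by rewrite oppr_eq0 oner_eq0.
apply: le_trans kK; have mak : measurable_fun setT (fun z => `|k z|%:E).
  by apply/measurable_EFinP; exact: measurableT_comp.
have := ge0_integral_affine N1 x mak (fun z => _).
rewrite normrN1 expr1n invr1 mul1e => <-//.
by under eq_integral => y _ do rewrite addrC -scaleN1r.
Qed.

Lemma kernel_yK y : (\int[mu]_x `|k (x - y)|%:E = \int[mu]_z `|k z|%:E)%E.
Proof.
apply: (@ge0_integral_shift R d (- y) (fun z => `|k z|%:E)) => //.
by apply/measurable_EFinP; exact: measurableT_comp.
Qed.

Lemma kernel_x_integrable x : mu.-integrable setT (fun y : E => (k (x - y))%:E).
Proof.
apply/integrableP; split; first by apply/measurable_EFinP; exact: measurable_kernel_x.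
by apply: le_lt_trans (kernel_xK x) _; rewrite ltry.
Qed.

Lemma kernelM_integrable x v : mu.-integrable setT (EFin \o v) ->
  mu.-integrable setT (fun y : E => (k (x - y) * v y)%:E).
Proof.
move=> iv; have mv : measurable_fun setT v by have /measurable_EFinP := measurable_int _ iv.
apply/integrableP; split.
  by apply/measurable_EFinP; apply: measurable_funM => //; exact: measurable_kernel_x.
apply: (@le_lt_trans _ _ (\int[mu]_y (`|M| * `|v y|)%:E)%E).
  apply: ae_ge0_le_integral.
  - exact: measurableT.
  - by move=> y _; exact: abse_ge0.
  - by apply/measurable_EFinP; apply: measurableT_comp => //; apply: measurable_funM => //; exact: measurable_kernel_x.
  - by move=> y _; rewrite lee_fin mulr_ge0.
  - by apply/measurable_EFinP; apply: measurable_funM => //; exact: measurableT_comp.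
  apply: filterS (kernel_xM x) => y h _; rewrite lee_fin normrM ler_wpM2r//.
  exact: le_trans h (ler_norm _).
rewrite ge0_integralZl_fin//; last exact: measurableT_comp.
by rewrite lte_mul_pinfty// ?lee_fin//; have /integrableP[] := iv.
Qed.

Lemma convolve_measurable v : mu.-integrable setT (EFin \o v) -> measurable_fun setT (convolve v).
Proof.
move=> iv; have mv : measurable_fun setT v by have /measurable_EFinP := measurable_int _ iv.
have mF : measurable_fun setT (fun p : E * E => (k (p.1 - p.2) * v p.2)%:E).
  apply/measurable_EFinP; apply: measurable_funM; first exact: measurable_diff_kernel.
  exact: (measurableT_comp mv).
apply: (measurableT_comp (fine_measurable measurableT)).
rewrite (_ : (fun _ => _) = (fun x => \int[mu]_y (fun p : E * E => (k (p.1 - p.2) * v p.2)%:E)^\+ (x, y)) \-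
   (fun x => \int[mu]_y (fun p : E * E => (k (p.1 - p.2) * v p.2)%:E)^\- (x, y)))%E; last first.
  apply/funext => x; rewrite integralE; congr (_ - _)%E; apply: eq_integral => y _.
    by rewrite funepos.unlock.
  by rewrite funeneg.unlock.
apply: emeasurable_funB.
- apply: (@measurable_fun_fubini_tonelli_F _ _ _ _ _ mu _ (measurable_funepos mF)).
  by move=> p; exact: funepos_ge0.
- apply: (@measurable_fun_fubini_tonelli_F _ _ _ _ _ mu _ (measurable_funeneg mF)).
  by move=> p; exact: funeneg_ge0.
Qed.

Variables (v : E -> R).
Hypothesis iv : mu.-integrable setT (EFin \o v).
Let mv : measurable_fun setT v.
Proof. by have /measurable_EFinP := measurable_int _ iv. Qed.

Lemma convolve_diffE x : v x - convolve v x = \int[mu]_y (k (x - y) * (v x - v y)).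
Proof.
rewrite -[X in X - _]mul1r -{1}(k1 x) -RintegralZr//; last exact: kernel_x_integrable.
rewrite /convolve -RintegralB//; last 2 first.
- under eq_fun => y do rewrite /= mulrC.
  exact: (integrableZl measurableT (v x) (kernel_x_integrable x)).
- exact: kernelM_integrable.
by apply: eq_Rintegral => y _; rewrite mulrBr.
Qed.

(** As k has mass 1, v - k * v is the average of v(x) - v(x - z) against k(z).
    Cauchy-Schwarz and Tonelli bound its square by the average of the modulus
    of continuity over the support of k, where |z| <= rho. One factor K comes
    from Cauchy-Schwarz, the other from the mass of |k|. *)
Lemma convolve_dist (A : R) : 0 <= A ->
  (forall z, shift_sq v z <= (A * enorm z ^+ 2)%:E)%E ->
  (\int[mu]_x ((v x - convolve v x) ^+ 2)%:E <= (K * K * (A * rho ^+ 2))%:E)%E.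
Proof.
move=> A0 hA; have AR0 : 0 <= A * rho ^+ 2 by rewrite mulr_ge0 ?sqr_ge0.
pose G (p : E * E) : R := `|k (p.1 - p.2)| * (v p.1 - v p.2) ^+ 2.
have mG : measurable_fun setT (EFin \o G).
  apply/measurable_EFinP; apply: measurable_funM.
    by apply: measurableT_comp => //; exact: measurable_diff_kernel.
  by apply: measurable_funX; apply: measurable_funB; exact: (measurableT_comp mv).
have G0 p : (0 <= (EFin \o G) p)%E by rewrite lee_fin mulr_ge0 ?sqr_ge0.
have mGx := @measurable_fun_fubini_tonelli_F _ _ _ _ _ mu (EFin \o G) mG G0.
have mc := convolve_measurable iv.
apply: (@le_trans _ _ (\int[mu]_x (K%:E * \int[mu]_y (G (x, y))%:E))%E).
  apply: ge0_le_integral => //.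
  - by move=> x _; rewrite lee_fin sqr_ge0.
  - by apply: measurable_sqr; exact: measurable_funB.
  - by apply: emeasurable_funM.
  move=> x _; rewrite convolve_diffE.
  apply: (cauchy_schwarz measurableT (measurable_kernel_x x) _ K0 (kernel_xK x)).
  exact: measurable_funB.
rewrite ge0_integralZl//; last 2 first.
- by move=> x _; apply: integral_ge0 => y _; exact: G0.
- by rewrite lee_fin ltW.
rewrite -mulrA [leRHS]EFinM lee_pmul2l//.
have -> : (\int[mu]_x \int[mu]_y (G (x, y))%:E = \int[mu]_y \int[mu]_x (G (x, y))%:E)%E.
  exact: (@fubini_tonelli _ _ _ _ R mu mu (EFin \o G) mG G0).
pose H (p : E * E) : R := `|k p.2| * (v (p.1 + p.2) - v p.1) ^+ 2.
have mH : measurable_fun setT (EFin \o H).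
  apply/measurable_EFinP; apply: measurable_funM.
    by apply: measurableT_comp => //; exact: (measurableT_comp mk).
  apply: measurable_funX; apply: measurable_funB; first exact: measurable_add_pair.
  exact: (measurableT_comp mv).
have H0 p : (0 <= (EFin \o H) p)%E by rewrite lee_fin mulr_ge0 ?sqr_ge0.
have -> : (\int[mu]_y \int[mu]_x (G (x, y))%:E = \int[mu]_y \int[mu]_z (H (y, z))%:E)%E.
  apply: eq_integral => y _.
  rewrite -(@ge0_integral_shift R d y (fun x => (G (x, y))%:E)).
  - by apply: eq_integral => z _; rewrite /G/H/= addrK (addrC z).
  - exact: (measurableT_comp mG (pair2_measurable y)).
  - by move=> x; exact: (G0 (x, y)).
have -> : (\int[mu]_y \int[mu]_z (H (y, z))%:E = \int[mu]_z \int[mu]_y (H (y, z))%:E)%E.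
  exact: (@fubini_tonelli _ _ _ _ R mu mu (EFin \o H) mH H0).
have HE z : (\int[mu]_y (H (y, z))%:E = `|k z|%:E * shift_sq v z)%E.
  rewrite /H/= ge0_integralZl_fin//.
    by apply: measurable_funX; apply: measurable_funB => //; exact: measurable_shift.
  by move=> y _; rewrite sqr_ge0.
apply: (@le_trans _ _ (\int[mu]_z (A * rho ^+ 2 * `|k z|)%:E)%E).
  apply: ae_ge0_le_integral.
  - exact: measurableT.
  - by move=> z _; apply: integral_ge0 => y _; exact: (H0 (y, z)).
  - exact: (@measurable_fun_fubini_tonelli_G _ _ _ _ _ mu (EFin \o H) mH H0).
  - by move=> z _; rewrite lee_fin mulr_ge0.
  - apply/measurable_EFinP; apply: measurable_funM => //; exact: measurableT_comp.
  apply: filterS krho => z hz _; rewrite HE.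
  have [kz|kz] := eqVneq (k z) 0; first by rewrite kz normr0 mul0e mulr0.
  rewrite mulrC EFinM lee_wpmul2l//; apply: le_trans (hA z) _.
  rewrite lee_fin ler_wpM2l// lerXn2r ?nnegrE ?enorm_ge0 ?hz//.
  exact: le_trans (enorm_ge0 _) (hz kz).
rewrite ge0_integralZl_fin//; last exact: measurableT_comp.
by rewrite [leRHS]EFinM [leRHS]muleC lee_wpmul2l.
Qed.

(** Convolution commutes with translations and is bounded on L^2 by the mass
    of |k|. *)
Lemma convolve_shift h : (shift_sq (convolve v) h <= (K * K)%:E * shift_sq v h)%E.
Proof.
have ivh : mu.-integrable setT (fun y : E => (v (y + h))%:E).
  apply/integrableP; split; first by apply/measurable_EFinP; exact: measurable_shift.
  have /integrableP[mF0] := iv; congr (_ < _)%E.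
  rewrite -[LHS](@ge0_integral_shift _ _ h (fun x => `|(v x)%:E|%E))//.
  exact: measurableT_comp.
have convE x : convolve v (x + h) - convolve v x = \int[mu]_y (k (x - y) * (v (y + h) - v y)).
  transitivity (\int[mu]_y (k (x - y) * v (y + h)) - convolve v x).
    congr (_ - _); rewrite /convolve /Rintegral.
    rewrite -[in LHS](integral_shift h (measurable_int _ (kernelM_integrable (x + h) iv))).
    by congr fine; apply: eq_integral => y _; rewrite opprD addrACA subrr addr0.
  rewrite /convolve -RintegralB//; [|exact: (kernelM_integrable x ivh)|exact: kernelM_integrable].
  by apply: eq_Rintegral => y _; rewrite mulrBr.
pose w (y : E) := v (y + h) - v y.
have mw : measurable_fun setT w by apply: measurable_funB => //; exact: measurable_shift.
pose G (p : E * E) : R := `|k (p.1 - p.2)| * (w p.2) ^+ 2.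
have mG : measurable_fun setT (EFin \o G).
  apply/measurable_EFinP; apply: measurable_funM.
    by apply: measurableT_comp => //; exact: measurable_diff_kernel.
  by apply: measurable_funX; exact: (measurableT_comp mw).
have G0 p : (0 <= (EFin \o G) p)%E by rewrite lee_fin mulr_ge0 ?sqr_ge0.
have mGx := @measurable_fun_fubini_tonelli_F _ _ _ _ _ mu (EFin \o G) mG G0.
have mc := convolve_measurable iv.
apply: (@le_trans _ _ (\int[mu]_x (K%:E * \int[mu]_y (G (x, y))%:E))%E).
  apply: ge0_le_integral => //.
  - by move=> x _; rewrite lee_fin sqr_ge0.
  - exact: measurable_shift_sqr.
  - by apply: emeasurable_funM.
  move=> x _; rewrite convE.
  exact: (cauchy_schwarz measurableT (measurable_kernel_x x) mw K0 (kernel_xK x)).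
rewrite ge0_integralZl//; last 2 first.
- by move=> x _; apply: integral_ge0 => y _; exact: G0.
- by rewrite lee_fin ltW.
rewrite EFinM -muleA lee_pmul2l//.
have -> : (\int[mu]_x \int[mu]_y (G (x, y))%:E = \int[mu]_y \int[mu]_x (G (x, y))%:E)%E.
  exact: (@fubini_tonelli _ _ _ _ R mu mu (EFin \o G) mG G0).
rewrite /shift_sq -ge0_integralZl//; last 3 first.
- exact: measurable_sqr.
- by move=> y _; rewrite lee_fin sqr_ge0.
- by rewrite lee_fin ltW.
apply: ge0_le_integral => //.
- by move=> y _; apply: integral_ge0 => x _; exact: (G0 (x, y)).
- exact: (@measurable_fun_fubini_tonelli_G _ _ _ _ _ mu (EFin \o G) mG G0).
- by apply: emeasurable_funM => //; exact: measurable_sqr.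
move=> y _; rewrite /G/=; under eq_integral do rewrite mulrC.
rewrite ge0_integralZl_fin ?sqr_ge0//; last by apply: measurableT_comp => //; exact: measurable_kernel_y.
by rewrite muleC lee_wpmul2r ?lee_fin ?sqr_ge0// kernel_yK.
Qed.

End convolution.

(** * Dyadic decomposition of the Gagliardo seminorm *)

Section dyadic.
Context {R : realType}.

Lemma exprn_powR (a s : R) n : 0 <= a -> (a ^+ n) `^ s = (a `^ s) ^+ n.
Proof. by move=> a0; rewrite -!powR_mulrn ?powR_ge0// powRAC. Qed.

Lemma geometric_nneseries (c q : R) : 0 <= q < 1 ->
  (\sum_(k <oo) (c * q ^+ k)%:E = (c / (1 - q))%:E)%E.
Proof.
move=> /andP[q0 q1]; apply: cvg_lim => //.
have := @cvg_geometric_series R c q; rewrite ger0_norm// => /(_ q1) H.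
rewrite (_ : (fun _ => _) = EFin \o series (geometric c q)).
  by apply: cvg_EFin; [near=> k|exact: H].
by apply/funext => k; rewrite /series/= sumEFin.
Unshelve. all: by end_near. Qed.

Lemma inner_shell (eps x : R) : 0 < x -> x <= eps ->
  exists k : nat, eps * 2^-1 ^+ k.+1 < x <= eps * 2^-1 ^+ k.
Proof.
move=> x0 xe; have e0 : 0 < eps by exact: lt_le_trans xe.
have ex : exists k : nat, eps * 2^-1 ^+ k.+1 < x.
  have := @cvg_geometric R eps 2^-1; rewrite ger0_norm ?invr_ge0//.
  have h1 : 2^-1 < 1 :> R by rewrite invf_lt1// ltr1n.
  move=> /(_ h1)/cvgrPdist_lt/(_ _ x0)[k _ hk]; exists k.
  have := hk k.+1 (leqnSn k); rewrite sub0r normrN /= ger0_norm//.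
  by rewrite mulr_ge0 ?exprn_ge0 ?invr_ge0// ltW.
case: (ex_minnP ex) => k hk kmin; exists k; rewrite hk/=.
case: k hk kmin => [|k] hk kmin; first by rewrite expr0 mulr1.
by rewrite leNgt; apply/negP => /kmin; rewrite ltnn.
Qed.

Lemma outer_shell (eps x : R) : 0 < eps -> eps < x ->
  exists k : nat, eps * 2 ^+ k < x <= eps * 2 ^+ k.+1.
Proof.
move=> e0 xe.
have ex : exists k : nat, x <= eps * 2 ^+ k.+1.
  have [k hk] : exists k : nat, x / eps <= k%:R.
    exists (Num.bound (x / eps)); apply/ltW/archi_boundP.
    by rewrite divr_ge0// ltW// (lt_trans e0).
  exists k; rewrite mulrC -ler_pdivrMr//; apply: le_trans hk _.
  rewrite -natrX ler_nat; exact: leq_trans (ltnW (ltn_expl k (ltnSn 1))) (leq_pexp2l _ (leqnSn k)).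
case: (ex_minnP ex) => k hk kmin; exists k; rewrite hk andbT.
case: k hk kmin => [|k] hk kmin; first by rewrite expr0 mulr1.
by rewrite ltNge; apply/negP => /kmin; rewrite ltnn.
Qed.

Lemma powR_shell (x p : R) n : 0 < x ->
  x ^+ n / x `^ p = x `^ (n%:R - p).
Proof.
by move=> x0; rewrite powRB ?powR_mulrn ?ltW//; apply/implyP => _; rewrite gt_eqF.
Qed.

End dyadic.

Section gagliardo_bound.
Context {R : realType} {d : nat}.
Local Notation E := 'rV[R]_d.
Local Notation mu := (lebesgue_rV R d).

Lemma enorm_measurable : measurable_fun setT (@enorm R d).
Proof.
apply: (@measurableT_comp _ _ _ _ _ _ (@Num.sqrt R)).
  by apply: continuous_measurable_fun; exact: sqrt_continuous.
apply: measurable_sum => i; apply: measurable_funX; exact: measurable_rV_coord.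
Qed.

Lemma enormN (x : E) : enorm (- x) = enorm x.
Proof. by rewrite /enorm; congr Num.sqrt; apply: eq_bigr => i _; rewrite mxE sqrrN. Qed.

Lemma norm_le_enorm (x : E) : `|x| <= enorm x.
Proof.
rewrite [leLHS]/Num.Def.normr /= mx_normrE; apply/bigmax_leP; split => [|[i j] _] /=.
  exact: enorm_ge0.
by rewrite (ord1 i) coord_le_enorm.
Qed.

Lemma cubeP (r : R) (x : E) : 0 <= r -> cube r x <-> `|x| <= r.
Proof.
move=> r0; split => [h|h i].
  rewrite [leLHS]/Num.Def.normr /= mx_normrE; apply/bigmax_leP; split => [//|[i j] _] /=.
  by have := h j; rewrite /= in_itv/= -ler_norml (ord1 i).
by rewrite /= in_itv/= -ler_norml; apply: le_trans h; exact: coord_le_norm.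
Qed.

(** On S, Phi is dominated by the sum of the a_k times the indicators of the
    cubes, whose integrals form a geometric series. In the applications S is
    cut into dyadic shells; replacing each shell by the full cube around it
    costs only a constant. *)
Lemma shell_integral (Phi : E -> \bar R) (S : set E) (r a : nat -> R) (c q : R) :
  measurable_fun setT Phi -> measurable S -> (forall x, (0 <= Phi x)%E) ->
  (forall k, 0 <= r k) -> (forall k, 0 <= a k) -> 0 <= q < 1 ->
  (forall k, a k * (r k *+ 2) ^+ d <= c * q ^+ k) ->
  (forall h, S h -> exists k, cube (r k) h /\ (Phi h <= (a k)%:E)%E) ->
  (\int[mu]_(h in S) Phi h <= (c / (1 - q))%:E)%E.
Proof.
move=> mPhi mS Phi0 r0 a0 q01 hc hS.
pose f k (h : E) : R := a k * \1_(cube (r k)) h.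
have mf k : measurable_fun setT (f k).
  by apply: measurable_funM => //; apply: measurable_indic; exact: measurable_cube.
have f0 k h : (0 <= (f k h)%:E)%E by rewrite lee_fin mulr_ge0.
have msum : measurable_fun setT (fun h => \sum_(k <oo) (f k h)%:E)%E.
  by apply: ge0_emeasurable_sum => // k _; exact/measurable_EFinP.
have sum0 h : (0 <= \sum_(k <oo) (f k h)%:E)%E by exact: nneseries_ge0.
apply: (@le_trans _ _ (\int[mu]_h \sum_(k <oo) (f k h)%:E)%E).
  apply: (@le_trans _ _ (\int[mu]_(h in S) \sum_(k <oo) (f k h)%:E)%E); last first.
    exact: ge0_subset_integral.
  apply: ge0_le_integral => //; [exact: measurable_funTS..|].
  move=> h /hS[k [hk Phik]]; apply: le_trans Phik _.
  apply: (@le_trans _ _ (\sum_(0 <= i < k.+1) (f i h)%:E)%E); last exact: nneseries_lim_ge.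
  rewrite big_nat_recr//= {2}/f indicE mem_set// mulr1 leeDr//.
  by apply: sume_ge0 => i _.
rewrite integral_nneseries//; last by move=> k; exact/measurable_EFinP.
rewrite -geometric_nneseries//; apply: lee_nneseries => [k _ _|k _].
  by apply: integral_ge0 => h _; exact: f0.
rewrite ge0_integralZl_fin//; last by apply: measurable_indic; exact: measurable_cube.
rewrite integral_indic//; last exact: measurable_cube.
by rewrite setIT [X in (_ * X)%E](lebesgue_cube d (r0 k)) -EFinM lee_fin.
Qed.

Lemma measurable_enorm_diff : measurable_fun setT (fun p : E * E => enorm (p.1 - p.2)).
Proof. exact: (measurable_diff_kernel enorm_measurable). Qed.

Lemma measurable_gagliardo_kernel (g : E -> R) (p : R) : measurable_fun setT g ->
  measurable_fun setT (fun z : E * E => (g z.1 - g z.2) ^+ 2 / enorm (z.1 - z.2) `^ p).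
Proof.
move=> mg; under eq_fun => z do rewrite -powRN.
apply: measurable_funM.
  by apply: measurable_funX; apply: measurable_funB; exact: (measurableT_comp mg).
exact: (measurableT_comp (@measurable_powR R (- p)) measurable_enorm_diff).
Qed.

Lemma measurable_gagliardo_inner (O : set E) (g : E -> R) (p : R) : measurable O ->
  measurable_fun setT g ->
  measurable_fun setT (fun x => \int[mu]_(y in O)
    ((g x - g y) ^+ 2 / enorm (x - y) `^ p)%:E)%E.
Proof.
move=> mO mg.
rewrite (_ : (fun _ => _) = (fun x => \int[mu]_y
    ((g x - g y) ^+ 2 / enorm (x - y) `^ p * \1_O y)%:E))%E; last first.
  apply/funext => x; rewrite integral_indic_fin; apply: eq_integral => y _.
  by rewrite mulrC.
pose F (z : E * E) : R := (g z.1 - g z.2) ^+ 2 / enorm (z.1 - z.2) `^ p * \1_O z.2.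
have mF : measurable_fun setT (EFin \o F).
  apply/measurable_EFinP; apply: measurable_funM; first exact: measurable_gagliardo_kernel.
  exact: (measurableT_comp (measurable_indic mO)).
apply: (@measurable_fun_fubini_tonelli_F _ _ _ _ _ mu (EFin \o F) mF).
by move=> z; rewrite lee_fin mulr_ge0// divr_ge0 ?sqr_ge0 ?powR_ge0.
Qed.

(** Substitute y = x + h and exchange the integrals, after enlarging the
    domain of integration to the whole space. *)
Lemma gagliardo_le_shift (O : set E) (t : R) (g : E -> R) : measurable O ->
  measurable_fun setT g ->
  (gagliardo O t g <= \int[mu]_h (((enorm h `^ (d%:R + 2 * t))^-1)%:E * shift_sq g h))%E.
Proof.
move=> mO mg; set p := d%:R + 2 * t.
pose F (z : E * E) : R := (g z.1 - g z.2) ^+ 2 / enorm (z.1 - z.2) `^ p.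
have mF : measurable_fun setT (EFin \o F).
  by apply/measurable_EFinP; exact: measurable_gagliardo_kernel.
have F0 z : (0 <= (EFin \o F) z)%E by rewrite lee_fin divr_ge0 ?sqr_ge0 ?powR_ge0.
have mFx := @measurable_fun_fubini_tonelli_F _ _ _ _ _ mu (EFin \o F) mF F0.
apply: (@le_trans _ _ (\int[mu]_x \int[mu]_y (F (x, y))%:E)%E).
  rewrite /gagliardo -/p.
  apply: (@le_trans _ _ (\int[mu]_(x in O) \int[mu]_y (F (x, y))%:E)%E); last first.
    by apply: ge0_subset_integral => // x _; apply: integral_ge0 => y _; exact: (F0 (x, y)).
  have mFO x : measurable_fun setT (fun y => (F (x, y))%:E).
    exact: (measurableT_comp mF (pair1_measurable x)).
  apply: ge0_le_integral => //.
  - by move=> x _; apply: integral_ge0 => y _; exact: (F0 (x, y)).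
  - by apply: measurable_funTS; exact: measurable_gagliardo_inner.
  - exact: measurable_funTS.
  - move=> x _; exact: (ge0_subset_integral mu mO measurableT (mFO x) (fun y _ => F0 (x, y))).
pose H (z : E * E) : R := enorm z.2 `^ (- p) * (g (z.1 + z.2) - g z.1) ^+ 2.
have mH : measurable_fun setT (EFin \o H).
  apply/measurable_EFinP; apply: measurable_funM.
    apply: (measurableT_comp (@measurable_powR R (- p))).
    exact: (measurableT_comp enorm_measurable).
  apply: measurable_funX; apply: measurable_funB; first exact: measurable_add_pair.
  exact: (measurableT_comp mg).
have H0 z : (0 <= (EFin \o H) z)%E by rewrite lee_fin mulr_ge0 ?sqr_ge0 ?powR_ge0.
have -> : (\int[mu]_x \int[mu]_y (F (x, y))%:E = \int[mu]_x \int[mu]_h (H (x, h))%:E)%E.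
  apply: eq_integral => x _.
  rewrite -(@ge0_integral_shift R d x (fun y => (F (x, y))%:E)).
  - apply: eq_integral => h _; congr EFin; rewrite /F/H/= opprD addrCA subrr addr0.
    by rewrite enormN powRN mulrC (addrC h) -[in RHS]sqrrN opprB.
  - exact: (measurableT_comp mF (pair1_measurable x)).
  - by move=> y; exact: (F0 (x, y)).
have -> : (\int[mu]_x \int[mu]_h (H (x, h))%:E = \int[mu]_h \int[mu]_x (H (x, h))%:E)%E.
  exact: (@fubini_tonelli _ _ _ _ R mu mu (EFin \o H) mH H0).
rewrite le_eqVlt; apply/orP; left; apply/eqP; apply: eq_integral => h _.
rewrite /H/= ge0_integralZl_fin ?powR_ge0//; first by rewrite powRN.
  by apply: measurable_funX; apply: measurable_funB => //; exact: measurable_shift.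
by move=> x _; rewrite sqr_ge0.
Qed.

(** The modulus is at most B min(|h|^2, eps^2), and B is the same for every
    eps: near 0 the first bound makes |h|^(2-d-2t) integrable because t < 1,
    and far away the second one makes eps^2 |h|^(-d-2t) integrable because t >
    0. Both integrals scale as eps^(2(1-t)). They are estimated over dyadic
    shells around the cube of radius eps. *)
Lemma gagliardo_bound (t : R) : (2 <= d)%N -> 0 < t -> t < 1 ->
  exists2 C : R, 0 <= C & forall (O : set E) (g : E -> R) (B eps : R),
    measurable O -> measurable_fun setT g -> 0 <= B -> 0 < eps ->
    (forall h, shift_sq g h <= (B * enorm h ^+ 2)%:E)%E ->
    (forall h, shift_sq g h <= (B * eps ^+ 2)%:E)%E ->
    (gagliardo O t g <= (C * B * eps `^ (2 * (1 - t)))%:E)%E.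
Proof.
move=> d2 t0 t1; set sg := 2 * (1 - t); have sg0 : 0 < sg by rewrite mulr_gt0// subr_gt0.
(* The kernel |h|^(2-p) is then decreasing, hence bounded on each shell by its
   value at the inner radius. *)
set p := d%:R + 2 * t; have p2 : 2 < p.
  have : 2%:R <= d%:R :> R by rewrite ler_nat.
  by rewrite /p; move: (d%:R : R) => D; lra.
have p0 : 0 < p by apply: lt_trans p2.
pose q1 : R := 2^-1 `^ sg; pose q2 : R := 2^-1 `^ (2 * t).
have half0 : 0 <= 2^-1 :> R by rewrite invr_ge0.
have half1 : 2^-1 < 1 :> R by rewrite invf_lt1// ltr1n.
have q01 x : 0 < x -> 0 <= (2^-1 : R) `^ x < 1.
  move=> x0; rewrite powR_ge0/= -[ltRHS](congr1 (@^~ x) (@powR1 R)).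
  by apply: gt0_ltr_powR; rewrite ?nnegrE.
have q1b : 0 <= q1 < 1 by exact: q01.
have q2b : 0 <= q2 < 1 by apply: q01; rewrite mulr_gt0.
exists (4 ^+ d / (1 - q1) + 4 ^+ d / (1 - q2)).
  by rewrite addr_ge0// divr_ge0 ?exprn_ge0// subr_ge0 ltW//; [case/andP: q1b|case/andP: q2b].
move=> O g B eps mO mg B0 e0 hB1 hB2.
apply: le_trans (gagliardo_le_shift t mO mg) _; rewrite -/p.
pose Phi (h : E) : \bar R := (((enorm h `^ p)^-1)%:E * shift_sq g h)%E.
have sq0 h : (0 <= shift_sq g h)%E by apply: integral_ge0 => x _; rewrite lee_fin sqr_ge0.
have Phi0 h : (0 <= Phi h)%E by rewrite mule_ge0// lee_fin invr_ge0 powR_ge0.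
have mPhi : measurable_fun setT Phi.
  apply: emeasurable_funM.
    apply/measurable_EFinP; under eq_fun => h do rewrite -powRN.
    exact: (measurableT_comp (@measurable_powR R (- p)) enorm_measurable).
  pose H (z : E * E) : R := (g (z.1 + z.2) - g z.1) ^+ 2.
  have mH : measurable_fun setT (EFin \o H).
    apply/measurable_EFinP; apply: measurable_funX; apply: measurable_funB; first exact: measurable_add_pair.
    exact: (measurableT_comp mg).
  apply: (@measurable_fun_fubini_tonelli_G _ _ _ _ _ mu (EFin \o H) mH).
  by move=> z; rewrite lee_fin sqr_ge0.
have eps2t : eps ^+ 2 * eps `^ (- (2 * t)) = eps `^ sg.
  rewrite powRN powR_shell//; congr powR; rewrite /sg; ring.
have mC : measurable (cube eps : set E) by exact: measurable_cube.
(* Radii eps/2^k, ratio 2^(-2(1-t)) of the geometric series. *)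
have inner : (\int[mu]_(h in cube eps) Phi h <= (4 ^+ d * B * eps `^ sg / (1 - q1))%:E)%E.
  pose r k := eps * 2^-1 ^+ k.
  have r0 k : 0 < r k by rewrite mulr_gt0// exprn_gt0// invr_gt0.
  pose a k := B * (r k.+1 ^+ 2 / r k.+1 `^ p).
  have a0 k : 0 <= a k by rewrite mulr_ge0// divr_ge0 ?sqr_ge0 ?powR_ge0.
  apply: (@shell_integral Phi _ r a) => //.
  - by move=> k; exact: ltW.
  - move=> k; have -> : r k *+ 2 = 4 * r k.+1.
      by rewrite /r exprS -mulr_natl; field.
    have rE : r k.+1 ^+ 2 / r k.+1 `^ p * r k.+1 ^+ d = eps `^ sg * q1 ^+ k.+1.
      rewrite powR_shell// -[X in _ * X]powR_mulrn ?(ltW (r0 _))// -powRD; last first.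
        by apply/implyP => _; rewrite gt_eqF.
      rewrite (_ : _ + _ = sg); last by rewrite /p /sg; ring.
      by rewrite /r powRM ?exprn_ge0 ?(ltW e0)// exprn_powR.
    rewrite exprMn (_ : a k * _ = 4 ^+ d * B * (r k.+1 ^+ 2 / r k.+1 `^ p * r k.+1 ^+ d)); last first.
      by rewrite /a; ring.
    rewrite rE -!mulrA; apply: ler_wpM2l; first by rewrite exprn_ge0.
    rewrite ler_wpM2l// ler_wpM2l ?powR_ge0// exprS ler_piMl//.
      by rewrite exprn_ge0//; case/andP: q1b.
    by case/andP: q1b => _ /ltW.
  (* The origin lies in no shell, but the modulus vanishes there. *)
  - move=> h hc; have [h0|h0] := eqVneq h 0.
      exists 0%N; split; first by rewrite /r expr0 mulr1.
      by rewrite /Phi h0 shift_sq0 mule0 lee_fin.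
    have nh0 : 0 < `|h| by rewrite normr_gt0.
    have nhe : `|h| <= eps by apply/(cubeP _ (ltW e0)).
    have [k /andP[k1 k2]] := inner_shell nh0 nhe.
    exists k; split; first by apply/cubeP => //; exact: ltW.
    have eh : r k.+1 < enorm h by exact: lt_le_trans k1 (norm_le_enorm h).
    have eh0 : 0 < enorm h by exact: lt_trans eh.
    apply: (@le_trans _ _ ((enorm h `^ p)^-1%:E * (B * enorm h ^+ 2)%:E)%E).
      by rewrite lee_wpmul2l// lee_fin invr_ge0 powR_ge0.
    rewrite -EFinM lee_fin mulrC -mulrA ler_wpM2l// !powR_shell//.
    rewrite -(opprB p) !powRN lef_pV2 ?posrE ?powR_gt0//.
    apply: ge0_ler_powR; rewrite ?nnegrE ?subr_ge0 ?(ltW p2) ?(ltW (r0 _)) ?(ltW eh0)//.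
    exact: ltW.
(* Radii eps 2^k, ratio 2^(-2t) of the geometric series. *)
have outer : (\int[mu]_(h in ~` cube eps) Phi h <= (4 ^+ d * B * eps `^ sg / (1 - q2))%:E)%E.
  pose r k := eps * 2 ^+ k.
  have r0 k : 0 < r k by rewrite mulr_gt0// exprn_gt0.
  pose a k := B * eps ^+ 2 / r k `^ p.
  have Be0 : 0 <= B * eps ^+ 2 by rewrite mulr_ge0 ?sqr_ge0.
  have a0 k : 0 <= a k by rewrite divr_ge0 ?powR_ge0.
  apply: (@shell_integral Phi _ (fun k => r k.+1) a) => //.
  - exact: measurableC.
  - by move=> k; exact: ltW.
  - move=> k; have -> : r k.+1 *+ 2 = 4 * r k.
      by rewrite /r exprS -mulr_natl; ring.
    have rE : r k ^+ d / r k `^ p = eps `^ (- (2 * t)) * q2 ^+ k.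
      rewrite powR_shell// (_ : _ - p = - (2 * t)); last by rewrite /p; ring.
      rewrite /r powRM ?exprn_ge0 ?(ltW e0)// exprn_powR//; congr (_ * _ ^+ _).
      by rewrite /q2 -[in RHS]powR_inv1// -powRrM mulN1r.
    rewrite exprMn (_ : a k * _ = 4 ^+ d * B * (eps ^+ 2 * (r k ^+ d / r k `^ p))); last first.
      by rewrite /a; ring.
    by rewrite rE [eps ^+ 2 * _]mulrA eps2t -!mulrA.
  - move=> h hc; have nhe : eps < `|h|.
      by rewrite ltNge; apply/negP => hn; apply: hc; apply/cubeP => //; exact: ltW.
    have [k /andP[k1 k2]] := outer_shell e0 nhe.
    exists k; split; first by apply/cubeP => //; exact: ltW.
    have eh : r k < enorm h by exact: lt_le_trans k1 (norm_le_enorm h).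
    have eh0 : 0 < enorm h by exact: lt_trans eh.
    apply: (@le_trans _ _ ((enorm h `^ p)^-1%:E * (B * eps ^+ 2)%:E)%E).
      by rewrite lee_wpmul2l// lee_fin invr_ge0 powR_ge0.
    rewrite -EFinM lee_fin mulrC ler_wpM2l//.
    rewrite lef_pV2 ?posrE ?powR_gt0//.
    apply: ge0_ler_powR; rewrite ?nnegrE ?(ltW p0) ?(ltW (r0 _)) ?(ltW eh0)//.
    exact: ltW.
have dC : [disjoint (cube eps : set E) & ~` cube eps] by apply/disj_setPS; rewrite setICr.
have mU : measurable_fun (cube eps `|` ~` cube eps) Phi by rewrite setUv.
rewrite -/(integral _ _ Phi) -[X in integral _ X](setUv (cube eps)).
rewrite (ge0_integral_setU mu mC (measurableC mC) mU (fun x _ => Phi0 x) dC).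
rewrite (_ : _ * B * _ = 4 ^+ d * B * eps `^ sg / (1 - q1) + 4 ^+ d * B * eps `^ sg / (1 - q2)); last by ring.
by rewrite EFinD leeD.
Qed.

End gagliardo_bound.

(** * The rescaled mollifier *)

Section mollifier.
Context {R : realType} {d : nat}.
Local Notation E := 'rV[R]_d.
Local Notation mu := (lebesgue_rV R d).
Implicit Type psi : E -> R.

Lemma enorm_continuous : continuous (@enorm R d).
Proof.
move=> x; apply: (@continuous_comp _ _ _ (fun x : E => \sum_(i < d) x ord0 i ^+ 2) (@Num.sqrt R));
  last exact: sqrt_continuous.
have FF : Filter (nbhs x) := nbhs_filter x.
apply: cvg_big => [|i _].
  exact: add_continuous.
apply: (@continuous_comp _ _ _ (fun x : E => x ord0 i) (fun y : R => y ^+ 2)).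
  exact: coord_continuous.
exact: exprn_continuous.
Qed.

Lemma enormZ (a : R) (x : E) : enorm (a *: x) = `|a| * enorm x.
Proof.
apply/eqP; rewrite -(@eqrXn2 _ 2) ?mulr_ge0 ?enorm_ge0//.
rewrite exprMn real_normK ?num_real// !enorm_sqr mulr_sumr; apply/eqP.
by apply: eq_bigr => i _; rewrite mxE exprMn.
Qed.

Lemma lebesgue_rV_gt0 : (0 < mu setT)%E.
Proof.
apply: (@lt_le_trans _ _ (mu (cube 1 : set E))).
  by rewrite [X in (_ < X)%E](lebesgue_cube d ler01) lte_fin exprn_gt0// pmulrn_lgt0.
by apply: le_measure => //; rewrite inE; [exact: measurable_cube|exact: measurableT].
Qed.

Lemma Linfty_bound psi : Linfty psi ->
  exists2 M : R, 0 < M & {ae mu, forall x, `|psi x| <= M}.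
Proof.
move=> [_]; rewrite unlock lebesgue_rV_gt0.
set S := ess_sup _ _ => S1; exists (`|fine S| + 1); first by rewrite ltr_wpDl.
have /ess_supP : (S <= (`|fine S| + 1)%:E)%E.
  case: S S1 => //= [r _|_]; last exact: leNye.
  by rewrite lee_fin (le_trans (ler_norm r))// lerDl.
by apply: filterS => x; rewrite /= lee_fin.
Qed.

(** Off the ball psi vanishes almost everywhere near each point, hence almost
    everywhere. *)
Lemma ess_supp_ball psi r : supp_in_ball psi r ->
  {ae mu, forall x, psi x != 0 -> enorm x <= r}.
Proof.
move=> h; have oU : open [set x : E | r < enorm x].
  rewrite openE => x /= rx.
  have : nbhs (enorm x) [set y : R | r < y].
    by apply: open_nbhs_nbhs; split; [exact: open_gt|exact: rx].
  exact: enorm_continuous.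
have H : {ae mu, forall x, [set x : E | r < enorm x] x -> psi x = 0}.
  apply: (negligible_open_locally oU) => x /= rx.
  have : ~ ess_supp psi x by move=> /h /=; rewrite leNgt rx.
  by move=> /contrapT.
by apply: filterS H => x /= hx px; rewrite leNgt; apply/negP => /hx/eqP; rewrite (negbTE px).
Qed.

Lemma Linfty_integral psi M r : 0 <= r -> measurable_fun setT psi ->
  {ae mu, forall x, `|psi x| <= M} -> {ae mu, forall x, psi x != 0 -> enorm x <= r} ->
  (\int[mu]_x `|psi x|%:E <= (`|M| * (r *+ 2) ^+ d)%:E)%E.
Proof.
move=> r0 mpsi hM hr; have mc : measurable (cube r : set E) by exact: measurable_cube.
have mi : measurable_fun setT (\1_(cube r) : E -> R) by exact: measurable_indic.
apply: (@le_trans _ _ (\int[mu]_x (`|M| * \1_(cube r) x)%:E)%E).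
  apply: ae_ge0_le_integral.
  - exact: measurableT.
  - by move=> x _; rewrite lee_fin.
  - by apply/measurable_EFinP; exact: measurableT_comp.
  - by move=> x _; rewrite lee_fin mulr_ge0.
  - by apply/measurable_EFinP; apply: measurable_funM.
  apply: filterS2 hM hr => x xM xr _; rewrite lee_fin.
  have [->|p0] := eqVneq (psi x) 0; first by rewrite normr0 mulr_ge0.
  rewrite indicE mem_set ?mulr1; first exact: le_trans xM (ler_norm M).
  by apply/cubeP => //; apply: le_trans (norm_le_enorm x) (xr p0).
rewrite ge0_integralZl_fin// integral_indic// setIT [X in (_ * X)%E](lebesgue_cube d r0).
by rewrite -EFinM.
Qed.

Variables (psi : E -> R) (eps : R).
Hypotheses (mpsi : measurable_fun setT psi) (eps0 : 0 < eps).
Let epsV : eps^-1 != 0.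
Proof. by rewrite invr_eq0 gt_eqF. Qed.
Let epsd : 0 < eps ^- d.
Proof. by rewrite invr_gt0 exprn_gt0. Qed.

Lemma ae_scale (P : E -> Prop) : {ae mu, forall x, P x} ->
  {ae mu, forall x, P (eps^-1 *: x)}.
Proof.
move=> /(negligible_affine epsV 0); apply: negligibleS => x /= h h'; apply: h.
by rewrite -[_ *: _]addr0.
Qed.

Lemma delta_bound M : {ae mu, forall x, `|psi x| <= M} ->
  {ae mu, forall x, `|delta_eps psi eps x| <= eps ^- d * M}.
Proof.
move=> /ae_scale; apply: filterS => x h.
by rewrite normrM gtr0_norm// ler_pM2l.
Qed.

Lemma delta_supp r : {ae mu, forall x, psi x != 0 -> enorm x <= r} ->
  {ae mu, forall x, delta_eps psi eps x != 0 -> enorm x <= r * eps}.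
Proof.
move=> /ae_scale; apply: filterS => x h.
rewrite mulf_eq0 negb_or => /andP[_ /h].
by rewrite enormZ gtr0_norm ?invr_gt0// mulrC ler_pdivrMr.
Qed.

Lemma ge0_integral_dilation (f : E -> \bar R) : measurable_fun setT f ->
  (forall x, (0 <= f x)%E) ->
  (\int[mu]_y f (eps^-1 *: y)%R = (eps ^+ d)%:E * \int[mu]_y f y)%E.
Proof.
move=> mf f0; have := ge0_integral_affine epsV 0 mf f0.
rewrite gtr0_norm ?invr_gt0// exprVn invrK => <-.
by apply: eq_integral => y _; rewrite addr0.
Qed.

Lemma measurable_dilation (f : E -> R) : measurable_fun setT f ->
  measurable_fun setT (fun x : E => f (eps^-1 *: x)).
Proof.
move=> mf; apply: (measurableT_comp mf).
have := measurable_affine (eps^-1) (0 : E); congr (measurable_fun _ _).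
by apply/funext => x; rewrite addr0.
Qed.

Lemma delta_measurable : measurable_fun setT (delta_eps psi eps).
Proof. by apply: measurable_funM => //; exact: measurable_dilation. Qed.

Lemma delta_integral :
  (\int[mu]_x `|delta_eps psi eps x|%:E = \int[mu]_x `|psi x|%:E)%E.
Proof.
have mp : measurable_fun setT (fun x => `|psi x|) by exact: measurableT_comp.
have mp' : measurable_fun setT (fun x => `|psi x|%:E) by exact/measurable_EFinP.
transitivity (\int[mu]_x (eps ^- d * `|psi (eps^-1 *: x)|)%:E)%E.
  by apply: eq_integral => x _; rewrite normrM (gtr0_norm epsd).
rewrite ge0_integralZl_fin ?(ltW epsd)//; last exact: (measurable_dilation mp).
rewrite (@ge0_integral_dilation (fun x => `|psi x|%:E))//.
by rewrite muleA -EFinM mulVf ?mul1e// gt_eqF// exprn_gt0.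
Qed.

(** The moment condition of order 0 says that psi has integral 1; rescaling
    preserves it. *)
Lemma delta_unit (i : 'I_d) (k : nat) x : (\int[mu]_x `|psi x|%:E < +oo)%E ->
  moments psi k -> \int[mu]_y delta_eps psi eps (x - y) = 1.
Proof.
move=> ipsi /(_ i 0%N (eps^-1 *: x) (leq0n k)); rewrite expr0 => h1.
have N1 : (-1 : R) != 0 by rewrite oppr_eq0 oner_eq0.
pose h (y : E) := psi (eps^-1 *: x - y).
have mh : measurable_fun setT h.
  apply: (measurableT_comp mpsi).
  have := measurable_affine (-1 : R) (eps^-1 *: x); congr (measurable_fun _ _).
  by apply/funext => y; rewrite scaleN1r addrC.
have ih : mu.-integrable setT (EFin \o h).
  apply/integrableP; split; first exact/measurable_EFinP.
  have mp : measurable_fun setT (fun x => `|psi x|%:E).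
    by apply/measurable_EFinP; exact: measurableT_comp.
  have := ge0_integral_affine N1 (eps^-1 *: x) mp (fun x => _).
  rewrite normrN1 expr1n invr1 mul1e => H; apply: le_lt_trans ipsi; rewrite -H//.
  by rewrite le_eqVlt; apply/orP; left; apply/eqP; apply: eq_integral => y _; rewrite scaleN1r addrC.
have e1 : \int[mu]_y h y = 1.
  by rewrite -h1; apply: eq_Rintegral => y _; rewrite expr0 mul1r.
rewrite /Rintegral.
have -> : (\int[mu]_y (delta_eps psi eps (x - y))%:E =
   \int[mu]_y ((eps ^- d)%:E * (EFin \o h) (eps^-1 *: y)%R))%E.
  by apply: eq_integral => y _; rewrite /delta_eps EFinM scalerBr.
have ihs : mu.-integrable setT (fun y => (EFin \o h) (eps^-1 *: y)).
  apply/integrableP; split.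
    by apply/measurable_EFinP; exact: measurable_dilation.
  have mah : measurable_fun setT (fun x => `|h x|%:E).
    by apply/measurable_EFinP; exact: measurableT_comp.
  rewrite (@ge0_integral_dilation (fun x => `|h x|%:E))//.
  rewrite lte_mul_pinfty ?lee_fin ?exprn_ge0 ?(ltW eps0)//.
  by have /integrableP[] := ih.
rewrite integralZl// (integral_scale epsV ih).
rewrite gtr0_norm ?invr_gt0// exprVn invrK muleA -EFinM.
by rewrite mulVf ?mul1e// gt_eqF// exprn_gt0.
Qed.

End mollifier.

(** * Coercivity of the energy form *)

Section energy.
Context {R : realType} {d : nat}.
Local Notation E := 'rV[R]_d.
Local Notation mu := (lebesgue_rV R d).
Variables (O : set E) (oO : open O) (bO : bounded_set O).
Let mO : measurable O := open_measurable_rV oO.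

Lemma L2_bounded_mul (a f : E -> R) (M : R) : measurable_fun O a ->
  (forall x, O x -> `|a x| <= M) -> L2 O f -> L2 O (fun x => a x * f x).
Proof.
move=> ma aM Lf; apply: integrable_sqr_L2 => //.
  by apply: measurable_funM => //; exact: Lf.1.
apply: (le_integrable mO _ _ (integrableZl mO (M ^+ 2) (L2_sqr_integrable mO Lf))).
  by apply/measurable_EFinP; apply: measurable_funX; apply: measurable_funM => //; exact: Lf.1.
move=> x Ox; rewrite /= lee_fin [leLHS]normrX normrM exprMn [leRHS]normrM !normrX.
rewrite ler_wpM2r ?exprn_ge0// lerXn2r ?nnegrE//.
exact: le_trans (aM _ Ox) (ler_norm M).
Qed.

Lemma quad_formE (xi eta : E) (B : 'M[R]_d) :
  (xi *m B *m eta^T) ord0 ord0 = \sum_i \sum_j (B i j * xi ord0 i) * eta ord0 j.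
Proof.
rewrite mxE exchange_big/=; apply: eq_bigr => j _; rewrite !mxE mulr_suml.
by apply: eq_bigr => i _; rewrite (mulrC (xi _ _)).
Qed.

Lemma within_closure_continuous (f : E -> R) :
  {within closure O, continuous f} -> {in O, continuous f}.
Proof.
move=> cf; rewrite -continuous_open_subspace//.
by apply: continuous_subspaceW cf; exact: subset_closure.
Qed.

(** Boundedness of O enters here: a Lipschitz function grows at most linearly. *)
Lemma lipschitz_bounded_measurable (c : E -> R) : [lipschitz c x | x in closure O] ->
  measurable_fun O c /\ exists M : R, forall x, O x -> `|c x| <= M.
Proof.
move=> [L [_ hL]].
have L1 : L < `|L| + 1 by rewrite (le_lt_trans (ler_norm L))// ltrDl.
set K := `|L| + 1; have K0 : 0 < K by rewrite ltr_wpDl.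
have hK x y : O x -> O y -> `|c x - c y| <= K * `|x - y|.
  move=> Ox Oy; apply: (hL K L1 (x, y)); split; exact: subset_closure.
split.
  apply: continuous_measurable_rV => // x /set_mem Ox.
  have FF : Filter (nbhs x) := nbhs_filter x.
  apply/cvgrPdist_lt => e e0.
  apply: filterS2 (open_nbhs_nbhs (conj oO Ox)) (nbhsx_ballx x _ (divr_gt0 e0 K0)) => y Oy.
  rewrite -ball_normE /= => xy; apply: le_lt_trans (hK _ _ Ox Oy) _.
  by rewrite mulrC -ltr_pdivlMr.
have [[x0 Ox0]|O0] := pselect (exists x, O x); last first.
  by exists 0 => x Ox; case: O0; exists x.
have [r0 [_ hr]] := bO; have r1 : r0 < `|r0| + 1 by rewrite (le_lt_trans (ler_norm r0))// ltrDl.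
exists (K * (`|r0| + 1 + `|x0|) + `|c x0|) => x Ox.
rewrite -[c x](subrK (c x0)); apply: le_trans (ler_normD _ _) _; rewrite lerD2r.
apply: le_trans (hK _ _ Ox Ox0) _; rewrite ler_pM2l//.
by apply: le_trans (ler_normB _ _) _; rewrite lerD2r; exact: (hr _ r1).
Qed.

Variables (A : E -> 'M[R]_d) (c : E -> R).
Hypothesis hAc : admissible_coefficients O A c.

Definition energy_density (u w : E -> R) (x : E) : R :=
  (grad O u x *m A x *m (grad O w x)^T) ord0 ord0 + c x * u x * w x.

Lemma energy_integrable u w : H1 O u -> H1 O w ->
  mu.-integrable O (EFin \o energy_density u w).
Proof.
move=> Hu Hw; have [CA [MA hMA] _ _ [lc _]] := hAc.
have [mc [Mc hMc]] := lipschitz_bounded_measurable lc.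
have [Lgu _] := grad_weak Hu; have [Lgw _] := grad_weak Hw.
have mA i j : measurable_fun O (fun x => A x i j).
  apply: continuous_measurable_rV => //; apply: within_closure_continuous.
  by have [] := CA i j.
have LA i j : L2 O (fun x => A x i j * grad O u x ord0 i).
  apply: (@L2_bounded_mul _ _ MA) => // x Ox; apply: hMA; exact: subset_closure.
rewrite (_ : _ \o _ = (fun x => \sum_(i <- index_enum 'I_d) \sum_(j <- index_enum 'I_d)
    (A x i j * grad O u x ord0 i * grad O w x ord0 j)%:E) \+
  (fun x => (c x * u x * w x)%:E))%E; last first.
  apply/funext => x /=; rewrite /energy_density quad_formE EFinD; congr (_ + _)%E.
  by rewrite -sumEFin; apply: eq_bigr => i _; rewrite -sumEFin.
apply: integrableD => //.
  apply: integrable_sum => // i _; apply: integrable_sum => // j _.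
  exact: (L2M_integrable mO (LA i j) (Lgw j)).
exact: (L2M_integrable mO (L2_bounded_mul mc hMc Hu.1) Hw.1).
Qed.

(** Ellipticity bounds the gradient part from below and c >= 0 makes the
    zeroth order part nonnegative. The difference of the two energies is the
    energy of u - w because the gradient is linear almost everywhere. *)
Lemma energy_coercive : exists2 a0 : R, 0 < a0 & forall u w, H1 O u -> H1 O w ->
  a0 * gradsq O (u - w) <=
  energy_form O A c u (u - w) - energy_form O A c w (u - w).
Proof.
have [_ _ _ [a0 [a1 [a0_gt0 _ hA]]] [_ c0]] := hAc.
exists a0 => // u w Hu Hw; have He := H1B oO Hu Hw; set e := u - w.
have iu := energy_integrable Hu He; have iw := energy_integrable Hw He.
have ie := energy_integrable He He; have [Lge _] := grad_weak He.
have -> : energy_form O A c u e - energy_form O A c w e =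
    \int[mu]_(x in O) energy_density e e x.
  rewrite (_ : energy_form O A c u e = \int[mu]_(x in O) energy_density u e x)//.
  rewrite (_ : energy_form O A c w e = \int[mu]_(x in O) energy_density w e x)//.
  rewrite -(RintegralB mO iu iw).
  apply: ae_eq_Rintegral => //.
  - by apply: measurable_funB; apply/measurable_EFinP; [exact: measurable_int iu|exact: measurable_int iw].
  - by apply/measurable_EFinP; exact: measurable_int ie.
  apply: filterS (gradB oO Hu Hw) => x hx Ox.
  rewrite /energy_density hx// !mulmxBl !mxE /e !fctE; ring.
have -> : a0 * gradsq O e = \int[mu]_(x in O) (a0 * enorm (grad O e x) ^+ 2).
  by rewrite (RintegralZl _ mO (L2v_integrable oO Lge)).
apply: le_Rintegral => //; first exact: (integrableZl mO a0 (L2v_integrable oO Lge)).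
move=> x Ox; have cx := subset_closure Ox.
have /andP[h _] := hA x (grad O e x) cx.
rewrite /energy_density -[leLHS]addr0 lerD// -mulrA mulr_ge0 ?c0//.
by rewrite -expr2 sqr_ge0.
Qed.

End energy.

(** * Dual norms *)

Section dual.
Context {R : realType} {d : nat}.
Local Notation E := 'rV[R]_d.
Variables (X : set (E -> R)) (N : (E -> R) -> R) (F : (E -> R) -> R).
Hypotheses (hF : in_dual X N F) (X0 : X 0).
Hypothesis XZ : forall (a : R) u, 0 < a -> X u -> X (a *: u) /\ N (a *: u) = a * N u.
Hypothesis N0 : forall u, 0 <= N u.

Let F0 : F 0 = 0.
Proof.
have := hF.1 1 0 0 X0 X0; rewrite scaler0 addr0 mul1r => /eqP.
by rewrite -subr_eq subrr => /eqP.
Qed.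

Let S := [set r | exists u, [/\ X u, N u <= 1 & r = `|F u|]].

Let S_sup : has_sup S.
Proof.
split.
  have [M hM] := hF.2.
  have N00 : N 0 = 0.
    have [_] := @XZ 2 0 (ltr0n _ 2) X0; rewrite scaler0; lra.
  by exists `|F 0|, 0; split => //; rewrite N00.
have [M hM] := hF.2; exists `|M| => _ [u [Xu Nu ->]].
apply: le_trans (hM _ Xu) _; apply: le_trans (ler_norm _) _.
by rewrite normrM (ger0_norm (N0 u)) ler_piMr.
Qed.

Lemma dual_norm_ge0 : 0 <= dual_norm X N F.
Proof.
have [[x Sx] _] := S_sup.
apply: le_trans (sup_upper_bound S_sup Sx).
by case: Sx => u [_ _ ->].
Qed.

(** Homogeneity reduces to N u = 1; when N u = 0 the continuity of F forces F
    u = 0. *)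
Lemma dual_norm_le u : X u -> `|F u| <= dual_norm X N F * N u.
Proof.
move=> Xu; have [M hM] := hF.2.
have [Nu|] := leP (N u) 0.
  have {}Nu : N u = 0 by apply/eqP; rewrite eq_le Nu N0.
  by apply: le_trans (hM _ Xu) _; rewrite Nu !mulr0.
move=> Nu; have Nu1 : 0 < (N u)^-1 by rewrite invr_gt0.
have [Xa Na] := XZ Nu1 Xu.
have Fa : F ((N u)^-1 *: u) = (N u)^-1 * F u.
  by have := hF.1 (N u)^-1 u 0 Xu X0; rewrite addr0 F0 addr0.
have SF : S `|F ((N u)^-1 *: u)|.
  by exists ((N u)^-1 *: u); split => //; rewrite Na mulVf// gt_eqF.
have := sup_upper_bound S_sup SF.
by rewrite Fa normrM gtr0_norm// mulrC ler_pdivrMr.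
Qed.

Lemma dual_sub u v : X u -> X v -> F (u - v) = F u - F v.
Proof.
move=> Xu Xv; have := hF.1 (-1) v u Xv Xu.
by rewrite scaleN1r mulN1r [X in F X]addrC [RHS]addrC.
Qed.

End dual.

(** * Fractional Sobolev spaces *)

Section fractional.
Context {R : realType} {d : nat}.
Local Notation E := 'rV[R]_d.
Local Notation mu := (lebesgue_rV R d).
Implicit Types (O : set E) (u v : E -> R).

Lemma gagliardo_eq O t u v : (forall x, O x -> u x = v x) ->
  gagliardo O t u = gagliardo O t v.
Proof.
move=> uv; apply: eq_integral => x /set_mem Ox; apply: eq_integral => y /set_mem Oy.
by rewrite !uv.
Qed.

Lemma L2_eq O u v : measurable O -> (forall x, O x -> u x = v x) -> L2 O v -> L2 O u.
Proof.
move=> mO uv [mv v2]; split.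
  apply: (eq_measurable_fun v) => // x /set_mem Ox; exact/esym/uv.
by rewrite (eq_integral (fun x => (v x ^+ 2)%:E))// => x /set_mem Ox; rewrite uv.
Qed.

Lemma Hfrac_eq O t u v : measurable O -> (forall x, O x -> u x = v x) ->
  Hfrac O t v -> Hfrac O t u.
Proof.
by move=> mO uv [Lv gv]; split; [exact: L2_eq uv Lv|rewrite (gagliardo_eq _ uv)].
Qed.

Lemma gagliardo_ge0 O t u : (0 <= gagliardo O t u)%E.
Proof.
apply: integral_ge0 => x _; apply: integral_ge0 => y _.
by rewrite lee_fin divr_ge0 ?sqr_ge0 ?powR_ge0.
Qed.

Lemma gagliardoZ O t (a : R) u : measurable O -> measurable_fun O u ->
  gagliardo O t (a *: u) = ((a ^+ 2)%:E * gagliardo O t u)%E.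
Proof.
move=> mO mu'.
have uE x : O x -> u x = (u \_ O) x by move=> Ox; rewrite patchE mem_set.
have mu1 : measurable_fun setT (u \_ O) by apply/(measurable_restrictT _ mO).
rewrite (gagliardo_eq t uE) (@gagliardo_eq _ _ (a *: u) (a *: (u \_ O : E -> R))); last first.
  by move=> x Ox; rewrite !fctE uE.
set w : E -> R := u \_ O.
have inner_meas := measurable_gagliardo_inner (d%:R + 2 * t) mO mu1.
have k0 x y : 0 <= (w x - w y) ^+ 2 / enorm (x - y) `^ (d%:R + 2 * t).
  by rewrite divr_ge0 ?sqr_ge0 ?powR_ge0.
rewrite /gagliardo -ge0_integralZl//; last 3 first.
- exact: measurable_funTS.
- by move=> x _; apply: integral_ge0 => y _; rewrite lee_fin.
- by rewrite lee_fin sqr_ge0.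
apply: eq_integral => x _; rewrite -ge0_integralZl_fin ?sqr_ge0//.
  apply: eq_integral => y _; congr EFin; rewrite !fctE /GRing.scale/= -mulrBr exprMn.
  by rewrite mulrA.
apply: measurable_funTS.
exact: (measurableT_comp (measurable_gagliardo_kernel (d%:R + 2 * t) mu1) (pair1_measurable x)).
Qed.

Lemma L2_0 O : L2 O 0.
Proof.
split; first exact: measurable_cst.
by rewrite integral0_eq// => x _; rewrite expr0n.
Qed.

Lemma Hfrac0 O t : Hfrac O t 0.
Proof.
split; first exact: L2_0.
rewrite /gagliardo integral0_eq// => x _; rewrite integral0_eq// => y _.
by rewrite subrr expr0n mul0r.
Qed.

Lemma HfracZ O t (a : R) u : measurable O -> 0 < a -> Hfrac O t u ->
  Hfrac O t (a *: u) /\ Hfracnorm O t (a *: u) = a * Hfracnorm O t u.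
Proof.
move=> mO a0 [Lu gu]; have gZ := gagliardoZ t a mO Lu.1.
have i2 := L2_sqr_integrable mO Lu.
have sqE x : (a *: u) x ^+ 2 = a ^+ 2 * u x ^+ 2 by rewrite fctE exprMn.
have LZ : L2 O (a *: u).
  apply: integrable_sqr_L2 => //; first exact: (measurable_funM (measurable_cst a) Lu.1).
  under eq_fun => x do rewrite sqE EFinM.
  exact: integrableZl.
have a2 : 0 <= a ^+ 2 by rewrite sqr_ge0.
split.
  by split => //; rewrite gZ lte_mul_pinfty// ?lee_fin.
have fg : gagliardo O t u \is a fin_num by rewrite ge0_fin_numE ?gagliardo_ge0.
rewrite /Hfracnorm gZ fineM//.
have -> : \int[mu]_(x in O) ((a *: u) x ^+ 2) = a ^+ 2 * \int[mu]_(x in O) (u x ^+ 2).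
  by rewrite -(RintegralZl _ mO i2); apply: eq_Rintegral => x _; rewrite sqE.
rewrite -mulrDr sqrtrM// sqrtr_sqr gtr0_norm//.
Qed.

(** Every L^2 function with linear modulus of continuity is in H^t for t < 1:
    far shifts are controlled by the L^2 norm, so the previous bound applies
    with eps = 1. *)
Lemma shift_sq_Hfrac O t (g : E -> R) (A : R) : (2 <= d)%N -> 0 < t -> t < 1 ->
  measurable O -> L2 setT g -> 0 <= A ->
  (forall h, shift_sq g h <= (A * enorm h ^+ 2)%:E)%E -> Hfrac O t g.
Proof.
move=> d2 t0 t1 mO Lg A0 hA; have [mg g2] := Lg.
split.
  split; first exact: measurable_funTS.
  apply: le_lt_trans g2; apply: ge0_subset_integral => //; first exact: measurable_sqr.
  by move=> x _; rewrite lee_fin sqr_ge0.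
have [C C0 hC] := gagliardo_bound d2 t0 t1.
have g20 : (0 <= \int[mu]_x (g x ^+ 2)%:E)%E.
  by apply: integral_ge0 => x _; rewrite lee_fin sqr_ge0.
have /fineK gE : (\int[mu]_x (g x ^+ 2)%:E)%E \is a fin_num by rewrite ge0_fin_numE.
pose Q := fine (\int[mu]_x (g x ^+ 2)%:E)%E; have Q0 : 0 <= Q by exact: fine_ge0.
pose B := A + 4 * Q; have B0 : 0 <= B by rewrite addr_ge0// mulr_ge0.
apply: le_lt_trans (hC O g B 1 mO mg B0 ltr01 _ _) (ltry _) => h.
  apply: le_trans (hA h) _; rewrite lee_fin ler_wpM2r ?sqr_ge0//.
  by rewrite /B lerDl mulr_ge0.
apply: le_trans (shift_sq_le4 h mg) _; rewrite -gE -EFinM lee_fin expr1n mulr1.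
by rewrite /B lerDr.
Qed.

End fractional.

(** * The regularization error in fractional norms *)

Section regularization_estimate.
Context {R : realType} {d : nat}.
Local Notation E := 'rV[R]_d.
Local Notation mu := (lebesgue_rV R d).
Variables (Omega : set E) (oO : open Omega) (r : R) (r0 : 0 < r) (Or : Omega `<=` cube r).
Let mO : measurable Omega := open_measurable_rV oO.
Variables (psi : E -> R) (rho : R) (k : nat).
Hypotheses (hpsi : Linfty psi) (rho0 : 0 < rho) (hsupp : supp_in_ball psi rho)
  (hmom : moments psi k).
Variables (i0 : 'I_d) (d2 : (2 <= d)%N).

Lemma regularizeE eps (e : E -> R) :
  regularize Omega psi eps e = convolve (delta_eps psi eps) (e \_ Omega).
Proof.
apply/funext => x; rewrite /regularize /convolve Rintegral_mkcond.
by apply: eq_Rintegral => y _; rewrite !patchE; case: ifP => //; rewrite mulr0.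
Qed.

Lemma extension_L2 (e : E -> R) : L2 Omega e -> L2 setT (e \_ Omega).
Proof.
move=> Le; split; first exact: measurable_extension.
by rewrite integral_extension; exact: Le.2.
Qed.

Lemma extension_integrable (e : E -> R) : L2 Omega e ->
  mu.-integrable setT (EFin \o (e \_ Omega)).
Proof.
move=> Le; rewrite -restrict_EFin; apply: (integrable_mkcond _ mO).1.
apply: (L2_integrable mO mO) => //.
apply: (@le_lt_trans _ _ (mu (cube r))); last first.
  by rewrite [X in (X < _)%E](lebesgue_cube d (ltW r0)) ltry.
by apply: le_measure => //; rewrite inE//; exact: measurable_cube.
Qed.

(** With v the zero extension of e and w = delta_eps * v, the error g = v - w
    satisfies two bounds: its modulus of continuity is at most that of v up to
    a constant, hence of order |h|^2, and its L^2 norm squared is of order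
    eps^2. Interpolating them with the bound of the Gagliardo seminorm at t =
    1 - s gives the order eps^(2s). The first three memberships let the
    functional be applied to e and to its regularization separately. *)
Lemma regularization_estimate (eps0 s : R) : 0 < eps0 -> 0 < s -> s < 1 ->
  exists2 C : R, 0 <= C & forall eps (e : E -> R) (om : set E),
    0 < eps -> eps <= eps0 -> H10 Omega e -> measurable om -> om `<=` Omega ->
    [/\ Hfrac om (1 - s) e, Hfrac om (1 - s) (regularize Omega psi eps e),
        Hfrac om (1 - s) (e - regularize Omega psi eps e) &
        Hfracnorm om (1 - s) (e - regularize Omega psi eps e) ^+ 2 <=
          C * (eps `^ s) ^+ 2 * gradsq Omega e].
Proof.
move=> eps00 s0 s1; set t := 1 - s.
have t0 : 0 < t by rewrite /t subr_gt0.
have t1 : t < 1 by rewrite /t; lra.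
have [M M0 hM] := Linfty_bound hpsi.
have hr := ess_supp_ball hsupp; have mpsi := hpsi.1.
have hI := Linfty_integral (ltW rho0) mpsi hM hr.
set K := `|M| * (rho *+ 2) ^+ d in hI.
have K0 : 0 < K by rewrite mulr_gt0 ?exprn_gt0// ?normr_gt0 ?gt_eqF// pmulrn_lgt0.
have [Cg Cg0 hCg] := gagliardo_bound d2 t0 t1.
pose cA : R := 2 ^+ d * 4; have cA0 : 0 <= cA by rewrite mulr_ge0 ?exprn_ge0.
pose cB : R := 2 * (1 + K * K) + 4 * (K * K * rho ^+ 2).
have KK0 : 0 <= K * K by rewrite mulr_ge0 ?(ltW K0).
have KR0 : 0 <= K * K * rho ^+ 2 by rewrite mulr_ge0 ?sqr_ge0.
have c1 : 0 <= 2 * (1 + K * K) by rewrite mulr_ge0// addr_ge0.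
have c2 : 0 <= 4 * (K * K * rho ^+ 2) by rewrite mulr_ge0.
have c3 : 0 <= K * K * (cA * rho ^+ 2) by rewrite mulr_ge0// mulr_ge0 ?sqr_ge0.
have cB0 : 0 <= cB by rewrite addr_ge0.
pose cL := K * K * (cA * rho ^+ 2) * eps0 `^ (2 * t).
exists (cL + Cg * (cA * cB)).
  by rewrite addr_ge0// mulr_ge0 ?powR_ge0// mulr_ge0.
move=> eps e om e0 ee0 He mom omO.
have Le := He.1.1.
set G := gradsq Omega e; have G0 : 0 <= G := gradsq_ge0 Omega e.
pose v : E -> R := e \_ Omega; pose kp := delta_eps psi eps.
have iv : mu.-integrable setT (EFin \o v) by exact: extension_integrable.
have Lv : L2 setT v by exact: extension_L2.
have mv := Lv.1.
pose A := cA * G; have A0 : 0 <= A by rewrite mulr_ge0.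
have hA h : (shift_sq v h <= (A * enorm h ^+ 2)%:E)%E.
  have := H10_shift oO h He; congr (_ <= _%:E)%E.
  by rewrite /A /cA -/G; ring.
have mk : measurable_fun setT kp by exact: delta_measurable.
have kM := delta_bound e0 hM.
have kK : (\int[mu]_z `|kp z|%:E <= K%:E)%E by rewrite delta_integral.
have krho := delta_supp e0 hr.
have k1 x : \int[mu]_y kp (x - y) = 1.
  by apply: (delta_unit mpsi e0 i0 x _ hmom); apply: le_lt_trans hI (ltry _).
pose w := convolve kp v; have mw : measurable_fun setT w := convolve_measurable mk iv.
pose g : E -> R := fun x => v x - w x.
have mg : measurable_fun setT g by exact: measurable_funB.
have gL := convolve_dist mk K0 kM kK krho k1 iv A0 hA.
have wA h : (shift_sq w h <= (K * K * A * enorm h ^+ 2)%:E)%E.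
  apply: le_trans (convolve_shift mk K0 kM kK iv h) _.
  by rewrite -[K * K * A * _]mulrA [leRHS]EFinM lee_wpmul2l.
have Lg : L2 setT g by split => //; exact: le_lt_trans gL (ltry _).
have Lw : L2 setT w.
  apply: (@L2_eq _ _ _ _ (v - g)) => //; last exact: L2B.
  by move=> x _; rewrite !fctE /g; ring.
have KA0 : 0 <= K * K * A by rewrite mulr_ge0.
have B0 : 0 <= A * cB by rewrite mulr_ge0.
have g1 h : (shift_sq g h <= (A * cB * enorm h ^+ 2)%:E)%E.
  apply: (@le_trans _ _ (2%:E * (shift_sq v h + shift_sq w h))%E).
    have := integral_sqrB measurableT (measurable_funB (measurable_shift h mv) mv)
      (measurable_funB (measurable_shift h mw) mw).
    congr (_ <= _)%E; apply: eq_integral => x _; rewrite /g /=; congr (_%:E); ring.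
  apply: (@le_trans _ _ (2%:E * ((A * enorm h ^+ 2)%:E + (K * K * A * enorm h ^+ 2)%:E))%E).
    by rewrite lee_wpmul2l// leeD.
  rewrite -EFinD -EFinM lee_fin.
  rewrite (_ : 2 * _ = A * (2 * (1 + K * K)) * enorm h ^+ 2); last by ring.
  by rewrite ler_wpM2r ?sqr_ge0// ler_wpM2l// /cB lerDl.
have g2 h : (shift_sq g h <= (A * cB * eps ^+ 2)%:E)%E.
  apply: le_trans (shift_sq_le4 h mg) _.
  apply: (@le_trans _ _ (4%:E * (K * K * (A * (rho * eps) ^+ 2))%:E)%E).
    by rewrite lee_wpmul2l.
  rewrite -EFinM lee_fin.
  rewrite (_ : 4 * _ = A * (4 * (K * K * rho ^+ 2)) * eps ^+ 2); last by ring.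
  by rewrite ler_wpM2r ?sqr_ge0// ler_wpM2l// /cB lerDr.
have ev x : om x -> e x = v x by move=> /omO Ox; rewrite /v patchE mem_set.
have rw : regularize Omega psi eps e = w by rewrite regularizeE.
have eg x : om x -> (e - regularize Omega psi eps e) x = g x.
  by move=> ox; rewrite rw !fctE ev.
have Hg : Hfrac om t g by exact: (shift_sq_Hfrac d2 t0 t1 mom Lg B0 g1).
split.
- by apply: Hfrac_eq ev _ => //; exact: (shift_sq_Hfrac d2 t0 t1 mom Lv A0 hA).
- by rewrite rw; exact: (shift_sq_Hfrac d2 t0 t1 mom Lw KA0 wA).
- exact: Hfrac_eq eg Hg.
have [Lgo gg] := Hg.
(* The L^2 part is of order eps^2, better than needed: the surplus power of
   eps is absorbed by eps0. *)
have I1 : \int[mu]_(x in om) ((e - regularize Omega psi eps e) x ^+ 2) <=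
    K * K * (A * (rho * eps) ^+ 2).
  have -> : \int[mu]_(x in om) ((e - regularize Omega psi eps e) x ^+ 2) =
      \int[mu]_(x in om) (g x ^+ 2).
    by apply: eq_Rintegral => x /set_mem ox; rewrite eg.
  rewrite -lee_fin /Rintegral fineK; last first.
    by apply: integrable_fin_num => //; exact: L2_sqr_integrable.
  apply: le_trans gL; apply: ge0_subset_integral => //; first exact: measurable_sqr.
  by move=> x _; rewrite lee_fin sqr_ge0.
have I2 : fine (gagliardo om t (e - regularize Omega psi eps e)) <=
    Cg * (A * cB) * eps `^ (2 * (1 - t)).
  rewrite (gagliardo_eq t eg) -lee_fin fineK ?ge0_fin_numE ?gagliardo_ge0//.
  exact: hCg.
rewrite /Hfracnorm sqr_sqrtr; last first.
  apply: addr_ge0; last by rewrite fine_ge0 ?gagliardo_ge0.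
  by apply: Rintegral_ge0 => x _; rewrite sqr_ge0.
apply: le_trans (lerD I1 I2) _.
have es2 : (eps `^ s) ^+ 2 = eps `^ (2 * s).
  by rewrite -powR_mulrn ?powR_ge0// -powRrM mulrC.
have e2 : eps ^+ 2 <= eps0 `^ (2 * t) * eps `^ (2 * s).
  have -> : eps ^+ 2 = eps `^ (2 * t) * eps `^ (2 * s).
    rewrite -powRD; last by apply/implyP => _; rewrite gt_eqF.
    rewrite -powR_mulrn ?(ltW e0)//; congr powR; rewrite /t; ring.
  rewrite ler_wpM2r ?powR_ge0//; apply: ge0_ler_powR; rewrite ?nnegrE ?(ltW e0) ?(ltW eps00)//.
  by rewrite mulr_ge0// ltW.
rewrite es2 (_ : 2 * (1 - t) = 2 * s); last by rewrite /t; ring.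
rewrite (mulrDl cL) (mulrDl (cL * _)) lerD//.
  have -> : K * K * (A * (rho * eps) ^+ 2) = K * K * (cA * rho ^+ 2) * G * eps ^+ 2.
    by rewrite /A; ring.
  have -> : cL * eps `^ (2 * s) * G =
      K * K * (cA * rho ^+ 2) * G * (eps0 `^ (2 * t) * eps `^ (2 * s)).
    by rewrite /cL; ring.
  by rewrite ler_wpM2l// mulr_ge0.
by rewrite le_eqVlt; apply/orP; left; apply/eqP; rewrite /A; ring.
Qed.

End regularization_estimate.

Unset Implicit Arguments.
Set Strict Implicit.

Theorem theorem4p3 (R : realType) (m : nat) (hd : m.+1 = 2%N \/ m.+1 = 3%N)
  (Omega omega : set 'rV[R]_m.+1)
  (hOmega : lipschitz_domain Omega) (bOmega : bounded_set Omega)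
  (homega : lipschitz_domain omega) (homegaO : omega `<=` Omega)
  (c0 : R) (hc0 : 0 < c0)
  (hdist : (c0%:E < set_dist (boundary omega) (boundary Omega))%E)
  (A : 'rV[R]_m.+1 -> 'M[R]_m.+1) (c : 'rV[R]_m.+1 -> R)
  (hAc : admissible_coefficients Omega A c)
  (psi : 'rV[R]_m.+1 -> R) (r0 : R) (k : nat)
  (hpsi : Linfty psi) (hr0 : 0 < r0) (hsupp : supp_in_ball psi r0)
  (hmom : moments psi k)
  (eps0 : R) (heps0 : 0 < eps0) (hr0eps0 : r0 * eps0 <= c0)
  (s : R) (hs0 : 0 < s) (hs : s <= 2^-1) :
  exists C : R,
    forall F Fomega : ('rV[R]_m.+1 -> R) -> R,
      Hm1 Omega F -> supp_sm1 Omega omega s F Fomega ->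
    forall eps : R, 0 < eps -> eps <= eps0 ->
    forall u ueps : 'rV[R]_m.+1 -> R,
      solution Omega A c F u ->
      solution Omega A c (regularize_dual Omega psi eps Fomega) ueps ->
      H1norm Omega (u - ueps)
        <= C * eps `^ s * Hmfracnorm omega (1 - s) Fomega.
Proof.
have [[oO _ _] _] := hOmega; have [[oo _ _] _] := homega.
have mo := open_measurable_rV oo.
have d2 : (2 <= m.+1)%N by case: hd => ->.
have s1 : s < 1 by apply: le_lt_trans hs _; rewrite invf_lt1// ltr1n.
have [r rpos Or] := bounded_cube bOmega.
have [a0 a0pos hcoer] := energy_coercive oO bOmega hAc.
have [C1 C10 hC1] := regularization_estimate oO rpos Or hpsi hr0 hsupp hmom
  (@ord0 m) d2 heps0 hs0 s1.
have hP := poincare oO (@ord0 m) rpos Or.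
set CP := 2 ^+ m.+1 * 8 * (2 * r + 1) ^+ 2 in hP.
have CP0 : 0 <= CP by rewrite mulr_ge0 ?sqr_ge0// mulr_ge0 ?exprn_ge0.
exists (Num.sqrt (CP + 1) * Num.sqrt C1 / a0) => F Fom _ [hFom hF] eps e0 ee0 u ueps
  [Hu solu] [Hueps solueps].
pose e := u - ueps; have He : H10 Omega e := H10B oO Hu Hueps.
have [Xe Xr Xd hN] := hC1 eps e omega e0 ee0 He mo homegaO.
set N := Hmfracnorm omega (1 - s) Fom.
have XZ (a : R) v : 0 < a -> Hfrac omega (1 - s) v ->
    Hfrac omega (1 - s) (a *: v) /\
    Hfracnorm omega (1 - s) (a *: v) = a * Hfracnorm omega (1 - s) v.
  exact: HfracZ.
have X0 : Hfrac omega (1 - s) (0 : 'rV[R]_m.+1 -> R) := Hfrac0 omega (1 - s).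
have N0 v : 0 <= Hfracnorm omega (1 - s) v by exact: sqrtr_ge0.
have Nge0 : 0 <= N := dual_norm_ge0 hFom X0 XZ N0.
(* The two problems are tested with their difference e; the right-hand sides
   differ by the regularization error of e. *)
have key : energy_form Omega A c u e - energy_form Omega A c ueps e =
    Fom (e - regularize Omega psi eps e).
  by rewrite (solu e He) (solueps e He) (hF e He.1) (dual_sub hFom Xe Xr).
have coer := hcoer u ueps Hu.1 Hueps.1.
have G0 := gradsq_ge0 Omega e; have hPe := hP e He.
have dn := dual_norm_le hFom X0 XZ N0 Xd.
set G := gradsq Omega e in hN G0 hPe.
have bnd : a0 * G <= N * (Num.sqrt C1 * eps `^ s * Num.sqrt G).
  apply: le_trans coer _; rewrite -/e key.
  apply: le_trans (ler_norm _) _; apply: le_trans dn _.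
  rewrite -/N ler_wpM2l//.
  rewrite -[leLHS]ger0_norm// -sqrtr_sqr.
  rewrite [X in _ <= _ * X * _](_ : _ = Num.sqrt ((eps `^ s) ^+ 2)); last first.
    by rewrite sqrtr_sqr ger0_norm ?powR_ge0.
  by rewrite -sqrtrM// -sqrtrM ?ler_wsqrtr// mulr_ge0 ?sqr_ge0.
(* Division by the Dirichlet norm of e, which may vanish. *)
have sG : a0 * Num.sqrt G <= N * (Num.sqrt C1 * eps `^ s).
  have [sG0|sGpos] := leP (Num.sqrt G) 0.
    apply: (@le_trans _ _ 0); first by rewrite mulr_ge0_le0// ltW.
    by rewrite !mulr_ge0 ?sqrtr_ge0 ?powR_ge0.
  have GG : Num.sqrt G * Num.sqrt G = G by rewrite -expr2 sqr_sqrtr.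
  by rewrite -(ler_pM2r sGpos) -[leLHS]mulrA GG -[leRHS]mulrA.
have -> : H1norm Omega (u - ueps) = Num.sqrt (L2sq Omega e + G) by [].
apply: (@le_trans _ _ (Num.sqrt (CP + 1) * Num.sqrt G)).
  rewrite -sqrtrM ?addr_ge0//; apply: ler_wsqrtr.
  by rewrite mulrDl mul1r lerD2r.
rewrite -!mulrA ler_wpM2l ?sqrtr_ge0//.
rewrite [leRHS](_ : _ = N * (Num.sqrt C1 * eps `^ s) / a0); last first.
  by move: (N) (Num.sqrt C1) (eps `^ s) (a0^-1) => *; ring.
by rewrite ler_pdivlMr// mulrC.
Qed.
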